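(* There is an algorithm (based on building an Aho–Corasick-type automaton recognizing the parent-distance tables of all Cartesian trees in $\{C(p)\}\cup ng(C(p))$) which, given sequences $p$ of length $m$ and $t$ of length $n$ (of pairwise distinct integers), computes the number of positions $j\in\{1,\ldots,n-m+1\}$ such that $t[j\ldots j+m-1]\overset{\tau}{\approx}_{CT} p$, in $\mathcal{O}((m^2+n)\log m)$ worst-case time and $\mathcal{O}(m^2)$ space.
   Context: All sequences are finite sequences of pairwise distinct integers, indexed from $1$; $x[i\ldots j]$ is the factor from position $i$ to $j$. The Cartesian tree $C(x)$ of a sequence $x$ of length $n$ is empty if $n=0$; otherwise, if $x[i]$ is the minimum of $x$, it is the binary tree with root $i$, left subtree $C(x[1\ldots i-1])$ and right subtree $C(x[i+1\ldots n])$. Write $x\approx_{CT} y$ if $C(x)=C(y)$. For $1\le i\le n-1$, $\tau(x,i)$ is obtained from $x$ by exchanging the entries at positions $i$ and $i+1$. Write $x\overset{\tau}{\approx}_{CT} y$ (for $x,y$ of the same length $n$) if $x\approx_{CT} y$, or there is $i\in\{1,\ldots,n-1\}$ with $\tau(x,i)\approx_{CT} y$ or $\tau(y,i)\approx_{CT} x$. For a Cartesian tree $T$ with $n$ nodes and $1\le i\le n-1$, $ng(T,i)=\{C(\tau(x,i)) : C(x)=T\}$ and $ng(T)=\bigcup_{i=1}^{n-1}ng(T,i)$. The parent-distance table of $x$ is $\overrightarrow{PD}_x[i]=i-\max\{j<i : x[j]<x[i]\}$ if such $j$ exists and $0$ otherwise; it determines $C(x)$ uniquely. *)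

(* Defs.v *)
From HB Require Import structures.
From mathcomp Require Import all_boot all_order all_algebra.
Set Implicit Arguments. Unset Strict Implicit. Unset Printing Implicit Defensive.
Import Order.TTheory GRing.Theory Num.Theory.

(* Sequences are seq int; positions in the paper are 1-based.               *)

(* Cartesian trees are represented by their shapes: the node labels         *)
(* (positions) are determined by the in-order traversal of the shape.       *)
Inductive ctree := CLeaf | CNode of ctree & ctree.

Definition ctree_eq_dec (a b : ctree) : {a = b} + {a <> b}.
Proof. decide equality. Defined.

Definition ctree_eqb (a b : ctree) : bool :=
  if ctree_eq_dec a b then true else false.

Definition seqmin (x : seq int) : int :=
  foldr (fun a b => Num.min a b) (head 0%R x) x.

(* C(x): root at the position of the minimum, left subtree C(x[1..i-1]),   *)
(* right subtree C(x[i+1..n]); fuel = size x is always sufficient.         *)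
Fixpoint ct_fuel (k : nat) (x : seq int) : ctree :=
  match k with
  | 0 => CLeaf
  | k'.+1 =>
      if x is [::] then CLeaf
      else let i := index (seqmin x) x in
           CNode (ct_fuel k' (take i x)) (ct_fuel k' (drop i.+1 x))
  end.

Definition cartesian_tree (x : seq int) : ctree := ct_fuel (size x) x.

Definition ct_equiv (x y : seq int) : bool :=
  ctree_eqb (cartesian_tree x) (cartesian_tree y).

(* tau(x, i): exchange entries at (1-based) positions i and i+1 *)
Definition tau (x : seq int) (i : nat) : seq int :=
  take i.-1 x ++ [:: nth 0%R x i; nth 0%R x i.-1] ++ drop i.+1 x.

Definition tau_ct_equiv (x y : seq int) : bool :=
  (size x == size y) &&
  [|| ct_equiv x y
    | has (fun i => ct_equiv (tau x i) y || ct_equiv (tau y i) x)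
          (iota 1 (size x).-1) ].

(* factor t[j .. j+m-1] (1-based j) *)
Definition factor (t : seq int) (j m : nat) : seq int := take m (drop j.-1 t).

Definition tau_ct_count (p t : seq int) : nat :=
  count (fun j => tau_ct_equiv (factor t j (size p)) p)
        (iota 1 (if size p <= size t then (size t - size p).+1 else 0)).

(* Memory: cells indexed by nat holding natural-number words, all initially *)
(* 0.  Every value written must be < W (the word bound), where              *)
(* W = (m + n + 2)^c for a program-chosen constant c (word size O(log N)).  *)
(* The input sequences p, t are on a read-only tape; their (integer)        *)
(* symbols can only be compared with each other (comparison model for the   *)
(* input alphabet).  Each instruction costs one unit of time; space is the  *)
(* number of memory cells used, i.e. 1 + the largest address written.       *)

Inductive src := SrcP | SrcT.

Inductive instr :=
| IConst of nat & nat
| IAdd of nat & nat & nat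
| ISub of nat & nat & nat
| IMul of nat & nat & nat
| IDiv of nat & nat & nat
| ILt of nat & nat & nat
| IEq of nat & nat & nat
| ILoad of nat & nat
| IStore of nat & nat
| IJz of nat & nat
| IJmp of nat
| ILen of nat & src
| ICmp of nat & src & nat & src & nat
| IHalt of nat.

Record rstate := RState { pc : nat; mem : nat -> nat; spc : nat }.

Definition init_state : rstate := RState 0 (fun _ => 0) 0.

Definition wr (W : nat) (s : rstate) (d v : nat) : option rstate :=
  if v < W then
    Some (RState (pc s).+1 (fun i => if i == d then v else mem s i)
                 (maxn (spc s) d.+1))
  else None.

Definition tape (x : src) (p t : seq int) : seq int :=
  if x is SrcP then p else t.

Definition sym (x : src) (p t : seq int) (i : nat) : option int :=
  if (0 < i) && (i <= size (tape x p t)) then Some (nth 0%R (tape x p t) i.-1)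
  else None.

(* one step: None = error (stuck), Some (inl s') = continue,
   Some (inr o) = halted with output o *)
Definition step (prog : seq instr) (p t : seq int) (W : nat) (s : rstate)
  : option (rstate + nat) :=
  let M := mem s in
  let cont := fun o => omap inl o in
  if pc s < size prog then
  match nth (IHalt 0) prog (pc s) with
  | IConst d k => cont (wr W s d k)
  | IAdd d a b => cont (wr W s d (M a + M b))
  | ISub d a b => cont (wr W s d (M a - M b))
  | IMul d a b => cont (wr W s d (M a * M b))
  | IDiv d a b => if M b == 0 then None else cont (wr W s d (M a %/ M b))
  | ILt d a b => cont (wr W s d (M a < M b))
  | IEq d a b => cont (wr W s d (M a == M b))
  | ILoad d a => cont (wr W s d (M (M a)))
  | IStore a x => cont (wr W s (M a) (M x))
  | IJz a l => Some (inl (RState (if M a == 0 then l else (pc s).+1) M (spc s)))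
  | IJmp l => Some (inl (RState l M (spc s)))
  | ILen d x => cont (wr W s d (size (tape x p t)))
  | ICmp d x a y b =>
      match sym x p t (M a), sym y p t (M b) with
      | Some u, Some v => cont (wr W s d (u < v)%R)
      | _, _ => None
      end
  | IHalt a => Some (inr (M a))
  end
  else None.

Fixpoint run (prog : seq instr) (p t : seq int) (W : nat) (fuel : nat)
         (s : rstate) : option (nat * nat * nat) :=
  match fuel with
  | 0 => None
  | f.+1 =>
      match step prog p t W s with
      | None => None
      | Some (inr o) => Some (o, 1, spc s)
      | Some (inl s') =>
          match run prog p t W f s' with
          | Some (o, k, sp) => Some (o, k.+1, sp)
          | None => None
          end
      end
  end.

Definition runs_to (prog : seq instr) (p t : seq int) (W o k sp : nat) : Prop :=
  exists fuel, run prog p t W fuel init_state = Some (o, k, sp).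

(* Main.v *)
(* The Cartesian tree of a window is encoded by the parentheses that the
   classical stack algorithm produces: every element closes the entries that it
   pops and then opens itself.  Dropping the first element of a window erases the
   first opening parenthesis and its partner, so an Aho-Corasick automaton over
   these two letters has as failure function the iteration of that erasure, and
   the whole text is read in amortised constant time per element.

   The relation depends on the values and not only on the trees: a window whose
   tree is a neighbour of that of [p] need not be in relation with [p].  If the
   larger of the two entries of [p] exchanged at [i] is forgotten, the trees that
   remain for [p] and for the window must agree, which leaves a linear number of
   trees for all [i] together; they are inserted in a trie, each labelled with
   its unique [i].  At such a leaf, exchanging the entries of the window gives
   the tree of [p] if and only if the larger entry lies between two entries of
   the window whose positions depend only on [i], which takes two comparisons. *)

(* The linear count comes from where the larger entry can stand. Let [q] ascend at [i], and let the
   exchange at [i] in the window give the tree of [q]. In the window the larger entry precedes the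
   smaller one, and on its left only its rank among the right-spine entries above [q i] matters.
   Such a spine position [f] has [i] as its next smaller position, so [f] determines [i]; this
   leaves at most [m] pairs, plus one lowest rank per [i]. What the pattern cannot fix is how the
   larger entry compares with what follows [i.+1]: this is what the two comparisons recover.
   Descents of [q] become ascents by reversal, which preserves equality of Cartesian trees. In the
   other half of the relation [p] itself is exchanged, which prescribes the tree of the window
   completely; these words carry a flag that accepts without comparisons. Time is counted in loop
   iterations of a small structured language. Compilation turns an iteration into boundedly many
   machine steps, each pass raising the values by a bounded amount, so words of polynomial range
   suffice. *)
Require Import Defs.
From mathcomp Require Import all_boot all_order all_algebra.
From mathcomp Require Import zify.
Set Implicit Arguments. Unset Strict Implicit. Unset Printing Implicit Defensive.
Import Order.TTheory GRing.Theory Num.Theory.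

(** * A structured language and its compilation *)

Inductive expr :=
| Num of nat
| Var of nat
| Inc of expr & nat
| Sub of expr & expr
| Lt of expr & expr
| Get of nat & expr.

Record state := State { var : nat -> nat; arr : nat -> nat -> nat }.

Definition setv s x v :=
  State (fun y => if y == x then v else var s y) (arr s).
Definition seta s a i v :=
  State (var s) (fun b j => if (b == a) && (j == i) then v else arr s b j).

Fixpoint eval s e :=
  match e with
  | Num k => k
  | Var x => var s x
  | Inc e k => eval s e + k
  | Sub a b => eval s a - eval s b
  | Lt a b => nat_of_bool (eval s a < eval s b)
  | Get a e => arr s a (eval s e)
  end.

Inductive cmd :=
| Skip
| Set_ of nat & expr
| Put of nat & expr & expr
| Cmp of nat & src & expr & src & expr
| Len of nat & src
| Seq of cmd & cmd
| If of expr & cmd & cmd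
| While of expr & cmd.

(** * Cost semantics and program logic with an iteration budget *)

Section Semantics.
Variables (p t : seq int) (sb : nat).

(* The cost of an execution is its number of loop iterations. *)
Inductive exec : cmd -> state -> nat -> state -> Prop :=
| ESkip s : exec Skip s 0 s
| ESet s x e : exec (Set_ x e) s 0 (setv s x (eval s e))
| EPut s a i e : eval s i < sb ->
    exec (Put a i e) s 0 (seta s a (eval s i) (eval s e))
| ECmp s x y i z j :
    0 < eval s i <= size (tape y p t) -> 0 < eval s j <= size (tape z p t) ->
    exec (Cmp x y i z j) s 0
      (setv s x (nth 0%R (tape y p t) (eval s i).-1 <
                 nth 0%R (tape z p t) (eval s j).-1)%R)
| ELen s x y : exec (Len x y) s 0 (setv s x (size (tape y p t)))
| ESeq c1 c2 s k1 s1 k2 s2 : exec c1 s k1 s1 -> exec c2 s1 k2 s2 ->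
    exec (Seq c1 c2) s (k1 + k2) s2
| EIfT e c1 c2 s k s' : eval s e != 0 -> exec c1 s k s' ->
    exec (If e c1 c2) s k s'
| EIfF e c1 c2 s k s' : eval s e = 0 -> exec c2 s k s' ->
    exec (If e c1 c2) s k s'
| EWhF e c s : eval s e = 0 -> exec (While e c) s 0 s
| EWhT e c s k1 s1 k2 s2 : eval s e != 0 -> exec c s k1 s1 ->
    exec (While e c) s1 k2 s2 -> exec (While e c) s (k1 + k2).+1 s2.

(* [T] is a budget of loop iterations; the postcondition receives what is left of it. *)
Definition tri s c T (Q : nat -> state -> Prop) :=
  exists k s', [/\ exec c s k s', k <= T & Q (T - k) s'].

Lemma tri_skip s T (Q : nat -> state -> Prop) : Q T s -> tri s Skip T Q.
Proof. by move=> H; exists 0, s; split=> //; [constructor|rewrite subn0]. Qed.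

Lemma tri_set s x e T (Q : nat -> state -> Prop) :
  Q T (setv s x (eval s e)) -> tri s (Set_ x e) T Q.
Proof. by move=> H; eexists 0, _; split=> //; [constructor|rewrite subn0]. Qed.

Lemma tri_put s a i e T (Q : nat -> state -> Prop) :
  eval s i < sb -> Q T (seta s a (eval s i) (eval s e)) ->
  tri s (Put a i e) T Q.
Proof. by move=> Hi H; eexists 0, _; split=> //; [constructor|rewrite subn0]. Qed.

Lemma tri_cmp s x y i z j T (Q : nat -> state -> Prop) :
  0 < eval s i <= size (tape y p t) -> 0 < eval s j <= size (tape z p t) ->
  Q T (setv s x (nth 0%R (tape y p t) (eval s i).-1 <
                 nth 0%R (tape z p t) (eval s j).-1)%R) ->
  tri s (Cmp x y i z j) T Q.
Proof.
by move=> H1 H2 H; eexists 0, _; split=> //; [exact: ECmp|rewrite subn0].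
Qed.

Lemma tri_len s x y T (Q : nat -> state -> Prop) :
  Q T (setv s x (size (tape y p t))) -> tri s (Len x y) T Q.
Proof. by move=> H; eexists 0, _; split=> //; [constructor|rewrite subn0]. Qed.

Lemma tri_seq s c1 c2 T Q :
  tri s c1 T (fun T1 s1 => tri s1 c2 T1 Q) -> tri s (Seq c1 c2) T Q.
Proof.
move=> [k1 [s1 [H1 H2 [k2 [s2 [H3 H4 H5]]]]]].
exists (k1 + k2), s2; split; first exact: ESeq H1 H3.
  by rewrite -(subnKC H2) leq_add2l.
by rewrite subnDA.
Qed.

Lemma tri_if s e c1 c2 T Q :
  (eval s e != 0 -> tri s c1 T Q) -> (eval s e = 0 -> tri s c2 T Q) ->
  tri s (If e c1 c2) T Q.
Proof.
move=> H1 H2; case: (eqVneq (eval s e) 0) => He.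
  by have [k [s' [A1 A2 A3]]] := H2 He; exists k, s'; split=> //; exact: EIfF.
by have [k [s' [A1 A2 A3]]] := H1 He; exists k, s'; split=> //; exact: EIfT.
Qed.

Fixpoint mvar c : seq nat :=
  match c with
  | Set_ x _ | Cmp x _ _ _ _ | Len x _ => [:: x]
  | Seq a b | If _ a b => mvar a ++ mvar b
  | While _ a => mvar a
  | _ => [::]
  end.

Fixpoint marr c : seq nat :=
  match c with
  | Put a _ _ => [:: a]
  | Seq a b | If _ a b => marr a ++ marr b
  | While _ a => marr a
  | _ => [::]
  end.

(** A purely syntactic frame, derived once from the execution, so that loop invariants mention only
    what the body changes. Arrays are framed as a whole, not cell by cell. *)
Definition same c s s' :=
  (forall x, x \notin mvar c -> var s' x = var s x) /\
  (forall a i, a \notin marr c -> arr s' a i = arr s a i).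

Lemma same_refl c s : same c s s. Proof. by []. Qed.

Lemma exec_same c s k s' : exec c s k s' -> same c s s'.
Proof.
elim=> {c s k s'} //=; try by move=> *; split=> //= x; rewrite inE => /negPf->.
- by move=> s a i e _; split=> //= b j; rewrite inE => /negPf->.
- move=> c1 c2 s k1 s1 k2 s2 _ [A1 A2] _ [B1 B2]; split=> [x|x i];
    rewrite mem_cat negb_or => /andP[h1 h2]; by rewrite ?B1 ?A1 ?B2 ?A2.
- move=> e c1 c2 s k s' _ _ [A1 A2]; split=> [x|x i];
    rewrite mem_cat negb_or => /andP[h1 h2]; by rewrite ?A1 ?A2.
- move=> e c1 c2 s k s' _ _ [A1 A2]; split=> [x|x i];
    rewrite mem_cat negb_or => /andP[h1 h2]; by rewrite ?A1 ?A2.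
- move=> e c s k1 s1 k2 s2 _ _ [A1 A2] _ [B1 B2].
  by split=> [x|x i] h; rewrite ?B1 ?A1 ?B2 ?A2.
Qed.

Lemma tri_use s c T (P Q : nat -> state -> Prop) :
  tri s c T P -> (forall T' s', same c s s' -> P T' s' -> Q T' s') -> tri s c T Q.
Proof.
move=> [k [s' [H1 H2 H3]]] H; exists k, s'; split=> //; apply: H H3.
exact: exec_same H1.
Qed.

(** Each iteration pays one unit, so strong induction on the budget also proves termination and the
    budget serves as the variant. The frame relative to the entry state [s0] is carried along beside
    [I]. *)
Lemma tri_while (I : nat -> state -> Prop) s0 e c T (Q : nat -> state -> Prop) :
  I T s0 ->
  (forall T' s, same c s0 s -> I T' s -> eval s e != 0 ->
     0 < T' /\ tri s c T'.-1 I) ->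
  (forall T' s, same c s0 s -> I T' s -> eval s e = 0 -> Q T' s) ->
  tri s0 (While e c) T Q.
Proof.
move=> HI Hb Hq.
have: same c s0 s0 by exact: same_refl.
move: HI; move: {1 3 4}s0 => s; elim/ltn_ind: T s => T IH s HI Hs.
case: (eqVneq (eval s e) 0) => He.
  exists 0, s; split=> //; first exact: EWhF.
  by rewrite subn0; apply: Hq.
have [T0 [k [s1 [H1 H2 H3]]]] := Hb _ _ Hs HI He.
have Hs1 : same c s0 s1.
  have [A1 A2] := exec_same H1; case: Hs => B1 B2.
  by split=> *; rewrite ?A1 ?B1 ?A2 ?B2.
have [|k2 [s2 [H4 H5 H6]]] := IH (T.-1 - k) _ s1 H3 Hs1.
  by rewrite -subn1; lia.
exists (k + k2).+1, s2; split; first exact: EWhT H1 H4.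
  lia.
by have -> : T - (k + k2).+1 = T.-1 - k - k2 by lia.
Qed.

End Semantics.

(* Variables live in cells below 48, cells 48 to 63 are
   registers for expressions, cell [i] of array [a] is at [64 + 16 i + a]. *)

Fixpoint cexp d e : seq instr :=
  match e with
  | Num k => [:: IConst d k]
  | Var x => [:: IConst d 0; IAdd d d x]
  | Inc e k => cexp d e ++ [:: IConst d.+1 k; IAdd d d d.+1]
  | Sub a b => cexp d a ++ cexp d.+1 b ++ [:: ISub d d d.+1]
  | Lt a b => cexp d a ++ cexp d.+1 b ++ [:: ILt d d d.+1]
  | Get a e => cexp d e ++
      [:: IConst d.+1 16; IMul d d d.+1; IConst d.+1 (64 + a);
          IAdd d d d.+1; ILoad d d]
  end.

Fixpoint ccmd o c : seq instr :=
  match c with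
  | Skip => [::]
  | Set_ x e => cexp 48 e ++ [:: IConst 49 0; IAdd x 48 49]
  | Put a i e => cexp 48 i ++
      [:: IConst 49 16; IMul 48 48 49; IConst 49 (64 + a); IAdd 48 48 49] ++
      cexp 49 e ++ [:: IStore 48 49]
  | Cmp x y i z j => cexp 48 i ++ cexp 49 j ++ [:: ICmp x y 48 z 49]
  | Len x y => [:: ILen x y]
  | Seq a b => let ca := ccmd o a in ca ++ ccmd (o + size ca) b
  | If e a b =>
      let ce := cexp 48 e in
      let ca := ccmd (o + (size ce).+1) a in
      let ob := o + (size ce).+1 + (size ca).+1 in
      let cb := ccmd ob b in
      ce ++ IJz 48 ob :: ca ++ IJmp (ob + size cb) :: cb
  | While e a =>
      let ce := cexp 48 e in
      let ca := ccmd (o + (size ce).+1) a in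
      ce ++ IJz 48 (o + (size ce).+1 + (size ca).+1) :: ca ++ [:: IJmp o]
  end.

(** The bound on [d] keeps the scratch register [d.+1] of [Inc] and [Get] below cell 64, where the
    arrays begin. *)
Fixpoint wfe d e :=
  (d < 62) &&
  match e with
  | Num _ => true
  | Var x => x < 48
  | Inc e _ => wfe d e
  | Sub a b | Lt a b => wfe d a && wfe d.+1 b
  | Get a e => (a < 16) && wfe d e
  end.

Fixpoint wfc c :=
  match c with
  | Skip => true
  | Set_ x e => (x < 48) && wfe 48 e
  | Put a i e => [&& a < 16, wfe 48 i & wfe 49 e]
  | Cmp x _ i _ j => [&& x < 48, wfe 48 i & wfe 49 j]
  | Len x _ => x < 48
  | Seq a b => wfc a && wfc b
  | If e a b => [&& wfe 48 e, wfc a & wfc b]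
  | While e a => wfe 48 e && wfc a
  end.

(* Growth rates: each straight-line pass raises the largest value by at most this much. *)
Fixpoint gre e :=
  match e with
  | Num k => k
  | Var _ => 0
  | Inc e k => gre e + k
  | Sub a b => gre a + gre b
  | Lt a b => (gre a + gre b).+1
  | Get _ e => gre e
  end.

Fixpoint grc c :=
  match c with
  | Skip | Len _ _ => 0
  | Set_ _ e => gre e
  | Put _ i e => gre i + gre e
  | Cmp _ _ i _ j => (gre i + gre j).+1
  | Seq a b => grc a + grc b
  | If e a b => gre e + grc a + grc b
  | While e a => gre e + grc a
  end.

Local Notation cell := Defs.mem.

(** * Correctness of the compilation to machine code *)

Section Simulation.
Variables (p t : seq int) (W : nat) (prog : seq instr).

Fixpoint reach k rs rs' : Prop :=
  if k is k'.+1 then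
    exists2 rs1, step prog p t W rs = Some (inl rs1) & reach k' rs1 rs'
  else rs' = rs.

Lemma reach_trans k1 k2 r1 r2 r3 :
  reach k1 r1 r2 -> reach k2 r2 r3 -> reach (k1 + k2) r1 r3.
Proof.
elim: k1 r1 => [|k1 IH] r1 /= => [-> //|[r h1 h2] h3].
by exists r => //; exact: IH.
Qed.

Lemma runS f s : run prog p t W f.+1 s =
  match step prog p t W s with
  | None => None
  | Some (inr o) => Some (o, 1, spc s)
  | Some (inl s') => if run prog p t W f s' is Some (o, k, sp)
                     then Some (o, k.+1, sp) else None
  end.
Proof. by []. Qed.

Lemma reach_run k rs rs' o :
  reach k rs rs' -> step prog p t W rs' = Some (inr o) ->
  run prog p t W k.+1 rs = Some (o, k.+1, spc rs').
Proof.
elim: k rs => [|k IH] rs; first by move=> /= -> ->.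
by move=> [r h1 h2] h3; rewrite runS h1 (IH _ h2 h3).
Qed.

Definition code_at o l := exists pre post, prog = pre ++ l ++ post /\ size pre = o.

Lemma code_at_cat o a b :
  code_at o (a ++ b) -> code_at o a /\ code_at (o + size a) b.
Proof.
rewrite /code_at => -[pre [post [-> <-]]]; split; first by exists pre, (b ++ post); rewrite -catA.
by exists (pre ++ a), post; rewrite size_cat -!catA.
Qed.

Lemma code_at_cons o i l :
  code_at o (i :: l) -> [/\ o < size prog, nth (IHalt 0) prog o = i & code_at o.+1 l].
Proof.
rewrite /code_at => -[pre [post [-> <-]]]; split.
- by rewrite size_cat /=; lia.
- by rewrite nth_cat ltnn subnn.
- by exists (rcons pre i), post; rewrite size_rcons cat_rcons.
Qed.

Definition wrs rs d v :=
  RState (pc rs).+1 (fun i => if i == d then v else cell rs i)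
         (maxn (spc rs) d.+1).

Lemma wr_ok rs d v : v < W -> wr W rs d v = Some (wrs rs d v).
Proof. by rewrite /wr => ->. Qed.

Definition simul s rs :=
  (forall x, x < 48 -> cell rs x = var s x) /\
  (forall a i, a < 16 -> cell rs (64 + 16 * i + a) = arr s a i).

Lemma simul_frame s rs rs' :
  simul s rs -> (forall x, (x < 48) || (64 <= x) -> cell rs' x = cell rs x) -> simul s rs'.
Proof.
move=> [h1 h2] h; split=> [x hx|a i ha].
  by rewrite h ?hx // h1.
by rewrite h ?h2 //; lia.
Qed.

Definition bnd B s := (forall x, var s x <= B) /\ (forall a i, arr s a i <= B).

Lemma eval_bnd B s e : bnd B s -> eval s e <= B + gre e.
Proof.
move=> [h1 h2]; elim: e => //=; try by move=> *; lia.
- by move=> x; have := h1 x; lia.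
- by move=> a e _; have := h2 a (eval s e); lia.
Qed.

(** Registers are used as an upward stack: evaluation at [d] leaves everything below [d] intact, so
    a left operand survives the evaluation of the right one at [d.+1]. The constant 80 covers the
    address [64 + 16 * i + a] with [a < 16]. *)
Lemma cexp_ok e d o s rs B :
  code_at o (cexp d e) -> pc rs = o -> 48 <= d -> wfe d e -> simul s rs ->
  bnd B s -> 16 * (B + gre e) + 80 < W ->
  exists rs', [/\ reach (size (cexp d e)) rs rs', pc rs' = o + size (cexp d e),
    cell rs' d = eval s e,
    (forall x, (x < d) || (64 <= x) -> cell rs' x = cell rs x) &
    spc rs' <= maxn (spc rs) 64].
Proof.
elim: e d o rs => [k|x|e IH k|a IHa b IHb|a IHa b IHb|a e IH] d o rs /=
  hc ho hd /andP[hd2 hw] hr hB hW.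
- case/code_at_cons: hc => h1 h2 _.
  exists (wrs rs d k); split=> //=.
  + exists (wrs rs d k) => //; rewrite /step ho h1 h2 wr_ok //; lia.
  + by rewrite ho addn1.
  + by rewrite eqxx.
  + by move=> y hy; case: eqP => // e; lia.
  + lia.
- case/code_at_cons: hc => h1 h2 hc; case/code_at_cons: hc => h3 h4 _.
  have hx := hr.1 x hw; have hv := hB.1 x.
  exists (wrs (wrs rs d 0) d (var s x)); split=> /=.
  + exists (wrs rs d 0); first by rewrite /step ho h1 h2 wr_ok //; lia.
    eexists; last by [].
    rewrite /step /= ho h3 h4 eqxx.
    have -> : (x == d) = false by apply/eqP; lia.
    by rewrite hx add0n wr_ok //; lia.
  + by rewrite ho addn2.
  + by rewrite eqxx.
  + by move=> y hy; case: eqP => // e; lia.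
  + lia.
- have [hc1 hc2] := code_at_cat hc.
  have [|r [a1 a2 a3 a4 a5]] := IH _ _ _ hc1 ho hd hw hr hB; first lia.
  have hv := eval_bnd e hB.
  case/code_at_cons: hc2 => h1 h2 hc2; case/code_at_cons: hc2 => h3 h4 _.
  exists (wrs (wrs r d.+1 k) d (eval s e + k)); rewrite size_cat /=; split=> /=.
  + apply: reach_trans a1 _; exists (wrs r d.+1 k).
      by rewrite /step a2 h1 h2 wr_ok //; lia.
    eexists; last by [].
    rewrite /step /= a2 h3 h4 eqxx.
    have -> : (d == d.+1) = false by apply/eqP; lia.
    by rewrite a3 wr_ok //; lia.
  + lia.
  + by rewrite eqxx.
  + move=> y hy; case: eqP => [|_]; first lia.
    case: eqP => [|_]; first lia.
    exact: a4.
  + lia.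
- have [hc1 hc2] := code_at_cat hc; have [hc3 hc4] := code_at_cat hc2.
  case/andP: hw => hw1 hw2.
  have [|r [a1 a2 a3 a4 a5]] := IHa _ _ _ hc1 ho hd hw1 hr hB; first lia.
  have hr1 : simul s r by apply: simul_frame hr _ => x hx; apply: a4; lia.
  have [||r' [b1 b2 b3 b4 b5]] := IHb _ _ _ hc3 a2 _ hw2 hr1 hB; try lia.
  have hv := eval_bnd a hB.
  case/code_at_cons: hc4 => h1 h2 _.
  exists (wrs r' d (eval s a - eval s b)); rewrite !size_cat /=; split=> /=.
  + apply: reach_trans a1 _; apply: reach_trans b1 _.
    eexists; last by [].
    rewrite /step b2 h1 h2 b3 b4 ?a3 ?wr_ok //; lia.
  + lia.
  + by rewrite eqxx.
  + move=> y hy; case: eqP => [|_]; first lia.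
    by rewrite b4 ?a4 //; lia.
  + lia.
- have [hc1 hc2] := code_at_cat hc; have [hc3 hc4] := code_at_cat hc2.
  case/andP: hw => hw1 hw2.
  have [|r [a1 a2 a3 a4 a5]] := IHa _ _ _ hc1 ho hd hw1 hr hB; first lia.
  have hr1 : simul s r by apply: simul_frame hr _ => x hx; apply: a4; lia.
  have [||r' [b1 b2 b3 b4 b5]] := IHb _ _ _ hc3 a2 _ hw2 hr1 hB; try lia.
  case/code_at_cons: hc4 => h1 h2 _.
  exists (wrs r' d (nat_of_bool (eval s a < eval s b))); rewrite !size_cat /=; split=> /=.
  + apply: reach_trans a1 _; apply: reach_trans b1 _.
    eexists; last by [].
    rewrite /step b2 h1 h2 b3 b4 ?a3 ?wr_ok //; try lia.
  + lia.
  + by rewrite eqxx.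
  + move=> y hy; case: eqP => [|_]; first lia.
    by rewrite b4 ?a4 //; lia.
  + lia.
- case/andP: hw => ha hw.
  have [hc1 hc2] := code_at_cat hc.
  have [|r [a1 a2 a3 a4 a5]] := IH _ _ _ hc1 ho hd hw hr hB; first lia.
  have hv := eval_bnd e hB; have hv2 := hB.2 a (eval s e).
  have hr1 : simul s r by apply: simul_frame hr _ => x hx; apply: a4; lia.
  case/code_at_cons: hc2 => h0 h1 hc2.
  case/code_at_cons: hc2 => h2 h3 hc2.
  case/code_at_cons: hc2 => h4 h5 hc2.
  case/code_at_cons: hc2 => h6 h7 hc2.
  case/code_at_cons: hc2 => h8 h9 hc2.
  pose r1 := wrs r d.+1 16; pose r2 := wrs r1 d (eval s e * 16).
  pose r3 := wrs r2 d.+1 (64 + a); pose r4 := wrs r3 d (eval s e * 16 + (64 + a)).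
  have hd1 : (d == d.+1) = false by apply/eqP; lia.
  have hd2' : (d.+1 == d) = false by apply/eqP; lia.
  exists (wrs r4 d (arr s a (eval s e))); rewrite size_cat /=; split=> /=.
  + apply: reach_trans a1 _; exists r1.
      by rewrite /step a2 h0 h1 wr_ok //; lia.
    exists r2; first by rewrite /step /= a2 h2 h3 eqxx hd1 a3 wr_ok //; lia.
    exists r3; first by rewrite /step /= a2 h4 h5 wr_ok //; lia.
    exists r4; first by rewrite /step /= a2 h6 h7 !eqxx hd1 wr_ok //; lia.
    eexists; last by [].
    rewrite /step [pc _]/= a2 h8 h9.
    rewrite [cell r4 d]/= eqxx.
    have -> : cell r4 (eval s e * 16 + (64 + a)) = arr s a (eval s e).
      rewrite /r4 /r3 /r2 /r1 /=; do 2![case: eqP => [|_]; first lia].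
      by rewrite -(hr1.2 a (eval s e) ha); congr (cell r _); lia.
    by rewrite wr_ok //; lia.
  + lia.
  + by rewrite eqxx.
  + move=> y hy; rewrite /r4 /r3 /r2 /r1 /=; do 2![case: eqP => [|_]; first lia].
    exact: a4.
  + lia.
Qed.

Lemma simul_setv s rs x v : simul s rs -> x < 48 -> simul (setv s x v) (wrs rs x v).
Proof.
move=> [h1 h2] hx; split=> [y hy|a i ha] /=; first by rewrite h1.
by rewrite h2 //; case: eqP => //; lia.
Qed.

Lemma simul_seta s rs a i v : simul s rs -> a < 16 ->
  simul (seta s a i v) (wrs rs (64 + 16 * i + a) v).
Proof.
move=> [h1 h2] ha; split=> [y hy|b j hb] /=.
  by rewrite h1 //; case: eqP => //; lia.
rewrite h2 //; case: eqP => [e|e].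
  have -> : b = a by lia.
  have -> : j = i by lia.
  by rewrite !eqxx.
case: eqP => //= hba; case: eqP => //= hji; case: e; lia.
Qed.

Lemma bnd_weaken B B' s : bnd B s -> B <= B' -> bnd B' s.
Proof.
by move=> [h1 h2] h; split=> *; [apply: leq_trans (h1 _) h|apply: leq_trans (h2 _ _) h].
Qed.

Lemma bnd_setv B s x v : bnd B s -> v <= B -> bnd B (setv s x v).
Proof. by move=> [h1 h2] h; split=> //= y; case: eqP. Qed.

Lemma bnd_seta B s a i v : bnd B s -> v <= B -> bnd B (seta s a i v).
Proof. by move=> [h1 h2] h; split=> //= b j; case: andP. Qed.

(** Between two iterations only straight-line code runs, so [k] loop iterations amount to at most
    [k.+1] passes over the code. The same factor bounds the number of steps and, through [grc], the
    growth of the values. Quantifying over [B] lets consecutive executions be chained. *)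
Lemma exec_sim sb c s k s' : exec p t sb c s k s' -> forall o rs B,
  code_at o (ccmd o c) -> pc rs = o -> wfc c -> simul s rs -> bnd B s ->
  size p <= B -> size t <= B -> 16 * (B + k.+1 * grc c) + 96 < W ->
  spc rs <= 64 + 16 * sb ->
  exists n rs', [/\ reach n rs rs', n <= k.+1 * size (ccmd o c),
    pc rs' = o + size (ccmd o c),
    simul s' rs' /\ bnd (B + k.+1 * grc c) s' & spc rs' <= 64 + 16 * sb].
Proof.
elim=> {c s k s'}.
- move=> s o rs B hc ho hw hr hB hp ht hW hs; exists 0, rs; split=> //.
    by rewrite ho addn0.
  by split=> //; apply: bnd_weaken hB _; lia.
- move=> s x e o rs B /= /code_at_cat [hc hc2] ho /andP[hx he] hr hB hp ht hW hs.
  have [|r [a1 a2 a3 a4 a5]] := cexp_ok hc ho isT he hr hB; first lia.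
  have hv := eval_bnd e hB.
  case/code_at_cons: hc2 => h1 h2; case/code_at_cons => h3 h4 _.
  have hr1 : simul s (wrs r 49 0).
    apply: simul_frame hr _ => y hy /=.
    by case: eqP => [|_]; [lia|apply: a4; lia].
  exists (size (cexp 48 e) + 2), (wrs (wrs r 49 0) x (eval s e)).
  rewrite size_cat /=; split; try lia.
  + apply: reach_trans a1 _; exists (wrs r 49 0).
      by rewrite /step a2 h1 h2 wr_ok //; lia.
    eexists; last by [].
    by rewrite /step /= a2 h3 h4 /= a3 addn0 wr_ok //; lia.
  + split; first exact: simul_setv.
    by apply: bnd_setv; [apply: bnd_weaken hB _|]; lia.
- move=> s a i e hi o rs B /=.
  move=> /code_at_cat [hc]; rewrite -[_ :: _]/([:: _; _; _; _] ++ _).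
  move=> /code_at_cat [hc2] /code_at_cat [hc3 hc4] ho /and3P[ha hwi hwe].
  move=> hr hB hp ht hW hs.
  have [|r [a1 a2 a3 a4 a5]] := cexp_ok hc ho isT hwi hr hB; first lia.
  have hvi := eval_bnd i hB; have hve := eval_bnd e hB.
  case/code_at_cons: hc2 => h0 h1; case/code_at_cons => h2 h3.
  case/code_at_cons => h4 h5; case/code_at_cons => h6 h7 _.
  pose r1 := wrs r 49 16; pose r2 := wrs r1 48 (eval s i * 16).
  pose r3 := wrs r2 49 (64 + a); pose r4 := wrs r3 48 (eval s i * 16 + (64 + a)).
  have hr4 : simul s r4.
    apply: simul_frame hr _ => y hy; rewrite /r4 /r3 /r2 /r1 /=.
    by do 2![case: eqP => [|_]; first lia]; apply: a4; lia.
  have hpc : pc r4 = o + size (cexp 48 i) + 4 by rewrite /= a2; lia.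
  have hr14 : reach 4 r r4.
    exists r1; first by rewrite /step a2 h0 h1 wr_ok //; lia.
    exists r2; first by rewrite /step /= a2 h2 h3 /= a3 wr_ok //; lia.
    exists r3; first by rewrite /step /= a2 h4 h5 wr_ok //; lia.
    by exists r4 => //; rewrite /step /= a2 h6 h7 /= wr_ok //; lia.
  have [|r5 [b1 b2 b3 b4 b5]] := cexp_ok (d := 49) hc3 hpc isT hwe hr4 hB.
    lia.
  have hr5 : simul s r5 by apply: simul_frame hr4 _ => x hx; apply: b4; lia.
  case/code_at_cons: hc4 => h8 h9 _.
  have h48 : cell r5 48 = 64 + 16 * eval s i + a by rewrite b4 //= /r4 /=; lia.
  exists (size (cexp 48 i) + (4 + (size (cexp 49 e) + 1))),
    (wrs r5 (64 + 16 * eval s i + a) (eval s e)).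
  rewrite !size_cat /= ?size_cat /=; split.
  + apply: reach_trans a1 _; apply: reach_trans hr14 _; apply: reach_trans b1 _.
    eexists; last by [].
    rewrite /step b2 h8 h9 h48 b3 wr_ok //.
    lia.
  + lia.
  + by rewrite /= b2 /=; lia.
  + split; first exact: simul_seta.
    by apply: bnd_seta; [apply: bnd_weaken hB _|]; lia.
  + move: b5; rewrite /r4 /r3 /r2 /r1 /=; lia.
- move=> s x y i z j hi hj o rs B /=.
  move=> /code_at_cat [hc] /code_at_cat [hc2 hc3] ho /and3P[hx hwi hwj].
  move=> hr hB hp ht hW hs.
  have [|r [a1 a2 a3 a4 a5]] := cexp_ok hc ho isT hwi hr hB; first lia.
  have hr1 : simul s r by apply: simul_frame hr _ => u hu; apply: a4; lia.
  have [|r' [b1 b2 b3 b4 b5]] := cexp_ok (d := 49) hc2 a2 isT hwj hr1 hB; first lia.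
  have hr2 : simul s r' by apply: simul_frame hr1 _ => u hu; apply: b4; lia.
  case/code_at_cons: hc3 => h0 h1 _.
  set v := nat_of_bool _.
  have hv : v <= 1 by exact: leq_b1.
  exists (size (cexp 48 i) + (size (cexp 49 j) + 1)), (wrs r' x v).
  rewrite !size_cat /=; split.
  + apply: reach_trans a1 _; apply: reach_trans b1 _.
    eexists; last by [].
    by rewrite /step b2 h0 h1 b3 b4 // a3 /sym hi hj wr_ok //; lia.
  + lia.
  + by rewrite /= b2; lia.
  + split; first exact: simul_setv.
    by apply: bnd_setv; [apply: bnd_weaken hB _|]; lia.
  + rewrite /=; lia.
- move=> s x y o rs B /= /code_at_cons[h0 h1 _] ho hx hr hB hp ht hW hs.
  have hy : size (tape y p t) <= B by case: y {h1}.
  exists 1, (wrs rs x (size (tape y p t))); split=> //=; try lia.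
  + eexists; last by [].
    by rewrite /step ho h0 h1 wr_ok //; lia.
  + split; first exact: simul_setv.
    by apply: bnd_setv; [apply: bnd_weaken hB _|]; lia.
- move=> c1 c2 s k1 s1 k2 s2 _ IH1 _ IH2 o rs B /= /code_at_cat[hc1 hc2] ho.
  move=> /andP[hw1 hw2] hr hB hp ht hW hs.
  have [|n1 [r1 [a1 a2 a3 [a4 a6] a5]]] := IH1 o rs B hc1 ho hw1 hr hB hp ht _ hs.
    nia.
  have [|||n2 [r2 [b1 b2 b3 [b4 b6] b5]]] := IH2 _ _ _ hc2 a3 hw2 a4 a6 _ _ _ a5;
    try nia.
  exists (n1 + n2), r2; rewrite size_cat; split=> //; try nia.
  + exact: reach_trans a1 b1.
  + by split=> //; apply: bnd_weaken b6 _; nia.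
- move=> e c1 c2 s k s' he _ IH o rs B /= /code_at_cat[hc0].
  case/code_at_cons => h0 h1; rewrite -addnS => /code_at_cat[hc1].
  case/code_at_cons => h2 h3 hc2 ho.
  move=> /and3P[hwe hw1 hw2] hr hB hp ht hW hs.
  have [|r [a1 a2 a3 a4 a5]] := cexp_ok hc0 ho isT hwe hr hB; first nia.
  have hr1 : simul s (RState (pc r).+1 (cell r) (spc r)).
    by apply: simul_frame hr _ => u hu; apply: a4; lia.
  have [|||n [r2 [b1 b2 b3 [b4 b6] b5]]] :=
    IH _ (RState (pc r).+1 (cell r) (spc r)) _ hc1 _ hw1 hr1 hB hp ht;
    try (rewrite /=; nia).
  move: h2 h3 b1 b2 b3; set ca := ccmd _ c1; set ce := cexp _ _.
  set cb := ccmd _ c2 => h2 h3 b1 b2 b3.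
  exists (size ce + (n + 1).+1),
    (RState (o + (size ce).+1 + (size ca).+1 + size cb) (cell r2) (spc r2)).
  rewrite size_cat /= size_cat /=; split.
  + apply: reach_trans a1 _; exists (RState (pc r).+1 (cell r) (spc r)).
      by rewrite /step a2 h0 h1 a3 (negPf he).
    apply: reach_trans b1 _; eexists; last by [].
    by rewrite /step b3 h2 h3.
  + nia.
  + lia.
  + by split=> //; apply: bnd_weaken b6 _; nia.
  + by [].
- move=> e c1 c2 s k s' he _ IH o rs B /= /code_at_cat[hc0].
  case/code_at_cons => h0 h1; rewrite -addnS => /code_at_cat[hc1].
  case/code_at_cons => h2 h3; rewrite -addnS => hc2 ho.
  move=> /and3P[hwe hw1 hw2] hr hB hp ht hW hs.
  have [|r [a1 a2 a3 a4 a5]] := cexp_ok hc0 ho isT hwe hr hB; first nia.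
  move: h1 hc2; set ca := ccmd _ c1; set ob := _ + (size ca).+1 => h1 hc2.
  have hr1 : simul s (RState ob (cell r) (spc r)).
    by apply: simul_frame hr _ => u hu; apply: a4; lia.
  have [|||n [r2 [b1 b2 b3 [b4 b6] b5]]] :=
    IH _ (RState ob (cell r) (spc r)) _ hc2 _ hw2 hr1 hB hp ht;
    try (rewrite /=; nia).
  exists (size (cexp 48 e) + n.+1), r2.
  rewrite size_cat /= size_cat /=; split.
  + apply: reach_trans a1 _; eexists; last exact: b1.
    by rewrite /step a2 h0 h1 a3 he.
  + nia.
  + by rewrite b3 /ob; lia.
  + by split=> //; apply: bnd_weaken b6 _; nia.
  + by [].
- move=> e c s he o rs B /= /code_at_cat[hc0].
  case/code_at_cons => h0 h1 _ ho /andP[hwe hw] hr hB hp ht hW hs.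
  have [|r [a1 a2 a3 a4 a5]] := cexp_ok hc0 ho isT hwe hr hB; first nia.
  move: h1; set ca := ccmd _ c; set ob := _ + (size ca).+1 => h1.
  exists (size (cexp 48 e) + 1), (RState ob (cell r) (spc r)).
  rewrite size_cat /= size_cat /=; split.
  + apply: reach_trans a1 _; eexists; last by [].
    by rewrite /step a2 h0 h1 a3 he.
  + nia.
  + by rewrite /ob; lia.
  + split; first by apply: simul_frame hr _ => u hu; apply: a4; lia.
    by apply: bnd_weaken hB _; nia.
  + rewrite /=; lia.
- move=> e c s k1 s1 k2 s2 he _ IH1 _ IH2 o rs B hcw ho hww hr hB hp ht hW hs.
  move: (hcw) (hww) => /= /code_at_cat[hc0].
  case/code_at_cons => h0 h1; rewrite -addnS => /code_at_cat[hc1].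
  case/code_at_cons => h2 h3 _ /andP[hwe hw1].
  have [|r [a1 a2 a3 a4 a5]] := cexp_ok hc0 ho isT hwe hr hB.
    by move: hW => /=; nia.
  have hr1 : simul s (RState (pc r).+1 (cell r) (spc r)).
    by apply: simul_frame hr _ => u hu; apply: a4; lia.
  have [|||n [r2 [b1 b2 b3 [b4 b6] b5]]] :=
    IH1 _ (RState (pc r).+1 (cell r) (spc r)) _ hc1 _ hw1 hr1 hB hp ht;
    try (move: hW => /=; nia).
  (* The backward jump changes only the program counter, so the remaining iterations are simulated
     from the same offset [o], with the bound raised by the first one. *)
  have hr2 : simul s1 (RState o (cell r2) (spc r2)) by [].
  have [|||||n2 [r3 [d1 d2 d3 [d4 d6] d5]]] :=
    IH2 o (RState o (cell r2) (spc r2)) _ hcw _ hww hr2 b6;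
    try (by []); try (move: hW => /=; nia).
  exists (size (cexp 48 e) + (n + n2.+1).+1), r3; split=> //.
  + apply: reach_trans a1 _; exists (RState (pc r).+1 (cell r) (spc r)).
      by rewrite /step a2 h0 h1 a3 (negPf he).
    apply: reach_trans b1 _; eexists; last exact: d1.
    by rewrite /step b3 h2 h3.
  + move: b2 d2; rewrite /= !size_cat /= !size_cat /=; nia.
  + by split=> //; apply: bnd_weaken d6 _ => /=; nia.
Qed.

End Simulation.

Lemma tri_runs_to p t c sb T r o W :
  wfc c -> r < 48 ->
  tri p t sb (State (fun=> 0) (fun _ _ => 0)) c T (fun _ s => var s r = o) ->
  16 * (size p + size t + T.+1 * grc c) + 96 < W ->
  exists k sp, [/\ runs_to (ccmd 0 c ++ [:: IHalt r]) p t W o k sp,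
    k <= (T.+1 * size (ccmd 0 c)).+1 & sp <= 64 + 16 * sb].
Proof.
move=> hw hr [k [s' [he hk ho]]] hW.
set prog := ccmd 0 c ++ _.
have hc : code_at prog 0 (ccmd 0 c) by exists [::], [:: IHalt r].
have hk' : k.+1 * grc c <= T.+1 * grc c by rewrite leq_mul2r ltnS hk orbT.
have [||||||n [rs' [a1 a2 a3 [a4 a6] a5]]] :=
  exec_sim (W := W) he (rs := init_state) (B := size p + size t) hc erefl hw.
- by [].
- by [].
- by rewrite leq_addr.
- by rewrite leq_addl.
- lia.
- by [].
exists n.+1, (Defs.spc rs'); split=> //.
- exists n.+1; rewrite (reach_run a1 (o := o)) //.
  rewrite /step a3 add0n /prog size_cat addn1 ltnSn nth_cat ltnn subnn /=.
  by rewrite a4.1 // ho.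
- by rewrite ltnS (leq_trans a2) // leq_mul2r ltnS hk orbT.
Qed.

(** * Cartesian trees and interval minima *)

(** Equivalently, [a] is on the stack of the classical algorithm once [b] has been read, that is, on
    the right spine of the Cartesian tree of the prefix of length [b]. *)
Definition LM (x : nat -> nat) a b := all (fun k => x a < x k) (iota a.+1 (b - a)).

Lemma LMP x a b : reflect (forall k, a < k <= b -> x a < x k) (LM x a b).
Proof.
apply: (iffP allP) => H k; rewrite ?mem_iota => hk; apply: H; rewrite ?mem_iota; lia.
Qed.

Definition ismin (x : nat -> nat) a c b := all (fun k => x c <= x k) (iota a (b.+1 - a)).

Lemma mnP x a c b : reflect (forall k, a <= k <= b -> x c <= x k) (ismin x a c b).
Proof.
apply: (iffP allP) => H k; rewrite ?mem_iota => hk; apply: H; rewrite ?mem_iota; lia.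
Qed.

Definition dinj (x : nat -> nat) n :=
  forall a b, 0 < a <= n -> 0 < b <= n -> x a = x b -> a = b.

Definition cteq x y n := forall a b, 0 < a -> a < b -> b <= n -> LM x a b = LM y a b.

(** A second form of equality of Cartesian trees. It is stable under reversal and under splitting at
    the minimum, whereas [cteq] matches a scan from left to right. *)
Definition cteqm x y n := forall a c b,
  0 < a -> a <= c -> c <= b -> b <= n -> ismin x a c b = ismin y a c b.

Lemma LM_mn x n a b : dinj x n -> 0 < a <= b -> b <= n -> LM x a b = ismin x a a b.
Proof.
move=> hx ha hb; apply/LMP/mnP => H k hk.
  by case: (eqVneq k a) => [->//|ne]; apply/ltnW/H; lia.
rewrite ltn_neqAle H; last lia.
by rewrite andbT; apply/eqP => e; have : a = k by [apply: hx; lia]; lia.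
Qed.

Lemma mn_exists x a b : a <= b -> exists2 c, a <= c <= b & ismin x a c b.
Proof.
elim: b => [|b IH] hab; first by exists 0; [lia|apply/mnP => k hk; have -> : k = 0 by lia].
case: (ltngtP a b.+1) hab => // [h _|-> _]; last first.
  by exists b.+1; [lia|apply/mnP => k hk; have -> : k = b.+1 by lia].
have [c hc /mnP hm] := IH h.
case: (leqP (x c) (x b.+1)) => hcb.
  exists c; first lia; apply/mnP => k hk.
  by case: (eqVneq k b.+1) => [->//|ne]; apply: hm; lia.
exists b.+1; first lia; apply/mnP => k hk.
by case: (eqVneq k b.+1) => [->//|ne]; apply: leq_trans (ltnW hcb) _; apply: hm; lia.
Qed.

(** Values on the stack at [b] increase with the position, so the first stack entry at or after [a]
    carries the minimum of the interval. *)
Lemma mn_LM x n a c b : dinj x n -> 0 < a -> a <= c <= b -> b <= n ->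
  ismin x a c b = LM x c b && all (fun d => ~~ LM x d b) (iota a (c - a)).
Proof.
move=> hx ha hc hb; apply/idP/idP => [/mnP H|/andP[/LMP H1 /allP H2]].
  apply/andP; split.
    rewrite (LM_mn hx) //; [apply/mnP => k hk|lia]; apply: H; lia.
  apply/allP => d; rewrite mem_iota => hd; apply/negP => /LMP hl.
  have h1 := hl c; have h2 := H d; lia.
have [e he /mnP hm] := @mn_exists x a b ltac:(lia).
have hle : LM x e b by rewrite (LM_mn hx) //; [apply/mnP => k hk; apply: hm|]; lia.
case: (ltngtP e c) => hec.
- have /H2 : e \in iota a (c - a) by rewrite mem_iota; lia.
  by rewrite hle.
- by have h1 := H1 e; have h2 := hm c; lia.
- by rewrite -hec; apply/mnP.
Qed.

Lemma cteqP x y n : dinj x n -> dinj y n -> cteq x y n <-> cteqm x y n.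
Proof.
move=> hx hy; split=> H.
  have H' a b : 0 < a -> a <= b -> b <= n -> LM x a b = LM y a b.
    move=> h1 h2 h3; case: (ltngtP a b) h2 => // [h _|-> _]; first exact: H.
    by rewrite /LM subnn.
  move=> a c b ha hac hcb hb; rewrite (mn_LM hx) ?(mn_LM hy) ?hac //.
  rewrite H' //; last lia; congr andb; apply: eq_in_all => d.
  by rewrite mem_iota => hd; rewrite H' //; lia.
by move=> a b ha hab hb; rewrite (LM_mn hx) ?(LM_mn hy) ?H //; lia.
Qed.

Lemma cteq_sym x y n : cteq x y n -> cteq y x n.
Proof. by move=> H a b *; rewrite H. Qed.

Lemma cteq_trans x y z n : cteq x y n -> cteq y z n -> cteq x z n.
Proof. by move=> H1 H2 a b *; rewrite H1 ?H2. Qed.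

Lemma eq_LM x x' a b : (forall k, a <= k <= b -> x k = x' k) -> a <= b ->
  LM x a b = LM x' a b.
Proof.
move=> H hab; apply: eq_in_all => k; rewrite mem_iota => hk.
by rewrite (H a) ?(H k) //; lia.
Qed.

Lemma eq_cteq x x' n : (forall k, 0 < k <= n -> x k = x' k) -> cteq x x' n.
Proof. by move=> H a b h1 h2 h3; apply: eq_LM => [k hk|]; [apply: H|]; lia. Qed.

(** * Factors, and order-isomorphic copies of integer sequences *)

Definition shift j (x : nat -> nat) k := x (j + k).

Lemma mn_shift j x a c b : ismin (shift j x) a c b = ismin x (j + a) (j + c) (j + b).
Proof.
apply/mnP/mnP => H k hk; last by apply: H; lia.
by have := H (k - j); rewrite /shift subnKC; [apply|]; lia.
Qed.

Lemma dinj_shift j x n n' : dinj x n -> j + n' <= n -> dinj (shift j x) n'.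
Proof. by move=> hx h a b ha hb /hx; lia. Qed.

Lemma dinj_leq x n n' : dinj x n -> n' <= n -> dinj x n'.
Proof. by move=> hx h a b ha hb; apply: hx; lia. Qed.

Definition repr (s : seq int) (x : nat -> nat) := forall a b,
  a < size s -> b < size s -> (nth 0%R s a < nth 0%R s b)%R = (x a.+1 < x b.+1).

Lemma repr_le s x a b : repr s x -> a < size s -> b < size s ->
  (nth 0%R s a <= nth 0%R s b)%R = (x a.+1 <= x b.+1).
Proof. by move=> H ha hb; rewrite leNgt H // -leqNgt. Qed.

Lemma repr_take s x i : repr s x -> repr (take i s) x.
Proof.
move=> H a b; rewrite !size_take_min !leq_min => /andP[h1 h2] /andP[h3 h4].
by rewrite !nth_take // H.
Qed.

Lemma repr_drop s x i : repr s x -> repr (drop i s) (shift i x).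
Proof.
move=> H a b; rewrite !size_drop => h1 h2.
by rewrite !nth_drop H /shift ?addnS //; lia.
Qed.

Lemma foldr_min_mem (h : int) s : foldr (fun a b => Num.min a b) h s \in h :: s.
Proof.
elim: s => [|u s IH] /=; first by rewrite inE eqxx.
rewrite minElt; case: ifP => _; first by rewrite !inE eqxx orbT.
by move: IH; rewrite !inE => /orP[->|->]; rewrite ?orbT.
Qed.

Lemma foldr_min_le (h : int) s z : z \in s ->
  (foldr (fun a b => Num.min a b) h s <= z)%R.
Proof.
elim: s => //= u s IH; rewrite inE => /orP[/eqP->|hz]; first by rewrite ge_min lexx.
by rewrite ge_min (IH hz) orbT.
Qed.

Lemma index_seqmin (s : seq int) : s != [::] ->
  index (seqmin s) s < size s /\
  forall k, k < size s -> (nth 0%R s (index (seqmin s) s) <= nth 0%R s k)%R.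
Proof.
case: s => // h s _.
have hm : seqmin (h :: s) \in h :: s.
  by have := foldr_min_mem h (h :: s); rewrite inE => /orP[/eqP e|//];
     rewrite /seqmin [head _ _]/= e inE eqxx.
split; first by rewrite index_mem.
by move=> k hk; rewrite nth_index //; apply: foldr_min_le; exact: mem_nth.
Qed.

Lemma index_seqmin_mn s x : repr s x -> s != [::] ->
  ismin x 1 (index (seqmin s) s).+1 (size s).
Proof.
move=> H hs; have [h1 h2] := index_seqmin hs; apply/mnP => k hk.
by have := h2 k.-1; rewrite (repr_le H) //; [rewrite prednK; [apply|]|]; lia.
Qed.

Fixpoint csize c := if c is CNode l r then (csize l + csize r).+1 else 0.

Lemma ct_fuelS k s : s != [::] ->
  ct_fuel k.+1 s = CNode (ct_fuel k (take (index (seqmin s) s) s))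
                         (ct_fuel k (drop (index (seqmin s) s).+1 s)).
Proof. by case: s. Qed.

Lemma csize_ct k s : size s <= k -> csize (ct_fuel k s) = size s.
Proof.
elim: k s => [|k IH] s hs; first by move: hs; rewrite leqn0 => /eqP->.
case: (eqVneq s [::]) => [->//|ns].
have [h1 _] := index_seqmin ns; rewrite ct_fuelS //=.
have e : size (take (index (seqmin s) s) s) = index (seqmin s) s.
  by rewrite size_takel // ltnW.
by rewrite !IH ?e ?size_drop; lia.
Qed.

Lemma mn_uniq x n a c c' b : dinj x n -> 0 < a -> b <= n -> a <= c <= b -> a <= c' <= b ->
  ismin x a c b -> ismin x a c' b -> c = c'.
Proof.
move=> hx ha hb hc hc' /mnP h1 /mnP h2; apply: hx; try lia.
by have := h1 c' hc'; have := h2 c hc; lia.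
Qed.

(** The root sits at the minimum of the whole range, and the size of the left subtree recovers its
    position. An interval either contains the root, which is then its minimum, or lies within one
    subtree, where the induction hypothesis applies. *)
Lemma ct_fuelP k k' s s' x x' : size s <= k -> size s' <= k' ->
  repr s x -> repr s' x' -> dinj x (size s) -> dinj x' (size s') ->
  ct_fuel k s = ct_fuel k' s' <-> size s = size s' /\ cteqm x x' (size s).
Proof.
elim: k k' s s' x x' => [|k IH] k' s s' x x' hs hs' hr hr' hi hi'.
  move: hs; rewrite leqn0 size_eq0 => /eqP es; subst s.
  split=> [e|[e _]]; last by move/esym/size0nil: e => ->; case: k' {hs'}.
  have e' : size s' = 0 by rewrite -(csize_ct hs') -e.
  by split=> // a c b; rewrite /=; lia.
case: (eqVneq s [::]) => [es|ns].
  subst s; split=> [e|[e _]]; last by move/esym/size0nil: e => ->; case: k' {hs'}.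
  have e' : size s' = 0 by rewrite -(csize_ct hs') -e.
  by split=> // a c b; rewrite /=; lia.
case: (eqVneq s' [::]) => [es|ns'].
  subst s'; split=> [e|[e _]]; last by move/size0nil: e ns => ->.
  have e' : size s = 0 by rewrite -(csize_ct hs) e; case: k' {hs' e}.
  by move/size0nil: e' ns => ->.
case: k' hs' => [|k'] hs'; first by move: hs' ns'; rewrite leqn0 size_eq0 => ->.
rewrite !ct_fuelS //.
have [hj _] := index_seqmin ns; have [hj' _] := index_seqmin ns'.
have hm := index_seqmin_mn hr ns; have hm' := index_seqmin_mn hr' ns'.
move: hj hj' hm hm'; move: (index _ s) (index _ s') => i i' hj hj' hm hm' /=.
have st : size (take i s) = i by rewrite size_takel // ltnW.
have st' : size (take i' s') = i' by rewrite size_takel // ltnW.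
have sd : size (drop i.+1 s) = size s - i.+1 by rewrite size_drop.
have sd' : size (drop i'.+1 s') = size s' - i'.+1 by rewrite size_drop.
have IHl := IH k' (take i s) (take i' s') x x'.
rewrite st st' in IHl.
have {}IHl := IHl ltac:(lia) ltac:(lia) (repr_take hr) (repr_take hr')
  (dinj_leq hi (ltnW hj)) (dinj_leq hi' (ltnW hj')).
have IHr := IH k' (drop i.+1 s) (drop i'.+1 s') (shift i.+1 x) (shift i'.+1 x').
rewrite sd sd' in IHr.
have hd : i.+1 + (size s - i.+1) <= size s by lia.
have hd' : i'.+1 + (size s' - i'.+1) <= size s' by lia.
have {}IHr := IHr ltac:(lia) ltac:(lia) (repr_drop hr) (repr_drop hr')
  (dinj_shift hi hd) (dinj_shift hi' hd').
split=> [[/IHl[e1 l1] /IHr[e2 l2]]|[e H]].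
  have ei : i' = i by lia.
  subst i'; have es : size s' = size s by lia.
  split=> // a c b ha hac hcb hb.
  case: (leqP b i) => hbi; first by apply: l1; lia.
  case: (leqP a i.+1) => hai; last first.
    have := l2 (a - i.+1) (c - i.+1) (b - i.+1).
    by rewrite !mn_shift !subnKC; try lia; apply; lia.
  case: (eqVneq c i.+1) => [->|ne].
    by apply/idP/idP => _; apply/mnP => k0 hk0;
       [apply: (mnP _ _ _ _ hm')|apply: (mnP _ _ _ _ hm)]; lia.
  apply/idP/idP => /mnP h; case/eqP: ne; [apply: hi|apply: hi']; try lia.
    have := h i.+1; have := mnP _ _ _ _ hm c; lia.
  have := h i.+1; have := mnP _ _ _ _ hm' c; lia.
have ei : i' = i.
  apply: succn_inj; apply: (mn_uniq hi' (a := 1) (b := size s')) => //; try lia.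
  by rewrite -e -H //; lia.
subst i'; congr CNode.
  apply/IHl; split; first lia.
  by move=> a c b h1 h2 h3 h4; apply: H; lia.
apply/IHr; split; first lia.
by move=> a c b h1 h2 h3 h4; rewrite !mn_shift; apply: H; lia.
Qed.

Lemma ct_equivP s s' x x' : repr s x -> repr s' x' ->
  dinj x (size s) -> dinj x' (size s') -> size s = size s' ->
  ct_equiv s s' <-> cteq x x' (size s).
Proof.
move=> hr hr' hi hi' es; rewrite /ct_equiv /ctree_eqb.
rewrite cteqP //; last by rewrite es.
have := ct_fuelP (leqnn _) (leqnn _) hr hr' hi hi'.
rewrite /cartesian_tree; case: ctree_eq_dec => [e|ne] H; split=> //.
  by move=> _; case: H => /(_ e)[].
by move=> h; case: ne; apply/H.
Qed.

(** * Parenthesis encodings *)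

Definition depf d (w : seq bool) := foldl (fun d (b : bool) => if b then d.+1 else d.-1) d w.

Definition dep w := depf 0 w.

(** A closing letter at depth 0 is ignored: it would close an element that is no longer represented
    in the word. *)
Definition step w b := if b || (0 < dep w) then rcons w b else w.

(** [d] counts the letters opened since the erased one and not yet closed; the closing letter met at
    [d = 0] is the partner of the erased one. If it has not arrived yet, nothing is removed. *)
Fixpoint rm d (w : seq bool) :=
  match w with
  | [::] => [::]
  | true :: u => true :: rm d.+1 u
  | false :: u => if d is d'.+1 then false :: rm d' u else u
  end.

Definition del (w : seq bool) :=
  match w with
  | [::] => [::]
  | true :: u => rm 0 u
  | false :: u => u
  end.

Lemma depf_cat d u v : depf d (u ++ v) = depf (depf d u) v.
Proof. by rewrite /depf foldl_cat. Qed.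

Lemma dep_rcons u b : dep (rcons u b) = if b then (dep u).+1 else (dep u).-1.
Proof. by rewrite -cats1 /dep depf_cat. Qed.

(** Two regimes: either the partner is still awaited, the depths differ by one and the search goes
    on in [v]; or it has been erased, the depths agree and [v] is copied. *)
Lemma rm_spec u d :
  (depf d.+1 u = (depf d (rm d u)).+1 /\
   forall v, rm d (u ++ v) = rm d u ++ rm (depf d (rm d u)) v) \/
  (depf d.+1 u = depf d (rm d u) /\ forall v, rm d (u ++ v) = rm d u ++ v).
Proof.
elim: u d => [|[] u IH] d /=; first by left.
  by have [[h1 h2]|[h1 h2]] := IH d.+1; [left|right]; split=> // v; rewrite h2.
case: d => [|d]; first by right.
by have [[h1 h2]|[h1 h2]] := IH d; [left|right]; split=> // v; rewrite h2.
Qed.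

(** The delicate case is the closing letter that matches the erased opening one: [step] appends it,
    [del] removes it again, and on the shorter word it arrives at depth 0 and is ignored. This
    commutation is what makes the failure function computable letter by letter. *)
Lemma del_step w b : w != [::] -> del (step w b) = step (del w) b.
Proof.
case: w => [//|[] u] _; last first.
  by rewrite /step /dep /=; case: ifP.
have hr : del (rcons (true :: u) b) = rm 0 (u ++ [:: b]) by rewrite cats1.
have [[h1 h2]|[h1 h2]] := rm_spec u 0.
  rewrite /step {1}/dep /= h1 orbT hr h2 /dep; case: b {hr} => /=.
    by rewrite cats1.
  by case: (depf 0 (rm 0 u)) => [|n] /=; rewrite ?cats1 ?cats0.
rewrite /step {1}/dep /= h1 /dep; case: ifP => //= _.
by rewrite -cats1 h2 cats1.
Qed.

Lemma size_rm d u : size (rm d u) <= size u.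
Proof. by elim: u d => [|[] u IH] [|d] //=; exact: IH. Qed.

Lemma size_del w : w != [::] -> size (del w) < size w.
Proof. by case: w => [//|[] u] _ //=; rewrite ltnS size_rm. Qed.

Lemma dep_del w : dep (del w) <= dep w.
Proof.
case: w => [//|[] u] //=; rewrite /dep /=.
by have [[-> _]|[-> _]] := rm_spec u 0.
Qed.

Lemma count_rm d u : count id (rm d u) = count id u.
Proof. by elim: u d => [|[] u IH] [|d] //=; rewrite IH. Qed.

Lemma count_del w : count id (del w) = count id w - head false w.
Proof. by case: w => [|[] u] //=; rewrite ?count_rm ?addnK ?subn0 // addKn. Qed.

Lemma dep_count w : dep w <= count id w.
Proof. by elim/last_ind: w => // w b IH; rewrite dep_rcons -cats1 count_cat /=; case: b; lia. Qed.

(** * The stack algorithm and the word it produces *)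

Fixpoint stack (x : nat -> nat) n : seq nat :=
  if n is k.+1 then
    k.+1 :: drop (find (fun a => x a <= x k.+1) (stack x k)) (stack x k)
  else [::].

(* The pops of element [n+1], not of element [n]. *)
Definition pops x n := find (fun a => x a <= x n.+1) (stack x n).

Fixpoint enc x n :=
  if n is k.+1 then rcons (enc x k ++ nseq (pops x k) false) true else [::].

Lemma stackS x n : stack x n.+1 = n.+1 :: drop (pops x n) (stack x n).
Proof. by []. Qed.

Lemma pops_size x n : pops x n <= size (stack x n).
Proof. exact: find_size. Qed.

Lemma depf_nseq d j : depf d (nseq j false) = d - j.
Proof. by elim: j d => [|j IH] d /=; rewrite ?subn0 // IH; lia. Qed.

Lemma dep_pop w j : dep (w ++ nseq j false) = dep w - j.
Proof. by rewrite /dep depf_cat depf_nseq. Qed.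

Lemma dep_enc x n : dep (enc x n) = size (stack x n).
Proof. by elim: n => // n IH; rewrite stackS /= dep_rcons dep_pop IH size_drop. Qed.

Lemma count_enc x n : count id (enc x n) = n.
Proof.
elim: n => // n IH /=; rewrite -cats1 !count_cat IH count_nseq /=; lia.
Qed.

Lemma size_enc x n : size (enc x n) <= 2 * n.
Proof.
suff : size (enc x n) + size (stack x n) = 2 * n by lia.
elim: n => // n IH; rewrite stackS /= size_rcons size_cat size_nseq size_drop.
have := pops_size x n; lia.
Qed.

Lemma stack_le x n a : a \in stack x n -> 0 < a <= n.
Proof.
elim: n => // n IH; rewrite stackS inE => /orP[/eqP->|/mem_drop/IH]; lia.
Qed.

Lemma stack_sorted x n :
  sorted (fun a b => (b < a) && (x b <= x a)) (stack x n).
Proof.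
elim: n => // n IH; rewrite stackS /=.
have : {subset drop (pops x n) (stack x n) <= stack x n} by move=> a; exact: mem_drop.
have := drop_sorted (pops x n) IH.
have : forall a, a \in take 1 (drop (pops x n) (stack x n)) -> x a <= x n.+1.
  move=> a; rewrite /pops; case: (boolP (has (fun a => x a <= x n.+1) (stack x n))).
    move=> h; rewrite (drop_nth 0) -?has_find //= take0 inE => /eqP->.
    exact: (@nth_find _ 0 (fun a => x a <= x n.+1)).
  by move/hasNfind=> ->; rewrite drop_size.
case: (drop _ _) => //= a s h1 h2 h3.
rewrite h2 andbT h1 ?inE ?eqxx // andbT.
by have := stack_le (h3 a (mem_head _ _)); lia.
Qed.

(** Values decrease towards the bottom of the stack, so all entries below the first survivor survive
    too: popping is filtering. *)
Lemma drop_find_sorted (T : eqType) (R : rel T) (P : pred T) s :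
  transitive R -> (forall a b, R a b -> P a -> P b) -> sorted R s ->
  drop (find P s) s = filter P s.
Proof.
move=> tR hP; elim: s => //= a s IH hs.
case: ifP => ha; last by rewrite /= IH // (path_sorted hs).
congr cons; apply/esym/all_filterP/allP => b hb.
by apply: hP ha; exact: (allP (order_path_min tR hs)).
Qed.

Lemma stackE x n : dinj x n -> stack x n = rev [seq a <- iota 1 n | LM x a n].
Proof.
elim: n => // n IH hx; rewrite stackS /pops.
rewrite (drop_find_sorted _ _ (stack_sorted x n)); first last.
- by move=> a b /andP[_]; exact: leq_trans.
- by move=> b a c /andP[h1 h2] /andP[h3 h4]; apply/andP; split; lia.
rewrite IH; last exact: dinj_leq hx _.
rewrite filter_rev -filter_predI -(addn1 n) iotaD filter_cat rev_cat add1n /= addn1.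
rewrite [LM x n.+1 n.+1]/LM subnn /=; congr (_ :: rev _).
apply: eq_in_filter => a; rewrite mem_iota /= => ha.
apply/andP/LMP => [[h1 /LMP h2] k hk|H]; last first.
  by split; [apply/ltnW/H; lia|apply/LMP => k hk; apply: H; lia].
case: (eqVneq k n.+1) => [->|ne]; last by apply: h2; lia.
rewrite ltn_neqAle h1 andbT; apply/eqP => e; have : a = n.+1 by [apply: hx; lia].
lia.
Qed.

(** A decoder that replays the stack: the number of elements read so far, together with the stack of
    their positions. *)
Definition sdec (w : seq bool) := foldl (fun (p : nat * seq nat) (b : bool) =>
  if b then (p.1.+1, p.1.+1 :: p.2) else (p.1, behead p.2)) (0, [::]) w.

Lemma sdec_enc x n : sdec (enc x n) = (n, stack x n).
Proof.
elim: n => // n IH; rewrite stackS /= -cats1 /sdec !foldl_cat -/(sdec _) IH /=.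
have -> j (s : seq nat) : foldl (fun (p : nat * seq nat) (b : bool) =>
  if b then (p.1.+1, p.1.+1 :: p.2) else (p.1, behead p.2)) (n, s) (nseq j false)
  = (n, drop j s) by elim: j s => [|j IHj] [|a s] //=; rewrite ?drop0 ?IHj.
by [].
Qed.

Lemma enc_rev x n : head true (rev (enc x n)).
Proof. by case: n => //= n; rewrite rev_rcons. Qed.

(** An encoding is empty or ends with an opening letter, so removing the last letter and the run of
    closing letters before it recovers the previous encoding. *)
Lemma encS_inj x y n : enc x n.+1 = enc y n.+1 -> enc x n = enc y n.
Proof.
rewrite /= => /rcons_inj[] /(congr1 rev); rewrite !rev_cat !rev_nseq.
pose strip (r : seq bool) := drop (find id r) r.
have H j z : strip (nseq j false ++ rev (enc z n)) = rev (enc z n).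
  rewrite /strip; elim: j => [|j IH] //=.
  by case: (rev _) (enc_rev z n) => [|[] u].
by move/(congr1 strip); rewrite !H => /(congr1 rev); rewrite !revK.
Qed.

Lemma enc_stack x y n : enc x n = enc y n <-> forall k, k <= n -> stack x k = stack y k.
Proof.
split=> [|H].
  elim: n => [|n IH] h k; first by rewrite leqn0 => /eqP->.
  rewrite leq_eqVlt => /orP[/eqP->|hk]; last by apply: IH => //; exact: encS_inj h.
  by have := sdec_enc x n.+1; rewrite h sdec_enc => e; exact: esym (congr1 snd e).
elim: n H => // n IH H /=; rewrite IH; last by move=> k hk; apply: H; lia.
congr (rcons (_ ++ nseq _ _) _).
have := congr1 size (H n.+1 (leqnn _)); rewrite !stackS /= !size_drop.
have := pops_size x n; have := pops_size y n; rewrite (H n) //; lia.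
Qed.

(** Equal words mean equal stacks after every prefix, and membership of [a] in the stack at [b] is
    [LM]. *)
Lemma enc_cteq x y n : dinj x n -> dinj y n -> enc x n = enc y n <-> cteq x y n.
Proof.
move=> hx hy; rewrite enc_stack; split=> H.
  move=> a b h1 h2 h3.
  have := H b h3; rewrite (stackE (dinj_leq hx h3)) (stackE (dinj_leq hy h3)).
  move/(congr1 (fun s => a \in s)); rewrite !mem_rev !mem_filter mem_iota.
  have -> : 0 < a < 1 + b by lia.
  by rewrite !andbT.
move=> k hk; rewrite (stackE (dinj_leq hx hk)) (stackE (dinj_leq hy hk)).
congr rev; apply: eq_in_filter => a; rewrite mem_iota => ha.
case: (eqVneq a k) => [->|ne]; first by rewrite /LM subnn.
by apply: H; lia.
Qed.

Lemma eq_stack x y n : (forall k, 0 < k <= n -> x k = y k) -> stack x n = stack y n.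
Proof.
elim: n => // n IH H; rewrite !stackS /pops IH; last by move=> k hk; apply: H; lia.
congr (_ :: drop _ _); apply: eq_in_find => a /stack_le ha /=.
by rewrite !H; lia.
Qed.

Lemma eq_enc x y n : (forall k, 0 < k <= n -> x k = y k) -> enc x n = enc y n.
Proof. by move=> H; apply/enc_stack => k hk; apply: eq_stack => i hi; apply: H; lia. Qed.

Lemma iter_pop w c : iter c (step^~ false) w = w ++ nseq (minn c (dep w)) false.
Proof.
elim: c => [|c IH]; first by rewrite min0n cats0.
rewrite iterS IH /step dep_pop orFb -cats1.
case: ifP => h; last by congr (_ ++ nseq _ _); lia.
have -> : minn c.+1 (dep w) = minn c (dep w) + 1 by lia.
by rewrite nseqD catA.
Qed.

Lemma encS x n : enc x n.+1 = step (iter (pops x n) (step^~ false) (enc x n)) true.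
Proof.
rewrite iter_pop dep_enc; have -> : minn (pops x n) (size (stack x n)) = pops x n.
  by have := pops_size x n; lia.
by [].
Qed.

(** Both runs make the same comparisons until the stack of the shorter sequence is exhausted; only
    the longer one can pop further, which explains the [minn]. *)
Lemma stack_shift x n : exists2 tl, stack x n.+1 = map S (stack (shift 1 x) n) ++ tl &
  minn (pops x n.+1) (size (stack (shift 1 x) n)) = pops (shift 1 x) n.
Proof.
have H m tl : stack x m.+1 = map S (stack (shift 1 x) m) ++ tl ->
   minn (pops x m.+1) (size (stack (shift 1 x) m)) = pops (shift 1 x) m /\
   exists tl', stack x m.+2 = map S (stack (shift 1 x) m.+1) ++ tl'.
  move=> e.
  have ef : find (fun a => x a <= x m.+2) (map S (stack (shift 1 x) m)) = pops (shift 1 x) m.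
    by rewrite find_map.
  have ep : pops x m.+1 = find (fun a => x a <= x m.+2)
     (map S (stack (shift 1 x) m) ++ tl) by rewrite -e.
  split.
    rewrite ep find_cat ef has_find ef size_map.
    by have := pops_size (shift 1 x) m; case: ifP; lia.
  rewrite stackS [stack (shift 1 x) _]stackS ep e find_cat has_find ef size_map.
  case: ifP => h.
    by exists tl; rewrite drop_cat size_map h /= map_drop.
  have -> : pops (shift 1 x) m = size (stack (shift 1 x) m).
    by have := pops_size (shift 1 x) m; lia.
  rewrite drop_size drop_cat size_map ltnNge leq_addr /=.
  by eexists.
elim: n => [|n [tl e _]].
  by exists [:: 1]; rewrite ?minn0.
have [_ [tl' e']] := H _ _ e; have [h _] := H _ _ e'.
by exists tl'.
Qed.

(** [del] passes through every [step]. The pops of the longer run beyond the shorter stack become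
    closing letters at depth 0, which [step] ignores, in agreement with the [minn] of
    [stack_shift]. *)
Lemma del_enc x n : del (enc x n.+1) = enc (shift 1 x) n.
Proof.
elim: n => // n IH; rewrite encS (encS (shift 1 x)).
have ne w : w != [::] -> forall b, step w b != [::].
  by case: w => // a w _ b; rewrite /step; case: ifP.
have ni w c : w != [::] -> iter c (step^~ false) w != [::].
  by move=> h; elim: c => //= c IHc; apply: ne.
have nx : enc x n.+1 != [::] by rewrite /= -size_eq0 size_rcons.
rewrite del_step; last exact: ni.
have -> : del (iter (pops x n.+1) (step^~ false) (enc x n.+1)) =
          iter (pops x n.+1) (step^~ false) (enc (shift 1 x) n).
  elim: (pops x n.+1) => //= c IHc.
  by rewrite del_step ?IHc //; apply: ni.
congr step; rewrite !iter_pop; congr (_ ++ nseq _ _); rewrite dep_enc.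
have [tl _ h] := stack_shift x n; have := pops_size (shift 1 x) n; lia.
Qed.

Lemma del_iter_enc x k n : iter k del (enc x (k + n)) = enc (shift k x) n.
Proof.
elim: k x => [|k IH] x; first exact: eq_enc.
rewrite iterSr addSn del_enc IH; apply: eq_enc => i _.
by rewrite /shift; congr x; lia.
Qed.

(** * Swapping two neighbours *)

Definition swap (x : nat -> nat) i k :=
  if k == i then x i.+1 else if k == i.+1 then x i else x k.

Definition ins (x : nat -> nat) i z k :=
  if k == i then z else if k == i.+1 then x i else x k.

Definition mirror m (x : nat -> nat) k := x (m.+1 - k).

Lemma LMS x a b : a <= b -> LM x a b.+1 = LM x a b && (x a < x b.+1).
Proof.
move=> hab; apply/LMP/andP => [H|[/LMP H1 H2] k hk].
  by split; [apply/LMP => k hk; apply: H|apply: H]; lia.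
by case: (eqVneq k b.+1) => [->//|ne]; apply: H1; lia.
Qed.

Lemma LM_refl x a : LM x a a. Proof. by rewrite /LM subnn. Qed.

Lemma LM1 x a : LM x a a.+1 = (x a < x a.+1).
Proof. by rewrite LMS // LM_refl. Qed.

Lemma LM_lt x a b k : LM x a b -> a < k <= b -> x a < x k.
Proof. by move/LMP; apply. Qed.

(* The larger of two neighbours moves across the smaller one, possibly changing its value. *)
Definition hop i (x y : nat -> nat) :=
  [/\ forall k, k != i -> k != i.+1 -> x k = y k,
      y i = x i.+1, x i.+1 < x i & x i.+1 < y i.+1].

Section Hop.
Variables (i : nat) (x y : nat -> nat).
Hypothesis H : hop i x y.

Lemma hop_out a b : a <= b -> (b < i) || (i.+1 < a) -> LM x a b = LM y a b.
Proof. by case: H => h _ _ _ hab hb; apply: eq_LM => // k hk; apply: h; lia. Qed.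

(** An interval that covers both positions sees only the smaller of the two entries, which has the
    same value on both sides. *)
Lemma hop_over a b : a < i -> i < b -> LM x a b = LM y a b.
Proof.
case: H => h1 h2 h3 h4 ha hb; have e : x a = y a by apply: h1; lia.
apply/LMP/LMP => h k hk.
  case: (eqVneq k i) => [->|n1]; first by rewrite h2 -e; apply: h; lia.
  case: (eqVneq k i.+1) => [->|n2]; last by rewrite -(h1 k n1 n2) -e; apply: h; lia.
  by rewrite -e; apply: ltn_trans h4; apply: h; lia.
have hu : x a < x i.+1 by rewrite -h2 e; apply: h; lia.
case: (eqVneq k i) => [->|n1]; first exact: ltn_trans h3.
case: (eqVneq k i.+1) => [->//|n2].
by rewrite (h1 k n1 n2) e; apply: h; lia.
Qed.

Lemma hop_from b : i < b -> LM x i b = false.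
Proof.
case: H => h1 h2 h3 h4 hb; apply/negP => h.
have := LM_lt h (k := i.+1); lia.
Qed.

Lemma hop_next b : i.+1 < b -> LM x i.+1 b = LM y i b.
Proof.
case: H => h1 h2 h3 h4 hb; apply/LMP/LMP => h k hk.
  case: (eqVneq k i.+1) => [->|n1]; first by rewrite h2.
  by rewrite h2 -(h1 k) //; [apply: h|]; lia.
by rewrite -h2 h1; [apply: h|..]; lia.
Qed.

(** Both intervals end just after the smaller entry; the larger one, met on the way in [x], imposes
    nothing more. *)
Lemma hop_to a : a < i -> LM y a i = LM x a i.+1.
Proof.
case: H => h1 h2 h3 h4 ha; rewrite hop_over // LMS ?(ltnW ha) //.
case E: (LM y a i) => //=; apply/esym; apply: ltn_trans h4.
by rewrite -h2; apply: (LM_lt E); lia.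
Qed.

Lemma hop_asc : LM y i i.+1.
Proof. by case: H => h1 h2 h3 h4; rewrite LM1 h2. Qed.

End Hop.

Lemma bounded_max (P : pred nat) n : (forall a, a < n -> ~~ P a) \/
  exists f, [/\ f < n, P f & forall a, f < a < n -> ~~ P a].
Proof.
elim: n => [|n [IH|[f [h1 h2 h3]]]]; first by left.
  case E: (P n); last by left=> a; rewrite ltnS leq_eqVlt => /orP[/eqP->|/IH//]; rewrite E.
  by right; exists n; split=> // a; lia.
case E: (P n); first by right; exists n; split=> // a; lia.
right; exists f; split=> //; first exact: ltnW.
move=> a ha; case: (eqVneq a n) => [->|ne]; first by rewrite E.
by apply: h3; lia.
Qed.

(* Values just above an entry of the right spine to the left of [i], or just above [q i]. *)
Definition zok (q : nat -> nat) i z := exists f,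
  z = (q f).+1 /\ (f = i \/ [/\ 0 < f < i, q i < q f & forall k, f < k < i -> q f < q k]).

(* [g] is the next smaller position of [i+1] ([m+1] if none) and [h] the minimum in between. *)
Definition bracket (q : nat -> nat) m i g h :=
  [/\ i.+1 < g <= m.+1,
      forall k, i.+1 < k < g -> q i.+1 < q k,
      g <= m -> q g < q i.+1 &
      i.+2 < g -> i.+1 < h < g /\ forall k, i.+1 < k < g -> q h <= q k].

(** The larger entry stands at [i] in the window and moves to [i.+1]. There its next smaller
    position must be [g]: it has to exceed the entry at [g] and lie below the minimum of the entries
    between. *)
Definition chk (w : nat -> nat) m i g h := (g <= m -> w g < w i) /\ (i.+2 < g -> w i < w h).

Lemma hop_ins q i z : q i < q i.+1 -> q i < z -> hop i (ins q i z) q.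
Proof.
move=> h1 h2; split; rewrite /ins ?eqxx ?(gtn_eqF (ltnSn i)) //.
by move=> k /negPf-> /negPf->.
Qed.

Lemma hop_swap w i : w i.+1 < w i -> hop i w (swap w i).
Proof.
move=> h; split; rewrite /swap ?eqxx ?(gtn_eqF (ltnSn i)) //.
by move=> k /negPf-> /negPf->.
Qed.

Lemma swap_asc w q m i : 0 < i < m -> q i < q i.+1 -> cteq (swap w i) q m -> w i.+1 < w i.
Proof.
move=> hi hq /(_ i i.+1); rewrite !LM1 hq /swap eqxx (gtn_eqF (ltnSn i)) eqxx => -> //; lia.
Qed.

(** [f] is the last suffix minimum of the prefix before [i] whose window value lies between the two
    exchanged entries, or [i] if there is none. A value just above [q f] then compares with all
    these suffix minima as [w i] does. *)
Lemma swap_pattern w q m i : dinj q m -> 0 < i < m -> q i < q i.+1 ->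
  cteq (swap w i) q m -> exists z, zok q i z /\ cteq w (ins q i z) m.
Proof.
move=> inj hi hq H.
have hu := swap_asc hi hq H; have hw := hop_swap hu.
have e a : a < i -> swap w i a = w a by move=> ha; rewrite /swap !ltn_eqF //; lia.
have ei : swap w i i = w i.+1 by rewrite /swap eqxx.
have ep a : a < i -> LM w a i.-1 -> a < i -> 0 < a -> (w a < w i.+1) = (q a < q i).
  move=> ha hl _ ha0; have := H a i ha0 ha ltac:(lia).
  have -> : i = i.-1.+1 by lia.
  rewrite !LMS; [|lia..]; rewrite prednK; last lia.
  rewrite e // ei.
  have E : LM (swap w i) a i.-1 by rewrite -(hop_out hw) //; lia.
  rewrite E; case: (ltngtP a i.-1) (ha) => [h _|h|-> _]; try lia.
    by rewrite -H ?E //; lia.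
  by rewrite LM_refl.
have eq_pre a : 0 < a -> a < i -> LM w a i.-1 = LM q a i.-1.
  move=> h1 h2; case: (ltngtP a i.-1) (h2) => [h _|h|-> _]; try lia.
    by rewrite (hop_out hw) ?H //; lia.
  by rewrite !LM_refl.
have [f [hf hz]] : exists f, (f = i \/ [/\ 0 < f < i, q i < q f & LM q f i.-1]) /\
   forall a, 0 < a < i -> LM q a i.-1 -> (w a < w i) = (q a <= q f).
  case: (bounded_max (fun a => [&& 0 < a, LM q a i.-1, q i < q a & w a < w i]) i).
    move=> hn; exists i; split; first by left.
    move=> a ha hl; case: (ltnP (q a) (q i)) => h.
      rewrite (ltnW h); have := ep a; rewrite eq_pre ?hl; try lia.
    have hne : q a != q i by apply/eqP => ee; have : a = i by [apply: inj; lia]; lia.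
    have := hn a ltac:(lia); rewrite hl; lia.
  move=> [f [h1 /and4P[h2 h3 h4 h5] h6]]; exists f; split; first by right; split=> //; lia.
  move=> a ha hl; case: (ltngtP a f) => haf.
  - have h7 : q a < q f by apply: (LM_lt hl); lia.
    have h8 : w a < w f by apply: (@LM_lt w a i.-1); [rewrite eq_pre //; lia|lia].
    lia.
  - have h7 : q f < q a by apply: (LM_lt h3); lia.
    have := h6 a ltac:(lia); rewrite hl; lia.
  - by rewrite haf h5 leqnn.
exists (q f).+1; split.
  exists f; split=> //; case: hf => [->|[h1 h2 h3]]; [by left|right; split=> // k hk].
  by apply: (LM_lt h3); lia.
have hz' : q i < (q f).+1 by case: hf => [->|[]]; lia.
have hQ := hop_ins hq hz'.
(* Both sides hop to sequences with equal trees, so the [hop] lemmas settle every pair except those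
   with [b = i], the only ones that depend on the chosen value. *)
move=> a b ha hab hb.
case: (ltngtP a i) => hai.
- case: (ltngtP b i) => hbi.
  + by rewrite (hop_out hw) ?(hop_out hQ) ?H //; lia.
  + by rewrite (hop_over hw) ?(hop_over hQ) ?H //; lia.
  + rewrite hbi; have -> : i = i.-1.+1 by lia.
    rewrite !LMS; [|lia..]; rewrite prednK; last lia.
    have -> : LM (ins q i (q f).+1) a i.-1 = LM q a i.-1 by apply: (hop_out hQ); lia.
    rewrite eq_pre //; case E: (LM q a i.-1) => //=.
    by rewrite hz //; [rewrite /ins eqxx !ltn_eqF //; lia|lia].
- case: (ltngtP a i.+1) => hai1; first lia.
    by rewrite (hop_out hw) ?(hop_out hQ) ?H //; lia.
  by rewrite hai1 (hop_next hw) ?(hop_next hQ) ?H //; lia.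
- by rewrite hai (hop_from hw) ?(hop_from hQ) //; lia.
Qed.

Lemma swap_chk w q m i g h : dinj w m -> 0 < i < m -> q i < q i.+1 ->
  cteq (swap w i) q m -> bracket q m i g h -> chk w m i g h.
Proof.
move=> inj hi hq H [h1 h2 h3 h4].
have hu := swap_asc hi hq H; have hw := hop_swap hu.
have e k : i.+1 < k -> swap w i k = w k by move=> hk; rewrite /swap !gtn_eqF //; lia.
have ei : swap w i i.+1 = w i by rewrite /swap (gtn_eqF (ltnSn i)) eqxx.
have hl : LM (swap w i) i.+1 g.-1.
  case: (ltngtP i.+1 g.-1) => hg; [|lia|by rewrite -hg LM_refl].
  by rewrite H //; [apply/LMP => k hk; apply: h2|]; lia.
split=> hg.
  have hn : LM (swap w i) i.+1 g = false.
    rewrite H //; try lia; apply/negP => hh; have := LM_lt hh (k := g); lia.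
  move: hn; have -> : g = g.-1.+1 by lia.
  rewrite LMS; last lia; rewrite hl /= ei e; last lia.
  move/negbT; rewrite -leqNgt prednK; last lia.
  rewrite leq_eqVlt => /orP[/eqP ee|//].
  have : g = i by [apply: inj; lia].
  lia.
have [h5 h6] := h4 hg; rewrite -ei -e; last lia.
by apply: (LM_lt hl); lia.
Qed.

(** The pattern fixes every comparison of the exchanged window except those that start from the
    larger entry at [i.+1]; in [q] these hold exactly up to the position before [g], and [chk]
    ensures the same here. *)
Lemma pattern_swap w q m i z g h : dinj w m -> dinj q m -> dinj (ins q i z) m ->
  0 < i < m -> q i < q i.+1 -> q i < z ->
  cteq w (ins q i z) m -> bracket q m i g h -> chk w m i g h -> cteq (swap w i) q m.
Proof.
move=> inj injq injQ hi hq hz H [h1 h2 h3 h4] [h5 h6].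
have hQ := hop_ins hq hz.
have hu : w i.+1 < w i.
  have := H i i.+1 ltac:(lia) (ltnSn _) ltac:(lia).
  rewrite (hop_from hQ) // LM1 => /negbT; rewrite -leqNgt leq_eqVlt => /orP[/eqP ee|//].
  have : i.+1 = i by [apply: inj; lia].
  lia.
have hw := hop_swap hu.
have e k : i.+1 < k -> swap w i k = w k by move=> hk; rewrite /swap !gtn_eqF //; lia.
have ei : swap w i i.+1 = w i by rewrite /swap (gtn_eqF (ltnSn i)) eqxx.
move=> a b ha hab hb.
case: (ltngtP a i) => hai.
- case: (ltngtP b i) => hbi.
  + by rewrite -(hop_out hw) -?(hop_out hQ) ?H //; lia.
  + by rewrite -(hop_over hw) -?(hop_over hQ) ?H //; lia.
  + by rewrite hbi (hop_to hw) ?(hop_to hQ) ?H //; lia.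
- case: (ltngtP a i.+1) => hai1; first lia.
    by rewrite -(hop_out hw) -?(hop_out hQ) ?H //; lia.
  subst a.
  have [hbg|hgb] := ltnP b g.
    have hg : i.+2 < g by lia.
    have [h7 h8] := h4 hg.
    have -> : LM q i.+1 b by apply/LMP => k hk; apply: h2; lia.
    apply/LMP => k hk; rewrite ei e; last lia.
    apply: leq_trans (h6 hg) _.
    (* Right of [i.+1] the pattern agrees with [q], so the window has its minimum before [g] at the
       same position [h], and the one comparison with [h] covers the whole interval. *)
    have /mnP : ismin w i.+2 h g.-1.
      have E := proj1 (cteqP inj injQ) H.
      rewrite E; try lia; apply/mnP => j hj.
      have en k0 : i.+1 < k0 -> ins q i z k0 = q k0.
        by move=> hk0; rewrite /ins !gtn_eqF //; lia.
      by rewrite !en; [apply: h8|..]; lia.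
    by apply; lia.
  have -> : LM q i.+1 b = false.
    by apply/negP => hh; have := LM_lt hh (k := g); have := h3 ltac:(lia); lia.
  apply/negP => hh; have := LM_lt hh (k := g); rewrite ei e; last lia.
  by have := h5 ltac:(lia); lia.
- subst a; case: (ltngtP b i.+1) => hbi; first lia.
    by rewrite -(hop_next hw) -?(hop_next hQ) ?H //; lia.
  by rewrite hbi (hop_asc hw) LM1 hq.
Qed.

(** * Reversal, and uniqueness of the exchanged position *)

Lemma dinj_mirror m x : dinj x m -> dinj (mirror m x) m.
Proof.
move=> hx a b ha hb e; have : m.+1 - a = m.+1 - b by apply: hx e; lia.
lia.
Qed.

Lemma mirrorK m x k : 0 < k <= m -> mirror m (mirror m x) k = x k.
Proof. by move=> hk; rewrite /mirror; congr x; lia. Qed.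

Lemma mn_mirror m x a c b : 0 < a -> a <= c -> c <= b -> b <= m ->
  ismin (mirror m x) a c b = ismin x (m.+1 - b) (m.+1 - c) (m.+1 - a).
Proof.
move=> h1 h2 h3 h4; apply/mnP/mnP => H k hk; last by apply: H; lia.
have := H (m.+1 - k); rewrite /mirror subKn; last lia.
by apply; lia.
Qed.

Lemma cteq_mirror m x y : dinj x m -> dinj y m ->
  cteq x y m -> cteq (mirror m x) (mirror m y) m.
Proof.
move=> hx hy /(cteqP hx hy) H; apply/cteqP; try exact: dinj_mirror.
by move=> a c b h1 h2 h3 h4; rewrite !mn_mirror //; apply: H; lia.
Qed.

Lemma mirror_swap m x i k : 0 < i < m -> 0 < k <= m ->
  mirror m (swap x i) k = swap (mirror m x) (m - i) k.
Proof.
move=> hi hk; rewrite /mirror /swap.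
have -> : (m.+1 - k == i) = (k == (m - i).+1) by apply/eqP/eqP; lia.
have -> : (m.+1 - k == i.+1) = (k == m - i) by apply/eqP/eqP; lia.
case: eqP => h1; case: eqP => h2 //; try lia.
  by congr x; lia.
by congr x; lia.
Qed.

(** Patterns without reference to a direction: the smaller of the two entries moves to the other
    position, and its old place takes an arbitrary value above it. *)
Definition is_pat q m l y :=
  [/\ 0 < l < m,
      forall k, 0 < k <= m -> k != l -> k != l.+1 -> y k = q k &
      [/\ q l < q l.+1, y l.+1 = q l & q l < y l] \/
      [/\ q l.+1 < q l, y l = q l.+1 & q l.+1 < y l.+1]].

(** A pattern reverses the comparison of the two entries at its own position. If the positions are
    at least 2 apart, the first pattern keeps the comparison that the second one reverses; if they
    are adjacent, the comparisons among three consecutive entries already conflict. *)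
Lemma is_pat_inj_lt q m l l' y y' :
  is_pat q m l y -> is_pat q m l' y' -> cteq y y' m -> l < l' -> False.
Proof.
move=> [h1 h2 h3] [h1' h2' h3'] H hl.
have e1 := H l l.+1 ltac:(lia) (ltnSn _) ltac:(lia).
have e2 := H l' l'.+1 ltac:(lia) (ltnSn _) ltac:(lia).
rewrite !LM1 in e1 e2.
case: (ltngtP l' l.+1) => hll; first lia.
  have a1 := h2 l' ltac:(lia) ltac:(lia) ltac:(lia).
  have a2 := h2 l'.+1 ltac:(lia) ltac:(lia) ltac:(lia).
  by case: h3' => -[]; lia.
subst l'.
have e3 := H l l.+2 ltac:(lia) ltac:(lia) ltac:(lia).
rewrite !(LMS _ (leqnSn _)) !LM1 in e3.
have a1 := h2 l.+2 ltac:(lia) ltac:(lia) ltac:(lia).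
have a2 := h2' l ltac:(lia) ltac:(lia) ltac:(lia).
by case: h3 => -[? ? ?]; case: h3' => -[? ? ?]; lia.
Qed.

Lemma is_pat_inj q m l l' y y' :
  is_pat q m l y -> is_pat q m l' y' -> cteq y y' m -> l = l'.
Proof.
move=> h1 h2 H; case: (ltngtP l l') => // h.
  by case: (is_pat_inj_lt h1 h2 H h).
by case: (is_pat_inj_lt h2 h1 (cteq_sym H) h).
Qed.

(** * The trie and its failure function *)

(** A trie is the list of the words at its nodes in order of creation, the index serving as address.
    By the last field [step] never drops a letter along an edge. *)
Record prefix_tree (L : seq (seq bool)) : Prop := PrefixTree {
  pt_uniq : uniq L;
  pt_size : 0 < size L;
  pt_root : nth [::] L 0 = [::];
  pt_closed : forall w b, rcons w b \in L -> w \in L;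
  pt_pop : forall w, rcons w false \in L -> 0 < dep w }.

(** The state of the automaton after reading [w]: the first word of [L] among [w], [del w],
    [del (del w)] and so on. *)
Inductive longest (L : seq (seq bool)) : seq bool -> seq bool -> Prop :=
| LongestHere w : w \in L -> longest L w w
| LongestDel w v : w \notin L -> longest L (del w) v -> longest L w v.

Section Longest.
Variable L : seq (seq bool).
Hypothesis hL : prefix_tree L.

Lemma pt_nil : [::] \in L.
Proof. by rewrite -(pt_root hL) mem_nth // pt_size. Qed.

Lemma pt_index0 w : w \in L -> (index w L == 0) = (w == [::]).
Proof.
move=> hw; apply/eqP/eqP => [h|->]; first by rewrite -(nth_index [::] hw) h pt_root.
by rewrite -(pt_root hL) index_uniq ?pt_uniq ?pt_size.
Qed.

Lemma longest_in w v : longest L w v -> v \in L.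
Proof. by elim. Qed.

Lemma longest_det w v v' : longest L w v -> longest L w v' -> v = v'.
Proof.
move=> h; elim: h v' => {w v} [w hw v'|w v hw _ IH v'] h; inversion h; subst=> //.
- by rewrite hw in H.
- by rewrite H in hw.
- exact: IH.
Qed.

Lemma longest_dep w v : longest L w v -> dep v <= dep w.
Proof. by elim=> // {}w {}v _ _ h; exact: leq_trans h (dep_del w). Qed.

Lemma longest_size w v : longest L w v -> size v <= size w.
Proof.
elim=> // {}w {}v hw _ h; apply: leq_trans h _; apply: ltnW; apply: size_del.
by apply: contraNneq hw => ->; exact: pt_nil.
Qed.

Lemma step_in w b : step w b \in L -> w \in L.
Proof. by rewrite /step; case: ifP => // _; exact: pt_closed. Qed.

(** If [w] is outside [L], so is its extension by a letter, hence both are shortened, and [del]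
    commutes with [step]. The next state therefore depends on the current state and the letter
    only. *)
Lemma longest_step w v b u :
  longest L w v -> longest L (step v b) u -> longest L (step w b) u.
Proof.
move=> h; elim: h u => // {}w {}v hw _ IH u hu.
apply: LongestDel; first by apply: contra hw; exact: step_in.
rewrite del_step; last by apply: contraNneq hw => ->; exact: pt_nil.
exact: IH.
Qed.

Lemma longest_iter_del k w v : longest L w v ->
  (forall j, j < k -> iter j del w \notin L) -> longest L (iter k del w) v.
Proof.
move=> h; elim: k => // k IH hk; have {}IH := IH (fun j hj => hk j (ltnW hj)).
have hn := hk k (ltnSn k); inversion IH; subst=> //.
by rewrite H in hn.
Qed.

End Longest.

Definition child (c0 c1 : nat -> nat) (b : bool) := if b then c1 else c0.

(* [c0], [c1] and [dp] store, at the index of a node, its two children (0 if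
   absent) and its depth. *)
Record trie_mem c0 c1 (dp : nat -> nat) L : Prop := TrieMem {
  tm_tree :> prefix_tree L;
  tm_child : forall w b, w \in L ->
    child c0 c1 b (index w L) =
      if rcons w b \in L then index (rcons w b) L else 0;
  tm_dep : forall w, w \in L -> dp (index w L) = dep w;
  tm_fresh : forall i, size L <= i -> c0 i = 0 /\ c1 i = 0 }.

Definition upd (f : nat -> nat) i v j := if j == i then v else f j.

Lemma index_rcons_mem (T : eqType) (L : seq T) w x :
  w \in L -> index w (rcons L x) = index w L.
Proof. by move=> h; rewrite -cats1 index_cat h. Qed.

Lemma index_rcons_new (T : eqType) (L : seq T) x :
  x \notin L -> index x (rcons L x) = size L.
Proof. by move=> h; rewrite -cats1 index_cat (negPf h) /= eqxx addn0. Qed.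

Lemma trie_grow c0 c1 dp L w b : trie_mem c0 c1 dp L -> w \in L ->
  b || (0 < dep w) -> rcons w b \notin L ->
  trie_mem (if b then c0 else upd c0 (index w L) (size L))
           (if b then upd c1 (index w L) (size L) else c1)
           (upd dp (size L) (dep (rcons w b))) (rcons L (rcons w b)).
Proof.
move=> [[h1 h2 h3 h4 h5] h6 h7 h8] hw hb hn; split; first split.
- by rewrite rcons_uniq hn.
- by rewrite size_rcons.
- by rewrite nth_rcons h2 h3.
- move=> u c; rewrite !mem_rcons !inE => /orP[/eqP/rcons_inj[-> _]|/h4->]; last by rewrite orbT.
  by rewrite hw orbT.
- move=> u; rewrite mem_rcons inE => /orP[/eqP/rcons_inj[e1 e2]|/h5//].
  by move: hb; rewrite e1 -e2.
- move=> u c; rewrite mem_rcons inE => /orP[/eqP eu|hu].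
    rewrite eu index_rcons_new // -eu.
    have [f0 f1] := h8 _ (leqnn (size L)).
    have hni : size L == index w L = false by rewrite gtn_eqF // index_mem.
    have -> : rcons u c \in rcons L u = false.
      rewrite mem_rcons inE; apply/negP => /orP[/eqP/(congr1 size)|/h4].
        by rewrite size_rcons; lia.
      by rewrite eu (negPf hn).
    by rewrite /child /upd; case: c; case: b hni {hb hn eu} => // ->.
  rewrite (index_rcons_mem _ hu).
  have hL : child c0 c1 c (index u L) = if rcons u c \in L then index (rcons u c) L else 0.
    exact: h6.
  case: (eqVneq (rcons u c) (rcons w b)) => [e|ne].
    rewrite e mem_rcons inE eqxx index_rcons_new //.
    by case/rcons_inj: e => -> ->; rewrite /child /upd; case: b {hb hn}; rewrite eqxx.
  have -> : rcons u c \in rcons L (rcons w b) = (rcons u c \in L).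
    by rewrite mem_rcons inE (negPf ne).
  have -> : child (if b then c0 else upd c0 (index w L) (size L))
     (if b then upd c1 (index w L) (size L) else c1) c (index u L) =
     child c0 c1 c (index u L).
    case: (eqVneq u w) ne => [->|nu] ne.
      by move: ne; rewrite /child /upd; case: c {hL}; case: b {hb hn} => //; rewrite eqxx.
    have : index u L == index w L = false.
      by apply/negP => /eqP/(congr1 (nth [::] L));
        rewrite !nth_index // => /eqP; rewrite (negPf nu).
    by rewrite /child /upd; case: c {hL ne}; case: b {hb hn} => // ->.
  rewrite hL; case: ifP => // h; by rewrite index_rcons_mem.
- move=> u; rewrite mem_rcons inE => /orP[/eqP->|hu].
    by rewrite index_rcons_new // /upd eqxx.
  rewrite index_rcons_mem // /upd ltn_eqF ?index_mem //; exact: h7.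
- move=> i; rewrite size_rcons => hi.
  have hw' : index w L < size L by rewrite index_mem.
  have [f0 f1] := h8 i (ltnW hi).
  have e : i == index w L = false by apply/eqP; lia.
  by case: b {hb hn}; rewrite /upd e.
Qed.

Lemma trie_mem_init : trie_mem (fun=> 0) (fun=> 0) (fun=> 0) [:: [::]].
Proof.
split=> //; first split=> //.
- by move=> w b; rewrite inE => /eqP/(congr1 size); rewrite size_rcons.
- by move=> w; rewrite inE => /eqP/(congr1 size); rewrite size_rcons.
- move=> w b; rewrite inE => /eqP->; rewrite inE.
  by have -> : (rcons [::] b == [::]) = false by []; case: b.
- by move=> w; rewrite inE => /eqP->.
Qed.

(** * Building the trie *)

Declare Scope cmd_scope.
Notation "a ;; b" := (Seq a b) (at level 100, right associativity) : cmd_scope.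
Open Scope cmd_scope.
Coercion Var : nat >-> expr.

Notation vM := 0 (only parsing).
Notation vN := 1 (only parsing).
Notation vs := 2 (only parsing).
Notation vsp := 3 (only parsing).
Notation vk := 4 (only parsing).
Notation vc := 5 (only parsing).
Notation vcnt := 6 (only parsing).
Notation vlab := 7 (only parsing).
Notation vflag := 8 (only parsing).
Notation vf := 9 (only parsing).
Notation vi := 10 (only parsing).
Notation vu := 11 (only parsing).
Notation vv := 12 (only parsing).
Notation vh := 13 (only parsing).
Notation vqh := 14 (only parsing).
Notation vqt := 15 (only parsing).
Notation vx := 16 (only parsing).
Notation ve := 17 (only parsing).
Notation vres := 18 (only parsing).
Notation vg := 19 (only parsing).
Notation vgo := 20 (only parsing).
Notation vl := 21 (only parsing).
Notation vj := 22 (only parsing).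

Notation aQ := 0 (only parsing).
Notation aS := 1 (only parsing).
Notation aC0 := 2 (only parsing).
Notation aC1 := 3 (only parsing).
Notation aDep := 4 (only parsing).
Notation aI := 5 (only parsing).
Notation aF := 6 (only parsing).
Notation aFail := 7 (only parsing).
Notation aq := 8 (only parsing).
Notation aV := 9 (only parsing).
Notation aLo := 10 (only parsing).
Notation aHi := 11 (only parsing).
Notation aT := 12 (only parsing).

Definition aC (b : bool) := if b then aC1 else aC0.

Definition rank :=
  Len vM SrcP ;; Set_ vk (Num 0) ;;
  While (Lt vk vM) (
    Set_ vk (Inc vk 1) ;; Set_ vj (Num 0) ;; Set_ vu (Num 2) ;;
    While (Lt vj vM) (
      Set_ vj (Inc vj 1) ;; Cmp vx SrcP vj SrcP vk ;;
      If vx (Set_ vu (Inc vu 2)) Skip) ;;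
    Put aQ vk vu).

(** [vsp] is updated before each call, so it already holds the depth of the child. *)
Definition walk b :=
  Set_ vc (Get (aC b) vs) ;;
  If vc (Set_ vs vc)
    (Set_ vcnt (Inc vcnt 1) ;; Put (aC b) vs vcnt ;;
     Put aDep vcnt vsp ;; Set_ vs vcnt).

(* Cell 0 of [aS] is never written: it stays 0 and stops the inner loop. *)
Definition insert :=
  Set_ vs (Num 0) ;; Set_ vsp (Num 0) ;; Set_ vk (Num 0) ;;
  While (Lt vk vM) (
    Set_ vk (Inc vk 1) ;;
    While (Lt (Get aQ vk) (Get aS vsp)) (
      Set_ vsp (Sub vsp (Num 1)) ;; walk false) ;;
    Set_ vsp (Inc vsp 1) ;;
    Put aS vsp (Get aQ vk) ;;
    walk true) ;;
  Put aI vs vlab ;;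
  If vflag (Put aF vs (Num 1)) Skip.

Section Insert.
Variables (p t : seq int) (sb : nat).
Local Notation tri := (tri p t sb).

Lemma walk_ok b s T L w :
  trie_mem (arr s aC0) (arr s aC1) (arr s aDep) L -> w \in L ->
  var s vs = index w L -> b || (0 < dep w) -> var s vsp = dep (rcons w b) ->
  var s vcnt = (size L).-1 -> size L < sb ->
  tri s (walk b) T (fun T' s' => T' = T /\ exists L',
    [/\ trie_mem (arr s' aC0) (arr s' aC1) (arr s' aDep) L',
        L' = L \/ L' = rcons L (rcons w b), rcons w b \in L',
        var s' vs = index (rcons w b) L' & var s' vcnt = (size L').-1]).
Proof.
move=> hL hw hs hb hsp hcnt hsb.
have hi : index w L < size L by rewrite index_mem.
have hc := tm_child hL b hw.
have h0 : 0 < size L by case: hL => -[].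
have e0 : (size L).-1 + 1 = size L by lia.
apply: tri_seq; apply: tri_set; apply: tri_if => /=.
  rewrite hs => hne; apply: tri_set => /=; split=> //; exists L.
  have hc' : arr s (aC b) (index w L) = child (arr s aC0) (arr s aC1) b (index w L).
    by case: (b).
  move: hne; rewrite hc' hc; case: ifP => // hin _.
  by split=> //; left.
rewrite hs => hz.
have hn : rcons w b \notin L.
  apply/negP => hin; move: hc; rewrite hin => hc.
  have hc' : arr s (aC b) (index w L) = child (arr s aC0) (arr s aC1) b (index w L).
    by case: (b).
  move: hz; rewrite hc' hc => /eqP; rewrite (pt_index0 hL) //.
  by rewrite -size_eq0 size_rcons.
have hg := trie_grow hL hw hb hn.
apply: tri_seq; apply: tri_set; apply: tri_seq; apply: tri_put => /=.
  by rewrite hs; lia.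
apply: tri_seq; apply: tri_put => /=; first by rewrite hcnt; lia.
apply: tri_set; split=> //; exists (rcons L (rcons w b)).
rewrite index_rcons_new // mem_rcons inE eqxx size_rcons /= hcnt e0; split=> //; last by right.
by rewrite hs hsp; case: (b) hg.
Qed.

Definition stack_rep (S : nat -> nat) st (y : nat -> nat) :=
  S 0 = 0 /\ forall i, i < size st -> S (size st - i) = y (nth 0 st i).

Lemma stack_rep_push S st y k c : stack_rep S st y -> c <= size st ->
  stack_rep (upd S (size st - c).+1 (y k)) (k :: drop c st) y.
Proof.
move=> [h1 h2] hc; split=> [|[|i]] /=; rewrite ?size_drop /upd ?eqxx //.
rewrite ltnS => hi; have -> : (size st - c).+1 - i.+1 == (size st - c).+1 = false.
  by apply/eqP; lia.
rewrite nth_drop subSS -h2; last lia.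
by congr S; lia.
Qed.

Definition trie_state s L :=
  trie_mem (arr s aC0) (arr s aC1) (arr s aDep) L /\ var s vcnt = (size L).-1.

(** Growth at the end keeps all addresses valid. The bound on opening letters later rules out that a
    word longer than a window is a state. *)
Definition extends m n (L L' : seq (seq bool)) :=
  exists R, [/\ L' = L ++ R, size R <= n & forall w, w \in R -> count id w <= m].

Lemma extends_refl m n L : extends m n L L.
Proof. by exists [::]; rewrite cats0. Qed.

Lemma extends_walk m n L L' L'' w : extends m n L L' -> L'' = L' \/ L'' = rcons L' w ->
  count id w <= m -> extends m n.+1 L L''.
Proof.
move=> [R [-> h1 h2]] [->|->] hw; first by exists R; split=> //; exact: leqW.
exists (rcons R w); rewrite rcons_cat size_rcons; split=> // u.
by rewrite mem_rcons inE => /orP[/eqP->|/h2].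
Qed.

Lemma extends_size m n L L' : extends m n L L' -> size L' <= size L + n.
Proof. by move=> [R [-> h _]]; rewrite size_cat leq_add2l. Qed.

Lemma extends_weaken m n n' L L' : extends m n L L' -> n <= n' -> extends m n' L L'.
Proof. by move=> [R [-> h h']] hn; exists R; split=> //; apply: leq_trans h hn. Qed.

Lemma extends_mem m n L L' w : extends m n L L' -> w \in L ->
  w \in L' /\ index w L' = index w L.
Proof. by move=> [R [-> _ _]] h; rewrite mem_cat h index_cat h. Qed.

(** The potential [2 * (m - k) + size (stack y k)] pays one iteration for each element and one for
    each pop. *)
Lemma insert_ok s T Tb L y m :
  var s vM = m -> (forall k, 0 < k <= m -> arr s aQ k = y k) ->
  trie_state s L -> arr s aS 0 = 0 -> size L + 2 * m <= sb -> m < sb ->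
  2 * m + Tb <= T ->
  tri s insert T (fun T' s' => Tb <= T' /\ exists L',
    [/\ trie_state s' L', extends m (2 * m) L L', enc y m \in L',
        arr s' aS 0 = 0 &
        (forall i, arr s' aI i = upd (arr s aI) (index (enc y m) L') (var s vlab) i) /\
        (forall i, arr s' aF i = if var s vflag == 0 then arr s aF i
                                 else upd (arr s aF) (index (enc y m) L') 1 i)]).
Proof.
move=> hM hQ [hL hcnt] hS hsb hmsb hT.
have hL0 : 0 < size L by case: hL => -[].
apply: tri_seq; apply: tri_set; apply: tri_seq; apply: tri_set; apply: tri_seq; apply: tri_set.
apply: tri_seq.
apply: (tri_while (I := fun T s1 => exists k L',
  [/\ var s1 vk = k /\ k <= m, trie_state s1 L', extends m (size (enc y k)) L L',
      [/\ enc y k \in L', var s1 vs = index (enc y k) L' &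
          var s1 vsp = size (stack y k)] &
      stack_rep (arr s1 aS) (stack y k) y /\
      Tb + 2 * (m - k) + size (stack y k) <= T])).
- exists 0, L; split=> //=.
  + exact: extends_refl.
  + rewrite (pt_nil hL); split=> //.
    by apply/esym/eqP; rewrite (pt_index0 hL) // (pt_nil hL).
  + split=> //; lia.
- move=> T1 s1 [sv sa] [k [L1 [[hk hkm] [hL1 hc1] hx1 [hin hs1 hsp1] [hst hT1]]]].
  have hM1 : var s1 vM = m by rewrite sv.
  have hQ1 j : 0 < j <= m -> arr s1 aQ j = y j by move=> hj; rewrite sa // hQ.
  rewrite /= hk hM1 => hlt; have {}hlt : k < m by lia.
  split; first lia.
  apply: tri_seq; apply: tri_set; apply: tri_seq.
  have hpop := pops_size y k.
  apply: (tri_while (I := fun T s2 => exists j L',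
    [/\ j <= pops y k, trie_state s2 L',
        extends m (size (enc y k ++ nseq j false)) L L',
        [/\ enc y k ++ nseq j false \in L',
            var s2 vs = index (enc y k ++ nseq j false) L' &
            var s2 vsp = size (stack y k) - j] &
        Tb + 2 * (m - k).-1 + (size (stack y k) - j).+1 <= T])).
  + exists 0, L1; rewrite cats0 subn0; split=> //; lia.
  + move=> T2 s2 [sv2 sa2] [j [L2 [hj [hL2 hc2] hx2 [hin2 hs2 hsp2] hT2]]].
    have hQ2 i : 0 < i <= m -> arr s2 aQ i = y i by move=> hi; rewrite sa2 // hQ1.
    have hS2 i : arr s2 aS i = arr s1 aS i by rewrite sa2.
    rewrite /= sv2 // [var _ vk]/= hk hQ2; last lia.
    rewrite hsp2 hS2 addn1 => hlt2; have {}hlt2 : y k.+1 < arr s1 aS (size (stack y k) - j) by lia.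
    (* With an empty stack the guard would read the sentinel 0, and no value is below 0. *)
    have hjs : j < size (stack y k).
      rewrite ltnNge; apply/negP => h; move: hlt2.
      by have -> : size (stack y k) - j = 0 by [lia]; rewrite hst.1.
    have hjp : j < pops y k.
      rewrite ltn_neqAle hj andbT; apply/eqP => e.
      have := @nth_find _ 0 (fun a => y a <= y k.+1) (stack y k).
      rewrite has_find -/(pops y k) -e hjs => /(_ isT).
      by move: hlt2; rewrite hst.2 //; lia.
    split; first lia.
    apply: tri_seq; apply: tri_set.
    have hsz := extends_size hx2.
    have hse := size_enc y k.+1.
    have hw : rcons (enc y k ++ nseq j false) false = enc y k ++ nseq j.+1 false.
      by rewrite -cats1 -catA -(nseqD j 1) addn1.
    have hse2 : size (enc y k ++ nseq j.+1 false) <= 2 * m.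
      rewrite size_cat size_nseq; move: hse.
      by rewrite [enc y k.+1]/= size_rcons size_cat size_nseq; lia.
    apply: tri_use.
      apply: (@walk_ok false _ _ L2 (enc y k ++ nseq j false)) => //=.
      * by rewrite dep_pop dep_enc; lia.
      * by rewrite hsp2 dep_rcons dep_pop dep_enc; lia.
      * by move: hse2; rewrite -hw size_rcons; lia.
    move=> T3 s3 [sv3 sa3] [-> [L3 [a1 a2 a3 a4 a5]]].
    exists j.+1, L3; rewrite -hw; split=> //.
    * rewrite size_rcons; apply: extends_walk hx2 a2 _.
      rewrite -cats1 !count_cat count_enc count_nseq /=; lia.
    * by split=> //; rewrite sv3 //= hsp2; lia.
    * lia.
  + move=> T2 s2 [sv2 sa2] [j [L2 [hj [hL2 hc2] hx2 [hin2 hs2 hsp2] hT2]]].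
    have hQ2 i : 0 < i <= m -> arr s2 aQ i = y i by move=> hi; rewrite sa2 // hQ1.
    have hS2 i : arr s2 aS i = arr s1 aS i by rewrite sa2.
    have hk2 : var s2 vk = k.+1 by rewrite sv2 //= hk addn1.
    rewrite /= hk2 hQ2; last lia.
    rewrite hsp2 hS2 => hge; have {}hge : arr s1 aS (size (stack y k) - j) <= y k.+1 by lia.
    have {hj} hj : j = pops y k.
      apply/eqP; rewrite eqn_leq hj /= leqNgt; apply/negP => hlt2.
      have := @before_find _ 0 (fun a => y a <= y k.+1) (stack y k) j hlt2.
      by rewrite -hst.2 ?hge //; lia.
    subst j.
    apply: tri_seq; apply: tri_set; apply: tri_seq; apply: tri_put => /=.
      by have := size_enc y k; have := count_enc y k; have := dep_count (enc y k);
         rewrite dep_enc; lia.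
    have hsz := extends_size hx2.
    have hse2 : size (enc y k ++ nseq (pops y k) false) < 2 * m.
      by have := size_enc y k.+1; rewrite [enc y k.+1]/= size_rcons; lia.
    apply: tri_use.
      apply: (@walk_ok true _ _ L2 (enc y k ++ nseq (pops y k) false)) => //=.
      * by rewrite hsp2 dep_rcons dep_pop dep_enc; lia.
      * lia.
    move=> T3 s3 [sv3 sa3] [-> [L3 [a1 a2 a3 a4 a5]]].
    exists k.+1, L3; split=> //.
    * by rewrite sv3 //=.
    * rewrite /= size_rcons; apply: extends_walk hx2 a2 _.
      rewrite -cats1 !count_cat count_enc count_nseq /=; lia.
    * by split=> //; rewrite stackS sv3 //= hsp2 size_drop; lia.
    * rewrite stackS; split; last by rewrite /= size_drop; lia.
      have [e0 ei] := stack_rep_push k.+1 hst hpop.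
      have E i : arr s3 aS i = upd (arr s1 aS) (size (stack y k) - pops y k).+1 (y k.+1) i.
        rewrite sa3 //= /upd hsp2 addn1 hS2 hk2 hQ2 //; lia.
      by split=> [|i hi]; rewrite E // ei.
- move=> T1 s1 [sv sa] [k [L1 [[hk hkm] [hL1 hc1] hx1 [hin hs1 hsp1] [hst hT1]]]].
  have hM1 : var s1 vM = m by rewrite sv.
  rewrite /= hk hM1 => hge; have {}hkm : k = m by lia.
  rewrite hkm in hk hx1 hin hs1 hsp1 hst hT1.
  have hi : index (enc y m) L1 < sb.
    have h1 := extends_size hx1; have h2 := size_enc y m.
    have h3 : index (enc y m) L1 < size L1 by rewrite index_mem.
    lia.
  apply: tri_seq; apply: tri_put => /=.
    by rewrite hs1.
  have hx := extends_weaken hx1 (size_enc y m).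
  apply: tri_if => /=; rewrite sv //= => hf.
    apply: tri_put => /=.
      by rewrite hs1.
    apply: conj; first lia.
    exists L1; split=> //=; first by case: hst.
    by split=> i; rewrite ?(negPf hf) hs1 /upd !sa ?sv.
  apply: tri_skip; split; first lia.
  exists L1; split=> //=; first by case: hst.
  by split=> i; rewrite ?hf ?hs1 /upd !sa ?sv.
Qed.
End Insert.

(** * Patterns in both directions, and the record of what was inserted *)

Definition orient (dir : bool) m x := if dir then x else mirror m x.
Definition dpos (dir : bool) m k := if dir then k else m.+1 - k.
(** The pair [(i, i.+1)] of the reversed sequence is the pair starting at [m - i] of the original
    one. *)
Definition lab (dir : bool) m i := if dir then i else m - i.

Lemma orient_pos dir m (x : nat -> nat) k : x (dpos dir m k) = orient dir m x k.
Proof. by case: dir. Qed.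

Lemma orientK dir m x k : 0 < k <= m -> orient dir m (orient dir m x) k = x k.
Proof. by case: dir => //; exact: mirrorK. Qed.

Lemma ix_in dir m k : 0 < k <= m -> 0 < dpos dir m k <= m.
Proof. case: dir => /=; lia. Qed.

Lemma dinj_orient dir m x : dinj x m -> dinj (orient dir m x) m.
Proof. by case: dir => //; exact: dinj_mirror. Qed.

Lemma cteq_orient dir m x y : dinj x m -> dinj y m -> cteq x y m ->
  cteq (orient dir m x) (orient dir m y) m.
Proof. by case: dir => //; exact: cteq_mirror. Qed.

Lemma lab_in dir m i : 0 < i < m -> 0 < lab dir m i < m.
Proof. case: dir => /=; lia. Qed.

Lemma labK dir m i : 0 < i < m -> lab dir m (lab dir m i) = i.
Proof. case: dir => /=; lia. Qed.

Lemma orient_swap dir m x i k : 0 < i < m -> 0 < k <= m ->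
  orient dir m (swap x i) k = swap (orient dir m x) (lab dir m i) k.
Proof. by case: dir => //=; exact: mirror_swap. Qed.

Lemma dinj_ins x m i z : dinj x m -> 0 < i < m ->
  (forall k, 0 < k <= m -> k != i.+1 -> x k != z) -> dinj (ins x i z) m.
Proof.
move=> hx hi hz a b ha hb; rewrite /ins.
case: (eqVneq a i) => [->|na]; case: (eqVneq b i) => [->|nb] //.
- case: (eqVneq b i.+1) => [_|nb1] e; first by case/negP: (hz i ltac:(lia) ltac:(lia)); rewrite e.
  by case/negP: (hz b ltac:(lia) nb1); rewrite e.
- case: (eqVneq a i.+1) => [_|na1] e; first by case/negP: (hz i ltac:(lia) ltac:(lia)); rewrite e.
  by case/negP: (hz a ltac:(lia) na1); rewrite e.
- case: (eqVneq a i.+1) => [->|na1]; case: (eqVneq b i.+1) => [->|nb1] // e.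
  + have : i = b by [apply: hx e; lia]; lia.
  + have : a = i by [apply: hx e; lia]; lia.
  + exact: hx e.
Qed.

Lemma eq_dinj x y m : (forall k, 0 < k <= m -> x k = y k) -> dinj x m -> dinj y m.
Proof. by move=> H hx a b ha hb; rewrite -!H //; exact: hx. Qed.

(* In direction [dir], [q] ascends at [i] and its two entries there become [z] and [q i]. *)
Definition pat dir m q i z := orient dir m (ins (orient dir m q) i z).

Lemma patE dir m q i z k : 0 < i < m -> 0 < k <= m -> pat dir m q i z k =
  upd (upd q (dpos dir m i) z) (dpos dir m i.+1) (orient dir m q i) k.
Proof.
rewrite /pat /orient /dpos /ins /upd /mirror => hi hk; case: dir.
  by case: (eqVneq k i) => [->|//]; case: eqP => //; lia.
have -> : (m.+1 - k == i) = (k == m.+1 - i) by apply/eqP/eqP; lia.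
have -> : (m.+1 - k == i.+1) = (k == m.+1 - i.+1) by apply/eqP/eqP; lia.
case: (eqVneq k (m.+1 - i)) => [->|n1]; case: eqP => //; try lia.
by move=> _; congr q; lia.
Qed.

Lemma pat_is_pat dir m q i z : 0 < i < m -> orient dir m q i < orient dir m q i.+1 ->
  orient dir m q i < z -> is_pat q m (lab dir m i) (pat dir m q i z).
Proof.
rewrite /pat /orient /lab /ins /mirror => hi h1 h2; case: dir h1 h2 => h1 h2; split; try lia.
- by move=> k _ /negPf-> /negPf->.
- by left; rewrite !eqxx (gtn_eqF (ltnSn i)).
- move=> k hk n1 n2; rewrite !ifF; [congr q|apply/eqP..]; lia.
- right; have -> : m.+1 - (m - i) = i.+1 by lia.
  have -> : m.+1 - (m - i).+1 = i by lia.
  have e1 : m.+1 - i.+1 = m - i by lia.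
  have e2 : m.+1 - i = (m - i).+1 by lia.
  by rewrite !eqxx (gtn_eqF (ltnSn i)) -e1 -e2; split=> //; rewrite e1 e2; move: h1; rewrite e1 e2.
Qed.

Lemma pat_swap dir m q i k : 0 < i < m -> 0 < k <= m ->
  pat dir m q i (orient dir m q i.+1) k = swap q (lab dir m i) k.
Proof.
move=> hi hk.
have -> : pat dir m q i (orient dir m q i.+1) k =
          orient dir m (swap (orient dir m q) i) k by [].
have hl := lab_in dir hi; have h1 : 0 < lab dir m i <= m by lia.
have h2 : 0 < (lab dir m i).+1 <= m by lia.
by rewrite orient_swap // /swap !orientK.
Qed.

Definition database := seq (seq bool * nat * bool).

(** [PL] is a ghost log of insertions with word, label and flag. Flags accumulate, but a later
    insertion of the same word overwrites the label, so [db_in] only promises some entry with the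
    stored label; [is_pat_inj] later shows that labels of patterns agree. *)
Record db (m : nat) (s : state) (PL : database) (L : seq (seq bool)) : Prop := Db {
  db_trie :> trie_state s L;
  db_size : size L <= 1 + 2 * m * size PL;
  db_bottom : arr s aS 0 = 0;
  db_count : forall w, w \in L -> count id w <= m;
  db_in : forall w l f, (w, l, f) \in PL ->
    [/\ w \in L, exists f', (w, arr s aI (index w L), f') \in PL &
        f -> arr s aF (index w L) != 0];
  db_flag : forall w, w \in L -> arr s aF (index w L) != 0 -> exists l, (w, l, true) \in PL;
  db_lab : forall w, w \in L -> arr s aI (index w L) != 0 ->
    exists f, (w, arr s aI (index w L), f) \in PL;
  db_fresh : forall i, size L <= i -> arr s aI i = 0 /\ arr s aF i = 0 }.

Lemma db_frame m s s' PL L : db m s PL L ->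
  (forall a i, a \in [:: aS; aC0; aC1; aDep; aI; aF] -> arr s' a i = arr s a i) ->
  var s' vcnt = var s vcnt -> db m s' PL L.
Proof.
move=> [[[h1 h2 h3 h4] h5] h6 h7 h8 h9 h10 h11 h12] E Ev; split=> //.
- split; last by rewrite Ev.
  split=> //.
  + by move=> w b hw; rewrite -h2 //; case: b; rewrite /= E.
  + by move=> w hw; rewrite E // h3.
  + by move=> i hi; rewrite !E //; exact: h4.
- by rewrite E.
- by move=> w l f hw; have [k1 [f' k2] k3] := h9 w l f hw; split=> //; rewrite ?E //; exists f'.
- by move=> w hw; rewrite E //; exact: h10.
- by move=> w hw; rewrite E //; exact: h11.
- by move=> i hi; rewrite !E //; exact: h12.
Qed.

Section Patterns.
Variables (p t : seq int) (sb m : nat).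
Local Notation tri := (tri p t sb).

Lemma insert_db s T Tb y PL L : var s vM = m ->
  (forall k, 0 < k <= m -> arr s aQ k = y k) -> db m s PL L ->
  1 + 2 * m * (size PL).+1 <= sb -> m < sb -> 2 * m + Tb <= T ->
  tri s insert T (fun T' s' => Tb <= T' /\ exists L',
    db m s' ((enc y m, var s vlab, var s vflag != 0) :: PL) L').
Proof.
move=> hM hQ [hL hsz hb hcnt hin hf hl hfr] hsb hmsb hT.
apply: tri_use; first by apply: (insert_ok _ _ hM hQ hL hb _ hmsb hT); lia.
move=> T' s' _ [hT' [L' [h1 h2 h3 h4 [h5 h6]]]]; split=> //; exists L'.
have hL0 : 0 < size L by case: hL => [[[]]].
have old w : w \in L -> w \in L' /\ index w L' = index w L := fun h => extends_mem h2 h.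
have new w : w \in L' -> w \notin L -> size L <= index w L'.
  by case: h2 => R [-> _ _] _ hn; rewrite index_cat (negPf hn) leq_addr.
have eqi w : w \in L' -> (index w L' == index (enc y m) L') = (w == enc y m).
  move=> hw; apply/eqP/eqP => [e|->//].
  by rewrite -(nth_index [::] hw) e nth_index.
split=> //.
- by have := extends_size h2; rewrite /=; lia.
- case: h2 => R [-> _ hR] w; rewrite mem_cat => /orP[/hcnt|/hR] //.
- have main w : w \in L' ->
     (w == enc y m) || [exists f : bool, (w, arr s 5 (index w L'), f) \in PL] ->
     exists f, (w, arr s' 5 (index w L'), f) \in
        (enc y m, var s vlab, var s vflag != 0) :: PL.
    move=> hw; rewrite h5 /upd eqi //; case: eqP => [->|_] /=.
      by exists (var s vflag != 0); rewrite inE eqxx.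
    by move/existsP=> [f hff]; exists f; rewrite inE hff orbT.
  move=> w l f; rewrite inE => /orP[/eqP[-> _ ->]|hw].
    split=> //; first by apply: main; rewrite ?eqxx.
    by move/negPf=> e; rewrite h6 e /upd eqxx.
  have [k1 [f' k2] k3] := hin _ _ _ hw; have [k4 k5] := old _ k1; split=> //.
    apply: main => //; apply/orP; right; apply/existsP; exists f'.
    by rewrite k5.
  move=> /k3 h; rewrite h6; case: ifP => _; first by rewrite k5.
  by rewrite /upd k5; case: ifP.
- move=> w hw; rewrite h6 /upd eqi //; case: (eqVneq (var s 8) 0) => hv.
    move=> hne; case: (boolP (w \in L)) => hwL.
      have [k4 k5] := old _ hwL; have [|l hl'] := hf w hwL; rewrite -?k5 //.
      by exists l; rewrite inE hl' orbT.
    by move: hne; rewrite (hfr _ (new _ hw hwL)).2.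
  case: (eqVneq w (enc y m)) => [-> _|_ hne].
    by exists (var s vlab); rewrite inE eqxx.
  case: (boolP (w \in L)) => hwL.
    have [k4 k5] := old _ hwL; have [|l hl'] := hf w hwL; rewrite -?k5 //.
    by exists l; rewrite inE hl' orbT.
  by move: hne; rewrite (hfr _ (new _ hw hwL)).2.
- move=> w hw; rewrite h5 /upd eqi //; case: (eqVneq w (enc y m)) => [-> _|_ hne].
    by exists (var s vflag != 0); rewrite inE eqxx.
  case: (boolP (w \in L)) => hwL.
    have [k4 k5] := old _ hwL; have [|f hff] := hl w hwL; rewrite -?k5 //.
    by exists f; rewrite inE k5 hff orbT.
  by move: hne; rewrite (hfr _ (new _ hw hwL)).1.
- move=> i hi; have hi' : size L <= i.
    by apply: leq_trans hi; case: h2 => R [-> _ _]; rewrite size_cat leq_addr.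
  have hne : i == index (enc y m) L' = false.
    by apply: gtn_eqF; apply: leq_trans hi; rewrite index_mem.
  have [f1 f2] := hfr i hi'.
  by rewrite h5 h6 /upd hne f1 f2 if_same.
Qed.
End Patterns.

(** * Generating the patterns *)

Definition at_ (dir : bool) e := if dir then e else Sub (Inc vM 1) e.
Definition labe (dir : bool) := if dir then Var vi else Sub vM vi.

(** The pattern is written over the ranks in place and undone afterwards, so no copy is made. *)
Definition insert_pat dir :=
  Put aQ (at_ dir (Inc vi 1)) vu ;; Put aQ (at_ dir vi) vh ;;
  insert ;;
  Put aQ (at_ dir vi) vu ;; Put aQ (at_ dir (Inc vi 1)) vv.

(* Cells 0 and [m+1] of [aQ] hold 0, below all ranks, and stop the search. *)
Definition patF dir :=
  Set_ vf (Num 0) ;; Set_ vflag (Num 0) ;;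
  While (Lt vf vM) (
    Set_ vf (Inc vf 1) ;; Set_ vi (Inc vf 1) ;;
    While (Lt (Get aQ (at_ dir vf)) (Get aQ (at_ dir vi))) (Set_ vi (Inc vi 1)) ;;
    Set_ vu (Get aQ (at_ dir vi)) ;; Set_ vv (Get aQ (at_ dir (Inc vi 1))) ;;
    If (Lt vu vv) (
      Set_ vlab (labe dir) ;;
      Set_ vh (Inc (Get aQ (at_ dir vf)) 1) ;;
      insert_pat dir) Skip).

(* Positions are stored as distances to the position after the end of the window, 0 meaning none. *)
Definition brk dir :=
  Set_ vf (Inc vi 2) ;; Set_ vh vf ;;
  While (Lt vv (Get aQ (at_ dir vf))) (
    If (Lt (Get aQ (at_ dir vf)) (Get aQ (at_ dir vh))) (Set_ vh vf) Skip ;;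
    Set_ vf (Inc vf 1)) ;;
  Put aV vlab (Sub (Inc vM 1) (at_ dir vi)) ;;
  If (Lt vf (Inc vM 1)) (Set_ vx (Sub (Inc vM 1) (at_ dir vf))) (Set_ vx (Num 0)) ;;
  Put aLo vlab vx ;;
  If (Lt (Inc vi 2) vf) (Set_ vx (Sub (Inc vM 1) (at_ dir vh))) (Set_ vx (Num 0)) ;;
  Put aHi vlab vx.

(** Two words per ascent: [vh] just above [q i] is the case [f = i] of [zok], and [vh = q i.+1] is
    the exact exchange of [q], whose tree is accepted by its flag. *)
Definition patI dir :=
  Set_ vi (Num 0) ;;
  While (Lt (Inc vi 1) vM) (
    Set_ vi (Inc vi 1) ;;
    Set_ vu (Get aQ (at_ dir vi)) ;; Set_ vv (Get aQ (at_ dir (Inc vi 1))) ;;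
    If (Lt vu vv) (
      Set_ vlab (labe dir) ;;
      Set_ vflag (Num 0) ;; Set_ vh (Inc vu 1) ;; insert_pat dir ;;
      Set_ vflag (Num 1) ;; Set_ vh vv ;; insert_pat dir ;;
      brk dir) Skip).

Lemma db_setv m s PL L x v : x != vcnt -> db m s PL L -> db m (setv s x v) PL L.
Proof. by move=> hx h; apply: (db_frame h) => //=; rewrite eq_sym (negPf hx). Qed.

Lemma db_seta m s PL L a i v : a \notin [:: aS; aC0; aC1; aDep; aI; aF] ->
  db m s PL L -> db m (seta s a i v) PL L.
Proof.
move=> ha h; apply: (db_frame h) => //= b j hb.
by case: eqP => //= e; move: ha; rewrite -e hb.
Qed.

Lemma db_same c m s s' PL L : same c s s' ->
  (vcnt \notin mvar c) && all (fun a => a \notin marr c) [:: aS; aC0; aC1; aDep; aI; aF] ->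
  db m s PL L -> db m s' PL L.
Proof.
move=> [h1 h2] /andP[h3 /allP h4] h; apply: (db_frame h) => [a i ha|].
  by rewrite h2 // h4.
by rewrite h1.
Qed.

Section Patterns.
Variables (p t : seq int) (sb m : nat) (q : nat -> nat).
Local Notation tri := (tri p t sb).
Hypothesis m_gt0 : 0 < m.
Hypothesis hq0 : forall k, ~~ (0 < k <= m) -> q k = 0.
Hypothesis hqe : forall k, 0 < k <= m -> 0 < q k /\ ~~ odd (q k).
Hypothesis hqi : dinj q m.

Lemma orient_out dir k : ~~ (0 < k <= m) -> orient dir m q k = 0.
Proof. by case: dir => hk; rewrite /orient /mirror hq0 //; lia. Qed.

Lemma orient_even dir k : 0 < k <= m -> 0 < orient dir m q k /\ ~~ odd (orient dir m q k).
Proof. by move=> hk; rewrite -orient_pos; apply: hqe; exact: ix_in. Qed.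

Lemma odd_orient dir k : odd (orient dir m q k) = false.
Proof.
case: (boolP (0 < k <= m)) => h; last by rewrite orient_out.
by have [_ /negPf] := orient_even dir h.
Qed.

Lemma eval_at s dir e : var s vM = m -> eval s (at_ dir e) = dpos dir m (eval s e).
Proof. by move=> hM; case: dir => //=; rewrite hM addn1. Qed.

Lemma eval_labe s dir : var s vM = m -> eval s (labe dir) = lab dir m (var s vi).
Proof. by move=> hM; case: dir => //=; rewrite hM. Qed.

Definition env s := var s vM = m /\ forall k, arr s aQ k = q k.

Lemma eval_get s dir e : env s -> eval s (Get aQ (at_ dir e)) = orient dir m q (eval s e).
Proof. by move=> [hM hQ]; rewrite [LHS]/= eval_at // hQ orient_pos. Qed.

Definition good (PL : database) := forall w l f, (w, l, f) \in PL ->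
  (l = 0 /\ w = enc q m) \/
  exists y, [/\ is_pat q m l y, dinj y m, w = enc y m & f -> w = enc (swap q l) m].

Lemma good_pat dir i z (f : bool) PL : 0 < i < m -> orient dir m q i < orient dir m q i.+1 ->
  orient dir m q i < z -> (forall k, 0 < k <= m -> k != i.+1 -> orient dir m q k != z) ->
  (f -> z = orient dir m q i.+1) -> good PL ->
  good ((enc (pat dir m q i z) m, lab dir m i, f) :: PL).
Proof.
move=> hi h1 h2 h3 h4 hPL w l f'; rewrite inE => /orP[/eqP[-> -> ->]|/hPL//].
right; exists (pat dir m q i z); split=> //.
- exact: pat_is_pat.
- by apply: dinj_orient; apply: dinj_ins => //; exact: dinj_orient.
- by move=> hf; apply: eq_enc => k hk; rewrite (h4 hf) pat_swap.
Qed.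

(** Ranks are even, so a value inserted just above one of them collides with none and the pattern
    stays injective. *)
Lemma odd_fresh dir f k : orient dir m q k != (orient dir m q f).+1.
Proof. by apply/eqP => /(congr1 odd); rewrite /= !odd_orient. Qed.

(** The conditions make [i] the next smaller position after [f], hence unique: this is why one
    insertion per [f] suffices. *)
Definition covF dir n (PL : database) := forall f i,
  0 < f <= n -> f < i < m -> orient dir m q i < orient dir m q i.+1 ->
  orient dir m q i < orient dir m q f ->
  (forall k, f < k < i -> orient dir m q f < orient dir m q k) ->
  (enc (pat dir m q i (orient dir m q f).+1) m, lab dir m i, false) \in PL.

Lemma insert_pat_ok dir s T Tb PL L i z : env s -> db m s PL L -> 0 < i < m ->
  var s vi = i -> var s vu = orient dir m q i -> var s vv = orient dir m q i.+1 -> var s vh = z ->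
  1 + 2 * m * (size PL).+1 <= sb -> m.+1 < sb -> 2 * m + Tb <= T ->
  tri s (insert_pat dir) T (fun T' s' => Tb <= T' /\ env s' /\ exists L',
    db m s' ((enc (pat dir m q i z) m, var s vlab, var s vflag != 0) :: PL) L').
Proof.
move=> [hM hQ] hdb hi hvi hu hv hh hsb hmsb hT.
have hix : dpos dir m i < sb by have := @ix_in dir m i; lia.
have hix' : dpos dir m i.+1 < sb by have := @ix_in dir m i.+1; lia.
have hne : dpos dir m i.+1 != dpos dir m i by rewrite /dpos; case: (dir); lia.
apply: tri_seq; apply: tri_put; rewrite eval_at //= hvi addn1 //.
apply: tri_seq; apply: tri_put; rewrite eval_at //= hvi //.
apply: tri_seq; apply: tri_use.
  apply: (insert_db _ _ (m := m) (y := pat dir m q i z) (PL := PL) (L := L) (Tb := Tb)) => //=.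
  - move=> k hk; rewrite patE // /upd hQ hu hh.
    by case: (eqVneq k (dpos dir m i.+1)) => [->|//]; rewrite (negPf hne).
  - by apply: db_seta => //; apply: db_seta.
  - lia.
move=> T1 s1 [sv sa] [hT1 [L1 hdb1]].
have hM1 : var s1 vM = m by rewrite sv.
have hi1 : var s1 vi = i by rewrite sv.
apply: tri_seq; apply: tri_put; rewrite eval_at //= hi1 //.
apply: tri_put; rewrite eval_at //= hi1 addn1 //.
split=> //; split.
  split=> //= k; rewrite !sv //= hu hv.
  case: (eqVneq k (dpos dir m i.+1)) => [->|n1]; first by rewrite orient_pos.
  case: (eqVneq k (dpos dir m i)) => [->|n2]; first by rewrite orient_pos.
  by rewrite sa //= (negPf n1) (negPf n2) hQ.
by exists L1; apply: db_seta => //; apply: db_seta.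
Qed.

(** For each [f]: one outer iteration, at most [m] for the search and [2 * m] for the insertion,
    within [4 * m]. *)
Lemma patF_ok dir s T Tb PL L : env s -> db m s PL L -> good PL ->
  1 + 2 * m * (size PL + m).+1 <= sb -> m.+1 < sb -> 4 * m * m + Tb <= T ->
  tri s (patF dir) T (fun T' s' => Tb <= T' /\ exists PL' L',
    [/\ env s' /\ db m s' PL' L', good PL', size PL' <= size PL + m,
        covF dir m PL' & {subset PL <= PL'}]).
Proof.
move=> hE hdb hg hsb hmsb hT.
apply: tri_seq; apply: tri_set; apply: tri_seq; apply: tri_set.
apply: (tri_while (I := fun T s1 => exists n PL' L',
  [/\ var s1 vf = n /\ n <= m, env s1, db m s1 PL' L',
      [/\ good PL', size PL' <= size PL + n, covF dir n PL' & {subset PL <= PL'}] &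
      Tb + 4 * m * (m - n) <= T])).
- exists 0, PL, L; split=> //.
  + by apply: db_setv => //; apply: db_setv.
  + split=> //; first by rewrite addn0.
    by move=> f i; lia.
  + by rewrite subn0; lia.
- move=> T1 s1 [sv sa] [n [PL1 [L1 [[hf hnm] hE1 hdb1 [hg1 hs1 hc1 hsub1] hT1]]]].
  have hM1 := hE1.1.
  rewrite /= hf hM1 => hlt; have {}hlt : n < m by lia.
  have hmm : 4 * m * (m - n) = 4 * m * (m - n.+1) + 4 * m.
    by have -> : m - n = (m - n.+1).+1 by [lia]; rewrite mulnSr.
  have hT1' : Tb + (4 * m * (m - n.+1) + 4 * m) <= T1 by rewrite -hmm.
  clear hmm hT1; move: hT1'; set A := 4 * m * (m - n.+1) => hT1.
  split; first lia.
  apply: tri_seq; apply: tri_set; apply: tri_seq; apply: tri_set; apply: tri_seq.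
  apply: (tri_while (I := fun T s2 => exists i,
    [/\ var s2 vi = i, n.+1 < i <= m.+1,
        forall k, n.+1 < k < i -> orient dir m q n.+1 < orient dir m q k &
        Tb + A + 2 * m + (m.+1 - i) <= T])).
  + exists n.+2; split=> /=; rewrite ?hf; try lia.
  + move=> T2 s2 [sv2 sa2] [i [hi him hmin hT2]].
    have hE2 : env s2.
      by split=> [|k]; [rewrite sv2|rewrite sa2 //; exact: hE1.2].
    have hf2 : var s2 vf = n.+1 by rewrite sv2 //= hf addn1.
    rewrite [eval s2 (Lt _ _)]/= -/(eval s2 (Get _ _)).
    have := eval_get dir (Var vi) hE2; have := eval_get dir (Var vf) hE2.
    rewrite /= hi hf2 => -> -> hlt2.
    have him' : i <= m.
      by rewrite leqNgt; apply/negP => h; move: hlt2; rewrite (orient_out dir (k := i)) //; lia.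
    split; first lia.
    apply: tri_set; exists i.+1; rewrite /= hi addn1; split=> //; try lia.
    by move=> k hk; case: (eqVneq k i) => [->|ne]; [lia|apply: hmin; lia].
  + move=> T2 s2 hsame2 [i [hi him hmin hT2]].
    have [sv2 sa2] := hsame2.
    have hE2 : env s2.
      by split=> [|k]; [rewrite sv2|rewrite sa2 //; exact: hE1.2].
    have hM2 := hE2.1.
    have hf2 : var s2 vf = n.+1 by rewrite sv2 //= hf addn1.
    have hfl2 : var s2 vflag = 0 by rewrite sv2 //= sv.
    have hdb2 : db m s2 PL1 L1.
      by apply: (db_same hsame2) => //; apply: db_setv => //; apply: db_setv.
    have := eval_get dir (Var vi) hE2; have := eval_get dir (Var vf) hE2.
    have := eval_get dir (Inc vi 1) hE2.
    rewrite /= hi hf2 addn1 => e1 e2 e3; rewrite e2 e3 => hge.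
    apply: tri_seq; apply: tri_set; apply: tri_seq; apply: tri_set.
    rewrite /= e3.
    have e4 : eval (setv s2 11 (orient dir m q i)) (at_ dir (Inc 10 1)) = dpos dir m i.+1.
      by rewrite eval_at //= hi addn1.
    rewrite e4 hE2.2 orient_pos.
    have cov' PL' : {subset PL1 <= PL'} ->
      (n.+1 < i < m -> orient dir m q i < orient dir m q i.+1 ->
       (enc (pat dir m q i (orient dir m q n.+1).+1) m, lab dir m i, false) \in PL') ->
      covF dir n.+1 PL'.
      move=> hs hn f j hfn hj h1 h2 h3.
      case: (eqVneq f n.+1) h2 h3 hj => [->|ne] h2 h3 hj.
        case: (ltngtP i j) => hij.
        - by have := h3 i; lia.
        - by have := hmin j; lia.
        - by subst j; apply: hn.
      by apply: hs; apply: hc1 => //; lia.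
    apply: tri_if => /= hc; last first.
      apply: tri_skip; exists n.+1, PL1, L1; split=> //.
      * by apply: db_setv => //; apply: db_setv.
      * split=> //; first by lia.
        by apply: cov' => // _; lia.
      * lia.
    have {}hc : orient dir m q i < orient dir m q i.+1 by lia.
    have {}him : n.+1 < i < m.
      apply/andP; split; first lia.
      by rewrite ltnNge; apply/negP => h; move: hc; rewrite (orient_out dir (k := i.+1)) //; lia.
    have hi0 : 0 < i < m by lia.
    have hle : orient dir m q i <= orient dir m q n.+1 by lia.
    apply: tri_seq; apply: tri_set; apply: tri_seq; apply: tri_set.
    rewrite eval_labe //= hi; rewrite eval_at //= hf2 hE2.2 orient_pos addn1.
    apply: tri_use.
      apply: (insert_pat_ok (i := i) (z := (orient dir m q n.+1).+1) (PL := PL1) (L := L1)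
        (Tb := Tb + A)) => //=.
      * by do 4![apply: db_setv => //].
      * have : 2 * m * (size PL1).+1 <= 2 * m * (size PL + m).+1.
          by rewrite leq_mul2l; apply/orP; right; lia.
        lia.
      * lia.
    move=> T3 s3 [sv3 sa3] [hT3 [hE3 [L3 hdb3]]].
    exists n.+1; eexists; exists L3; split; [|exact: hE3|exact: hdb3| |lia].
      by split=> //; rewrite sv3.
    rewrite /= hfl2; split.
      + by apply: good_pat => // k _ _; exact: odd_fresh.
      + by rewrite /=; lia.
      + apply: cov' => [w hw|_ _]; rewrite inE ?hw ?orbT //.
        by apply/orP; left; apply/eqP.
      + by move=> w /hsub1 hw; rewrite inE hw orbT.
- move=> T1 s1 [sv sa] [n [PL1 [L1 [[hf hnm] hE1 hdb1 [hg1 hs1 hc1 hsub1] hT1]]]].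
  rewrite /= hf hE1.1 => hge; have en : n = m by lia.
  rewrite en in hs1 hc1; split; first lia.
  by exists PL1, L1.
Qed.
Definition slot dir s i := exists g h,
  [/\ bracket (orient dir m q) m i g h,
      arr s aV (lab dir m i) = m.+1 - dpos dir m i,
      arr s aLo (lab dir m i) = (if g <= m then m.+1 - dpos dir m g else 0) &
      arr s aHi (lab dir m i) = (if i.+2 < g then m.+1 - dpos dir m h else 0)].

Lemma slot_frame dir s s' i : slot dir s i ->
  (forall a, a \in [:: aV; aLo; aHi] -> arr s' a (lab dir m i) = arr s a (lab dir m i)) ->
  slot dir s' i.
Proof. by move=> [g [h [h1 h2 h3 h4]]] H; exists g, h; split=> //; rewrite H. Qed.

Lemma brk_ok dir s T Tb i : env s -> 0 < i < m -> var s vi = i ->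
  var s vv = orient dir m q i.+1 -> var s vlab = lab dir m i -> m < sb -> m + Tb <= T ->
  tri s (brk dir) T (fun T' s' => [/\ Tb <= T', slot dir s' i &
    forall a j, j != lab dir m i -> arr s' a j = arr s a j]).
Proof.
move=> [hM hQ] hi hvi hv hl hsb hT.
have hls : lab dir m i < sb by have := lab_in dir hi; lia.
apply: tri_seq; apply: tri_set; apply: tri_seq; apply: tri_set; apply: tri_seq.
apply: (tri_while (I := fun T s1 => exists f h,
  [/\ var s1 vf = f, var s1 vh = h, i.+2 <= f <= m.+1,
      forall k, i.+1 < k < f -> orient dir m q i.+1 < orient dir m q k &
      [/\ i.+2 < f -> i.+1 < h < f /\
            (forall k, i.+1 < k < f -> orient dir m q h <= orient dir m q k),
          f = i.+2 -> h = f & Tb + (m.+1 - f) <= T]])).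
- exists i.+2, i.+2; rewrite /= hvi addn2; split=> //; [lia|by move=> k; lia|].
  by split=> //; lia.
- move=> T1 s1 [sv sa] [f [h [hf hh hfm h1 [h2 h3 hT1]]]].
  have hE1 : env s1 by split=> [|k]; [rewrite sv //; exact: hM|rewrite sa //; exact: hQ].
  have := eval_get dir (Var vf) hE1; have := eval_get dir (Var vh) hE1.
  rewrite /= hf hh sv //= hv => e1 e2; rewrite e2 => hlt.
  have hfm' : f <= m.
    by rewrite leqNgt; apply/negP => hn; move: hlt; rewrite (orient_out dir (k := f)) //; lia.
  split; first lia.
  apply: tri_seq; apply: tri_if => /=; rewrite e1 e2 => hc.
    apply: tri_set; apply: tri_set; exists f.+1, f; rewrite /= hf addn1; split=> //; try lia.
      by move=> k hk; case: (eqVneq k f) => [->|ne]; [lia|apply: h1; lia].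
    split; [|lia..] => _; split; first lia.
    move=> k hk; case: (eqVneq k f) => [->//|ne].
    have [|h4 h5] := h2; first lia.
    by have := h5 k; lia.
  apply: tri_skip; apply: tri_set; exists f.+1, h; rewrite /= hf addn1 hh; split=> //; try lia.
    by move=> k hk; case: (eqVneq k f) => [->|ne]; [lia|apply: h1; lia].
  split; [|lia..] => _.
  case: (ltngtP f i.+2) hfm => [hlt2|hgt|e] hfm; first lia.
    have [h4 h5] := h2 hgt; split; first lia.
    by move=> k hk; case: (eqVneq k f) => [->|ne]; [lia|apply: h5; lia].
  have eh := h3 e; split; first lia.
  by move=> k hk; have -> : k = h by lia.
- move=> T1 s1 [sv sa] [f [h [hf hh hfm h1 [h2 h3 hT1]]]].
  have hE1 : env s1 by split=> [|k]; [rewrite sv //; exact: hM|rewrite sa //; exact: hQ].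
  have hM1 := hE1.1.
  have := eval_get dir (Var vf) hE1.
  rewrite /= hf sv //= hv => e2; rewrite e2 => hge.
  have hvi1 : var s1 vi = i by rewrite sv.
  have hl1 : var s1 vlab = lab dir m i by rewrite sv.
  have hb : bracket (orient dir m q) m i f h.
    split=> // hfm'; have hne : orient dir m q f != orient dir m q i.+1.
      apply/eqP => e; have : f = i.+1 by [apply: (dinj_orient (dir := dir) hqi); lia].
      lia.
    lia.
  apply: tri_seq; apply: tri_put => /=; first by rewrite hl1.
  rewrite eval_at // hl1 hM1 addn1 /= hvi1.
  apply: tri_seq; apply: (tri_use (P := fun T2 s2 => T2 = T1 /\
      var s2 vx = if f <= m then m.+1 - dpos dir m f else 0)).
    apply: tri_if => /=; rewrite hf hM1 => hc; apply: tri_set => /=; split=> //.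
      by rewrite eval_at //= hf hM1 addn1; case: ifP; lia.
    by case: ifP; lia.
  move=> T2 s2 [sv2 sa2] [-> hx2].
  have hvi2 : var s2 vi = i by rewrite sv2.
  have hf2 : var s2 vf = f by rewrite sv2.
  have hh2 : var s2 vh = h by rewrite sv2.
  have hM2 : var s2 vM = m by rewrite sv2.
  have hl2 : var s2 vlab = lab dir m i by rewrite sv2.
  apply: tri_seq; apply: tri_put; first by rewrite /= hl2.
  apply: tri_seq; apply: (tri_use (P := fun T2 s2 => T2 = T1 /\
      var s2 vx = if i.+2 < f then m.+1 - dpos dir m h else 0)).
    apply: tri_if => /=; rewrite hvi2 hf2 => hc; apply: tri_set => /=; split=> //.
      by rewrite eval_at //= hh2 hM2 addn1; case: ifP; lia.
    by case: ifP; lia.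
  move=> T3 s3 [sv3 sa3] [-> hx3].
  apply: tri_put; rewrite /= sv3 //= hl2 //.
  split; first lia.
    exists f, h; rewrite /= eqxx hx3; split=> //; rewrite sa3 //= ?hl2 ?eqxx //.
    by rewrite sa2 //= eqxx.
  move=> a j hj; rewrite (negPf hj) andbF sa3 //= hl2 (negPf hj) andbF sa2 //=.
  by rewrite (negPf hj) andbF sa.
Qed.

Definition covI dir n s (PL : database) := forall i, 0 < i <= n -> i < m ->
  orient dir m q i < orient dir m q i.+1 ->
  [/\ (enc (pat dir m q i (orient dir m q i).+1) m, lab dir m i, false) \in PL,
      (enc (swap q (lab dir m i)) m, lab dir m i, true) \in PL &
      slot dir s i].

Lemma lab_inj dir i j : 0 < i < m -> 0 < j < m -> lab dir m i = lab dir m j -> i = j.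
Proof. by move=> hi hj e; rewrite -(labK dir hi) e labK. Qed.

(** An ascent in one direction is a descent in the other, so the two runs of [patI] never write to
    the same slot. *)
Lemma lab_neg dir i j : 0 < i < m -> 0 < j < m -> orient dir m q i < orient dir m q i.+1 ->
  orient (~~ dir) m q j < orient (~~ dir) m q j.+1 -> lab (~~ dir) m j != lab dir m i.
Proof.
move=> hi hj h1 h2; apply/eqP => e; move: e h1 h2.
case: dir; rewrite /orient /lab /mirror /= => e h1 h2.
  have e1 : m.+1 - j = i.+1 by lia.
  have e2 : m.+1 - j.+1 = i by lia.
  by rewrite e1 e2 in h2; lia.
have e1 : m.+1 - i = j.+1 by lia.
have e2 : m.+1 - i.+1 = j by lia.
by rewrite e1 e2 in h1; lia.
Qed.

(** For each ascent: one outer iteration, two insertions of [2 * m] and at most [m] for [brk],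
    within [7 * m]. *)
Lemma patI_ok dir s T Tb PL L : env s -> db m s PL L -> good PL ->
  1 + 2 * m * (size PL + 2 * m).+1 <= sb -> m.+1 < sb -> 7 * m * m + Tb <= T ->
  tri s (patI dir) T (fun T' s' => Tb <= T' /\ exists PL' L',
    [/\ env s', db m s' PL' L' /\ covI dir m s' PL',
        good PL' /\ {subset PL <= PL'}, size PL' <= size PL + 2 * m &
        forall i, 0 < i < m -> orient (~~ dir) m q i < orient (~~ dir) m q i.+1 ->
          slot (~~ dir) s i -> slot (~~ dir) s' i]).
Proof.
move=> hE hdb hg hsb hmsb hT.
apply: tri_seq; apply: tri_set.
apply: (tri_while (I := fun T s1 => exists n PL' L',
  [/\ var s1 vi = n /\ n < m, env s1, db m s1 PL' L' /\ covI dir n s1 PL',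
      [/\ good PL', size PL' <= size PL + 2 * n, {subset PL <= PL'} &
         forall i, 0 < i < m -> orient (~~ dir) m q i < orient (~~ dir) m q i.+1 ->
          slot (~~ dir) s i -> slot (~~ dir) s1 i] &
      Tb + 7 * m * (m - n) <= T])).
- exists 0, PL, L; split=> //.
  + by split; [apply: db_setv|move=> i; lia].
  + by split=> //; rewrite addn0.
  + by rewrite subn0; lia.
- move=> T1 s1 _ [n [PL1 [L1 [[hi hnm] hE1 [hdb1 hc1] [hg1 hs1 hsub1 hsl1] hT1]]]].
  have hM1 := hE1.1.
  rewrite /= hi hM1 addn1 => hlt; have {}hlt : n.+1 < m by lia.
  have hmm : 7 * m * (m - n) = 7 * m * (m - n.+1) + 7 * m.
    by have -> : m - n = (m - n.+1).+1 by [lia]; rewrite mulnSr.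
  rewrite hmm in hT1; clear hmm hT; move: hT1; set A := 7 * m * (m - n.+1) => hT1.
  split; first lia.
  apply: tri_seq; apply: tri_set; apply: tri_seq; apply: tri_set; apply: tri_seq; apply: tri_set.
  set s2 := setv s1 _ _.
  have hE2 : env s2 by [].
  have e1 : eval s2 (Get 0 (at_ dir 10)) = orient dir m q n.+1.
    by rewrite (eval_get dir _ hE2) /= hi addn1.
  rewrite e1; set s3 := setv s2 _ _.
  have hE3 : env s3 by [].
  have e2 : eval s3 (Get 0 (at_ dir (Inc 10 1))) = orient dir m q n.+2.
    by rewrite (eval_get dir _ hE3) /= hi !addn1.
  rewrite e2; have hdb3 : db m (setv s3 12 (orient dir m q n.+2)) PL1 L1.
    by do 3![apply: db_setv => //].
  have hi3 : var s3 vi = n.+1 by rewrite /= hi addn1.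
  have hu3 : var s3 vu = orient dir m q n.+1 by [].
  apply: tri_if => /= hc; last first.
    apply: tri_skip; exists n.+1, PL1, L1; split=> //=; last lia.
    + split=> // i hi0 him ha; case: (eqVneq i n.+1) => [e|ne].
        by move: ha; rewrite e; lia.
      have [h1 h2 h3] := hc1 i ltac:(lia) him ha; split=> //.
    + split=> //; lia.
  have {}hc : orient dir m q n.+1 < orient dir m q n.+2 by lia.
  have hn0 : 0 < n.+1 < m by lia.
  have hszm k : k <= 1 -> 1 + 2 * m * (size PL1 + k).+1 <= sb.
    move=> hk; apply: leq_trans hsb; rewrite leq_add2l leq_mul2l; apply/orP; right; lia.
  apply: tri_seq; apply: tri_set; apply: tri_seq; apply: tri_set; apply: tri_seq; apply: tri_set.
  rewrite eval_labe //= hi !addn1.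
  apply: tri_seq; apply: tri_use.
    apply: (insert_pat_ok (i := n.+1) (z := (orient dir m q n.+1).+1) (PL := PL1) (L := L1)
        (Tb := Tb + A + 4 * m)) => //=.
    + by do 3![apply: db_setv => //].
    + by have := hszm 0; rewrite addn0; apply.
    + lia.
  move=> T4 s4 [sv4 sa4] [hT4 [hE4 [L4]]].
  rewrite [var _ vlab]/= [var _ vflag]/=.
  set PL4 := _ :: _ => hdb4.
  apply: tri_seq; apply: tri_set; apply: tri_seq; apply: tri_set.
  have hvi4 : var s4 vi = n.+1 by rewrite sv4 //= hi addn1.
  have hvv4 : var s4 vv = orient dir m q n.+2 by rewrite sv4.
  have hvl4 : var s4 vlab = lab dir m n.+1 by rewrite sv4.
  apply: tri_seq; apply: tri_use.
    apply: (insert_pat_ok (i := n.+1) (z := orient dir m q n.+2) (PL := PL4) (L := L4)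
        (Tb := Tb + A + 2 * m)) => //=.
    + by do 2![apply: db_setv => //].
    + by rewrite sv4.
    + by have := hszm 1; rewrite addn1; apply.
    + lia.
  move=> T5 s5 [sv5 sa5] [hT5 [hE5 [L5]]].
  rewrite [var _ vlab]/= [var _ vflag]/= hvl4.
  set PL5 := _ :: _ => hdb5.
  have hvi5 : var s5 vi = n.+1 by rewrite sv5.
  apply: tri_use.
    apply: (brk_ok (i := n.+1) (Tb := Tb + A)) => //.
    + by rewrite sv5.
    + by rewrite sv5.
    + lia.
    + lia.
  move=> T6 s6 hs6 [hT6 hslot hother]; have [sv6 sa6] := hs6.
  have hsame a j : a \in [:: 9; 10; 11] -> j != lab dir m n.+1 -> arr s6 a j = arr s1 a j.
    rewrite !inE => /or3P[]/eqP-> hj; by rewrite hother // sa5 // [LHS]/= sa4.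
  have hin4 : {subset PL1 <= PL5} by move=> w hw; rewrite !inE hw !orbT.
  exists n.+1, PL5, L5; split.
  + by rewrite sv6.
  + by split=> [|k]; rewrite ?sv6 ?sa6 //; case: hE5.
  + split; first exact: (db_same hs6).
    move=> i hi0 him ha; case: (eqVneq i n.+1) => [->|ne].
      split=> //; first by rewrite /PL5 /PL4 in_cons mem_head orbT.
      rewrite /PL5 inE; apply/orP; left; apply/eqP; congr (_, _, _).
      by apply: eq_enc => k hk; rewrite pat_swap.
    have [h1 h2 h3] := hc1 i ltac:(lia) him ha; split; try exact: hin4.
    apply: (slot_frame h3) => a hain; apply: hsame => //.
    apply/eqP => e; case/eqP: ne; apply: (lab_inj _ _ e); lia.
  + split.
    * apply: good_pat => //; first by move=> k hk nk; apply/eqP => e;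
        case/eqP: nk; apply: (dinj_orient (dir := dir) hqi) e; lia.
      by apply: good_pat => // k _ _; exact: odd_fresh.
    * by rewrite /=; lia.
    * by move=> w /hsub1/hin4.
    * move=> i hi0 ha /hsl1 h; apply: (slot_frame (h hi0 ha)) => a hain.
      by apply: hsame => //; apply: lab_neg.
  + lia.
- move=> T1 s1 _ [n [PL1 [L1 [[hi hnm] hE1 [hdb1 hc1] [hg1 hs1 hsub1 hsl1] hT1]]]].
  rewrite /= hi hE1.1 addn1 => hge; have en : n = m.-1 by lia.
  split; first lia.
  exists PL1, L1; split=> //; last lia.
  by split=> // i h1 h2; apply: hc1; lia.
Qed.
End Patterns.

(** * Ranks *)

(* Even positive numbers leave room for the odd values inserted between them
   and for the sentinel 0. *)
Definition rk (u : seq int) k :=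
  if 0 < k <= size u then 2 + 2 * count (fun z => (z < nth 0%R u k.-1)%R) u else 0.

Lemma count_lt_mono (u : seq int) a b : a \in u -> (a < b)%R ->
  count (fun z => (z < a)%R) u < count (fun z => (z < b)%R) u.
Proof.
move=> ha hab.
have := count_predUI (fun z => (z < a)%R) (pred1 a) u.
have -> : count (predI (fun z => (z < a)%R) (pred1 a)) u = 0.
  rewrite (eq_count (a2 := pred0)) ?count_pred0 // => z /=.
  by case: eqP => [->|_]; rewrite ?ltxx ?andbF.
have : 0 < count (pred1 a) u by rewrite -has_count has_pred1.
have : count (predU (fun z => (z < a)%R) (pred1 a)) u <= count (fun z => (z < b)%R) u.
  by apply: sub_count => z /= /orP[h|/eqP->//]; exact: lt_trans hab.
by move=> h1 h2; rewrite addn0 => h3; apply: leq_trans h1; rewrite h3 -addn1 leq_add2l.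
Qed.

Lemma repr_rk u : repr u (rk u).
Proof.
move=> a b ha hb; rewrite /rk /= ha hb.
case: (ltgtP (nth 0%R u a) (nth 0%R u b)) => [h|h|->]; last by rewrite ltnn.
  by apply/esym; rewrite ltn_add2l ltn_mul2l /= (count_lt_mono (mem_nth 0%R ha) h).
by apply/esym/negbTE; rewrite -leqNgt leq_add2l leq_mul2l /= ltnW //
  (count_lt_mono (mem_nth 0%R hb) h).
Qed.

Lemma rk_out u k : ~~ (0 < k <= size u) -> rk u k = 0.
Proof. by rewrite /rk => /negPf->. Qed.

Lemma rk_even u k : 0 < k <= size u -> 0 < rk u k /\ ~~ odd (rk u k).
Proof. by rewrite /rk => ->; split; [|rewrite oddD oddM]. Qed.

Lemma rk_inj u : uniq u -> dinj (rk u) (size u).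
Proof.
move=> hu a b ha hb e.
have ha' : a.-1 < size u by lia.
have hb' : b.-1 < size u by lia.
have h1 := repr_rk ha' hb'; have h2 := repr_rk hb' ha'.
have ea : a.-1.+1 = a by lia.
have eb : b.-1.+1 = b by lia.
rewrite ea eb e ltnn in h1 h2.
suff : a.-1 = b.-1 by lia.
apply/eqP; rewrite -(nth_uniq 0%R ha' hb' hu).
by move: h1 h2; case: ltgtP.
Qed.

Section Rank.
Variables (p t : seq int) (sb : nat).
Local Notation tri := (tri p t sb).

Lemma rank_ok s T Tb : (forall k, arr s aQ k = 0) -> size p < sb ->
  2 * size p * size p + Tb <= T ->
  tri s rank T (fun T' s' => Tb <= T' /\ env (size p) (rk p) s').
Proof.
move=> h0 hsb; set m := size p => hT.
apply: tri_seq; apply: tri_len; apply: tri_seq; apply: tri_set.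
apply: (tri_while (I := fun T s1 => exists n,
  [/\ var s1 vk = n, n <= m,
      forall k, arr s1 aQ k = if k <= n then rk p k else 0 &
      Tb + 2 * m * (m - n) <= T])).
- exists 0; split=> //= [k|]; last by rewrite subn0 addnC.
  by rewrite h0; case: ifP => //; rewrite leqn0 => /eqP->.
- move=> T1 s1 [sv sa] [n [hn hnm hQ hT1]].
  have hM1 : var s1 vM = m by rewrite sv.
  rewrite /= hn hM1 => hlt; have {}hlt : n < m by lia.
  have hmm : 2 * m * (m - n) = 2 * m * (m - n.+1) + 2 * m.
    by have -> : m - n = (m - n.+1).+1 by [lia]; rewrite mulnSr.
  rewrite hmm in hT1; clear hmm hT; move: hT1; set A := 2 * m * (m - n.+1) => hT1.
  split; first lia.
  apply: tri_seq; apply: tri_set; apply: tri_seq; apply: tri_set.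
  apply: tri_seq; apply: tri_set; apply: tri_seq.
  apply: (tri_while (I := fun T s2 => exists j,
    [/\ var s2 vj = j, j <= m,
        var s2 vu = 2 + 2 * count (fun z => (z < nth 0%R p n)%R) (take j p) &
        Tb + A + (m - j) <= T])).
  + exists 0; rewrite take0 /=; split=> //; lia.
  + move=> T2 s2 [sv2 sa2] [j [hj hjm hu hT2]].
    have hM2 : var s2 vM = m by rewrite sv2.
    have hk2 : var s2 vk = n.+1 by rewrite sv2 //= hn addn1.
    rewrite /= hj hM2 => hlt2; have {}hlt2 : j < m by lia.
    split; first lia.
    apply: tri_seq; apply: tri_set; apply: tri_seq; apply: tri_cmp => /=.
    * by rewrite hj; lia.
    * by rewrite hk2; lia.
    rewrite hj hk2 addn1 /=.
    have hc : count (fun z => (z < nth 0%R p n)%R) (take j.+1 p) =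
      (nth 0%R p j < nth 0%R p n)%R + count (fun z => (z < nth 0%R p n)%R) (take j p).
      by rewrite (take_nth 0%R) // -cats1 count_cat /=; lia.
    move: hc hu; set c := count _ (take j p) => hc hu.
    move: hc; case: (nth 0%R p j < nth 0%R p n)%R => /= hc; apply: tri_if => //= _.
      by apply: tri_set; exists j.+1; rewrite /= hc hu; split=> //; lia.
    by apply: tri_skip; exists j.+1; rewrite /= hc hu; split=> //; lia.
  + move=> T2 s2 [sv2 sa2] [j [hj hjm hu hT2]].
    have hM2 : var s2 vM = m by rewrite sv2.
    have hk2 : var s2 vk = n.+1 by rewrite sv2 //= hn addn1.
    rewrite /= hj hM2 => hge; have ej : j = m by lia.
    apply: tri_put => /=; first by rewrite hk2; lia.
    exists n.+1; rewrite hk2 hu ej take_size; split=> //.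
    * move=> k /=; rewrite sa2 //= hQ.
      case: (eqVneq k n.+1) => [->|ne]; last first.
        by have -> : (k <= n.+1) = (k <= n) by lia.
      by rewrite leqnn /rk /= -/m hlt.
    * lia.
- move=> T1 s1 [sv sa] [n [hn hnm hQ hT1]].
  have hM1 : var s1 vM = m by rewrite sv.
  rewrite /= hn hM1 => hge; have en : n = m by lia.
  split; first lia.
  split=> // k; rewrite hQ en; case: ifP => // /negbT h.
  by rewrite rk_out //; lia.
Qed.

End Rank.

(** * From the trie to an automaton *)

(** An absent transition is copied from the failure node, which is shorter and hence already
    complete. A closing letter at depth 0 leaves the word unchanged, so that transition is a
    loop. *)
Definition half b :=
  Set_ vc (Get (aC b) vs) ;;
  If vc
    (Put aFail vc (Get (aC b) vg) ;; Put aq vqt vc ;; Set_ vqt (Inc vqt 1))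
    (If (if b then Num 1 else Get aDep vs)
       (Put (aC b) vs (Get (aC b) vg)) (Put (aC b) vs vs)).

(* For the root, of index 0, the absent child 0 is already the right transition. *)
Definition bfs :=
  Set_ vqh (Num 0) ;; Set_ vqt (Num 1) ;; Put aq (Num 0) (Get aC1 (Num 0)) ;;
  While (Lt vqh vqt) (
    Set_ vs (Get aq vqh) ;; Set_ vqh (Inc vqh 1) ;; Set_ vg (Get aFail vs) ;;
    half false ;; half true).

Section Bfs.
Variables (p t : seq int) (sb : nat) (L : seq (seq bool)).
Local Notation tri := (tri p t sb).
Hypothesis hL : prefix_tree L.
Hypothesis hsb : size L <= sb.

Definition kid s b i := child (arr s aC0) (arr s aC1) b i.

Definition goto_ok s w b :=
  exists v, longest L (step w b) v /\ kid s b (index w L) = index v L.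

(** The child arrays are turned into the transition table in place: [D] marks the pairs of node and
    letter that are final, the others still hold trie edges. *)
Record bfs_inv s (qs : seq (seq bool)) (D : seq bool -> bool -> bool) : Prop := BfsInv {
  bi_tail : var s vqt = size qs;
  bi_queue : forall i, i < size qs -> arr s aq i = index (nth [::] qs i) L;
  bi_uniq : uniq qs;
  bi_in : forall w, w \in qs -> w \in L /\ w != [::];
  bi_mem : forall u b, rcons u b \in L -> (rcons u b \in qs) = (u == [::]) || D u b;
  bi_fail : forall w, w \in qs ->
    exists v, longest L (del w) v /\ arr s aFail (index w L) = index v L;
  bi_goto : forall w b, w \in L -> (w == [::]) || D w b -> goto_ok s w b;
  bi_kid : forall w b, w \in L -> w != [::] -> ~~ D w b ->
    kid s b (index w L) = if rcons w b \in L then index (rcons w b) L else 0;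
  bi_dep : forall w, w \in L -> arr s aDep (index w L) = dep w }.

Lemma kidE s b i : arr s (aC b) i = kid s b i. Proof. by case: b. Qed.

Lemma index_inj w v : w \in L -> v \in L -> index w L = index v L -> w = v.
Proof. by move=> hw hv e; rewrite -(nth_index [::] hw) e nth_index. Qed.

Lemma step_rcons w b : rcons w b \in L -> step w b = rcons w b.
Proof. by rewrite /step; case: b => //= /(pt_pop hL) ->. Qed.

(** Both the failure of a child and an absent transition ask for the state of [step (del v) b],
    which the completed node [f] supplies. *)
Lemma half_ok b s T qs (D : seq bool -> bool -> bool) v f : bfs_inv s qs D ->
  v \in L -> v != [::] -> ~~ D v b -> var s vs = index v L ->
  longest L (del v) f -> var s vg = index f L -> (f == [::]) || D f b ->
  tri s (half b) T (fun T' s' => T' = T /\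
    bfs_inv s' (if rcons v b \in L then rcons qs (rcons v b) else qs)
      (fun u c => D u c || ((u == v) && (c == b)))).
Proof.
move=> [h1 h2 h3 h4 h5 h6 h7 h8 h9] hv hv0 hD hs hf hg hDf.
have [g [hg1 hg2]] := h7 f b (longest_in hf) hDf.
have hgL := longest_in hg1.
have hvi : index v L < sb by apply: leq_trans hsb; rewrite index_mem.
have hstep : step v b \in L \/ longest L (step v b) g.
  case: (boolP (step v b \in L)) => h; [by left|right].
  apply: LongestDel => //; rewrite del_step //; exact: (longest_step hL) hf _.
apply: tri_seq; apply: tri_set; apply: tri_if => /=.
  rewrite kidE hs h8 //; case: ifP => // hin _.
  have hnew : rcons v b \notin qs by rewrite h5 // (negPf hv0) (negPf hD).
  have hci : index (rcons v b) L < sb by apply: leq_trans hsb; rewrite index_mem.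
  have hqs : size qs < size L.
    have : size (rcons qs (rcons v b)) <= size L.
      apply: uniq_leq_size; first by rewrite rcons_uniq hnew.
      by move=> w; rewrite mem_rcons inE => /orP[/eqP->|/h4[]].
    by rewrite size_rcons.
  apply: tri_seq; apply: tri_put => //; apply: tri_seq; apply: tri_put.
    by rewrite /= h1; exact: leq_trans hqs hsb.
  apply: tri_set; split=> //.
  have e1 : arr (setv s 5 (index (rcons v b) L)) (aC b) (var s vg) = index g L.
    by rewrite hg /= kidE hg2.
  rewrite /= e1 h1.
  split=> //=.
  - by rewrite size_rcons addn1.
  - move=> i; rewrite size_rcons nth_rcons => hi.
    case: eqP => [->|ne]; first by rewrite ltnn.
    have hi' : i < size qs by rewrite ltn_neqAle -ltnS hi andbT; apply/eqP.
    by rewrite hi' h2.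
  - by rewrite rcons_uniq hnew.
  - move=> w; rewrite mem_rcons inE => /orP[/eqP->|/h4//].
    by rewrite -size_eq0 size_rcons.
  - move=> u c hu; rewrite mem_rcons inE eqseq_rcons h5 //.
    by case: (u == v); case: (c == b); rewrite ?orbT ?orbF.
  - move=> w; rewrite mem_rcons inE => hw.
    case: (eqVneq w (rcons v b)) hw => [-> _|ne hw].
      exists g; rewrite eqxx; split=> //.
      by rewrite -(step_rcons hin) del_step //; exact: (longest_step hL) hf _.
    have [k1 k2] := h4 w hw; have [v' [k3 k4]] := h6 w hw; exists v'; split=> //.
    case: eqP => // /(index_inj k1 hin) e; by rewrite e eqxx in ne.
  - move=> w c hw; rewrite orbA => /orP[/(h7 w c hw)//|/andP[/eqP-> /eqP->]].
    exists (rcons v b); split; first by rewrite (step_rcons hin); constructor.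
    by have := h8 v b hv hv0 hD; rewrite hin.
  - by move=> w c hw hw0; rewrite negb_or => /andP[k1 k2]; exact: h8.
rewrite kidE hs h8 // => hz.
have hn : rcons v b \notin L.
  apply/negP => hin; move: hz; rewrite hin => /eqP; rewrite (pt_index0 hL) //.
  by rewrite -size_eq0 size_rcons.
rewrite (negPf hn).
have key s' u : (forall w, w \in L -> longest L (step v b) u -> u \in L) ->
  longest L (step v b) u ->
  (forall a i, (a != aC b) || (i != index v L) -> arr s' a i = arr s a i) ->
  arr s' (aC b) (index v L) = index u L -> var s' vqt = var s vqt ->
  bfs_inv s' qs (fun u c => D u c || ((u == v) && (c == b))).
  move=> _ hu hfr hval hvq.
  have kid' w c : w \in L -> (w != v) || (c != b) -> kid s' c (index w L) = kid s c (index w L).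
    move=> hw hne; rewrite -!kidE hfr //; move: hne.
    case: (eqVneq c b) => [->|ne _]; last by rewrite /aC; case: (c) (b) ne => -[].
    rewrite orbF eqxx /=; apply: contraNN => /eqP e; apply/eqP; exact: index_inj e.
  have hb : aC b \in [:: 2; 3] by case: (b).
  split=> //.
  - by rewrite hvq.
  - by move=> i hi; rewrite hfr ?h2 //; case: (b).
  - move=> w c hw; rewrite h5 //.
    have -> : (w == v) && (c == b) = false.
      by apply/negP => /andP[/eqP e1 /eqP e2]; move: hw; rewrite e1 e2 (negPf hn).
    by rewrite orbF.
  - by move=> w /h6[v' [k1 k2]]; exists v'; rewrite hfr //; case: (b).
  - move=> w c hw; case: (boolP ((w == v) && (c == b))) => [/andP[/eqP-> /eqP->] _|hne].
      by exists u; rewrite -kidE hval.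
    rewrite orbF => /(h7 w c hw) [v' [k1 k2]]; exists v'; split=> //.
    by rewrite kid' // -negb_and.
  - move=> w c hw hw0; rewrite negb_or => /andP[k1 k2].
    by rewrite kid' ?h8 // -negb_and.
  - by move=> w hw; rewrite hfr ?h9 //; case: (b).
have e1 : arr s (aC b) (index f L) = index g L by rewrite kidE hg2.
have hfr' w (a i : nat) : (a != aC b) || (i != index v L) ->
   (if (a == aC b) && (i == index v L) then w else arr s a i) = arr s a i.
  by rewrite -negb_and => /negPf->.
apply: tri_if => /= hc; apply: tri_put; rewrite /= ?hs // ?hg ?e1; split=> //.
  apply: (key _ g) => //=; last by rewrite !eqxx.
    case: hstep => //; rewrite /step.
    have -> : b || (0 < dep v).
      by move: hc; case: (b) => //=; rewrite hs h9 // lt0n.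
    by rewrite (negPf hn).
  exact: hfr'.
have [eb ed] : b = false /\ dep v = 0.
  by move: hc; case: (b) => //=; rewrite hs h9.
have est : step v b = v by rewrite /step eb ed.
apply: (key _ v) => //=; first by rewrite est; constructor.
  exact: hfr'.
by rewrite !eqxx.
Qed.

Lemma bfs_ok s T Tb : trie_mem (arr s aC0) (arr s aC1) (arr s aDep) L -> [:: true] \in L ->
  (forall i, arr s aFail i = 0) -> size L + Tb <= T ->
  tri s bfs T (fun T' s' => Tb <= T' /\ forall w b, w \in L -> goto_ok s' w b).
Proof.
move=> hm h1 hfail hT.
have hL0 : 0 < size L by case: hL.
have hnil := pt_nil hL.
have hi0 : index [::] L = 0 by apply/eqP; rewrite (pt_index0 hL).
have hf1 : [:: false] \notin L by apply/negP => /(pt_pop hL (w := [::])).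
apply: tri_seq; apply: tri_set; apply: tri_seq; apply: tri_set; apply: tri_seq.
apply: tri_put; first by rewrite /=; lia.
have hk0 b : kid s b 0 = if b then index [:: true] L else 0.
  by have := tm_child hm b hnil; rewrite hi0 /=; case: b; rewrite ?h1 ?(negPf hf1).
apply: (tri_while (I := fun T s1 => exists h qs,
  [/\ var s1 vqh = h /\ h <= size qs,
      bfs_inv s1 qs (fun u _ => u \in take h qs),
      forall j k, j < k < size qs -> size (nth [::] qs j) <= size (nth [::] qs k),
      forall i w, h <= i < size qs -> w \in qs -> size w <= (size (nth [::] qs i)).+1 &
      Tb + (size L - h) <= T])).
- exists 0, [:: [:: true]]; split=> //=.
  + split=> //=.
    * move=> i; rewrite ltnS leqn0 => /eqP-> /=; exact: (hk0 true).
    * by move=> w; rewrite inE => /eqP->.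
    * move=> u b hu; rewrite inE in_nil orbF.
      case: u hu => [|a u] hu; last first.
        by rewrite -[LHS]/((a == true) && (rcons u b == [::])) -size_eq0 size_rcons andbF.
      by case: b hu => //= hu; rewrite hu in hf1.
    * move=> w; rewrite inE => /eqP->; exists [::]; split; first by constructor.
      by rewrite hfail hi0.
    * move=> w b hw; rewrite in_nil orbF => /eqP->; case: b.
        exists [:: true]; split; first by constructor.
        by rewrite hi0; exact: (hk0 true).
      exists [::]; split; first by constructor.
      by rewrite hi0; exact: (hk0 false).
    * by move=> w b hw _ _; exact: (tm_child hm).
    * exact: (tm_dep hm).
  + by move=> j k; lia.
  + by move=> i w hi; rewrite inE => /eqP->; case: i hi.
  + lia.
- move=> T1 s1 _ [h [qs [[hh hhq] hI hsrt hwin hT1]]].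
  have hqL : size qs <= size L.
    by apply: uniq_leq_size; [exact: (bi_uniq hI)|move=> w /(bi_in hI)[]].
  rewrite /= hh (bi_tail hI) => hlt; have {}hlt : h < size qs by lia.
  split; first lia.
  set v := nth [::] qs h.
  have hvq : v \in qs by exact: mem_nth.
  have [hvL hv0] := bi_in hI hvq.
  (* By induction on prefixes: [u] was enqueued when its parent was processed, and the queue, sorted
     by length, places it before the longer [v]. The failure of [v] is such a word, since [del]
     shortens. *)
  have hproc u : u \in L -> size u < size v -> (u == [::]) || (u \in take h qs).
    elim/last_ind: u => [//|u b IH] huL hsz; rewrite size_rcons in hsz.
    have {}IH := IH (pt_closed hL huL) (ltnW hsz).
    have hq := bi_mem hI huL; rewrite IH in hq.
    apply/orP; right.
    have hidx : index (rcons u b) qs < size qs by rewrite index_mem.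
    have hlt2 : index (rcons u b) qs < h.
      rewrite ltnNge; apply/negP => hge.
      have : size v <= size (rcons u b).
        rewrite -(nth_index [::] hq); move: hge; rewrite leq_eqVlt => /orP[/eqP e|hge].
          by rewrite /v e.
        by apply: hsrt; rewrite hge hidx.
      by rewrite size_rcons leqNgt hsz.
    by rewrite -(nth_index [::] hq) -(nth_take [::] hlt2) mem_nth // size_take hlt.
  have [f [hf hfa]] := bi_fail hI hvq.
  have hfd : (f == [::]) || (f \in take h qs).
    apply: hproc; first exact: longest_in hf.
    by apply: leq_ltn_trans (longest_size hL hf) (size_del hv0).
  have hvt : v \notin take h qs.
    have := bi_uniq hI; rewrite -{1}(cat_take_drop h qs) (drop_nth [::]) // cat_uniq.
    by move=> /and3P[_ /hasPn/(_ v) hn _]; apply: hn; rewrite inE eqxx.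
  apply: tri_seq; apply: tri_set; apply: tri_seq; apply: tri_set; apply: tri_seq; apply: tri_set.
  rewrite /= hh addn1 (bi_queue hI hlt) -/v hfa.
  set s2 := setv _ vg _.
  have hI2 : bfs_inv s2 qs (fun u _ => u \in take h qs) by case: hI.
  apply: tri_seq; apply: tri_use.
    exact: (half_ok (b := false) _ hI2 hvL hv0 hvt _ hf).
  move=> T3 s3 [sv3 sa3] [-> hI3].
  have hb : (v \in take h qs) || ((v == v) && (true == false)) = false.
    by rewrite (negPf hvt) andbF.
  apply: tri_use.
    apply: (half_ok (b := true) _ hI3 hvL hv0 _ _ hf).
    - by rewrite hb.
    - by rewrite sv3.
    - by rewrite sv3.
    - by rewrite orbA hfd.
  move=> T4 s4 [sv4 sa4] [-> hI4].
  set new := (if rcons v false \in L then [:: rcons v false] else [::]) ++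
             (if rcons v true \in L then [:: rcons v true] else [::]).
  have eqs : (if rcons v true \in L
         then rcons (if rcons v false \in L then rcons qs (rcons v false) else qs) (rcons v true)
         else if rcons v false \in L then rcons qs (rcons v false) else qs) = qs ++ new.
    by rewrite /new; case: ifP; case: ifP => _ _ /=; rewrite -?cats1 -?catA ?cats0.
  rewrite eqs in hI4.
  have hnew w : w \in new -> size w = (size v).+1.
    rewrite /new mem_cat => /orP[]; case: ifP => // _; rewrite inE => /eqP->; by rewrite size_rcons.
  clearbody new.
  have hq4 : var s4 vqh = h.+1 by rewrite sv4 //= sv3.
  clear sv4 sa4 hI3 sv3 sa3 hI2 s2 hproc hfa hf hI hb hfd hvt eqs s3 T3 hk0 hf1 hnil hm hfail.
  have hqv w : w \in qs -> size w <= (size v).+1 by apply: hwin; rewrite leqnn.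
  have hge i : h <= i < size (qs ++ new) -> size v <= size (nth [::] (qs ++ new) i).
    move=> hi; rewrite nth_cat; case: ltnP => hi2.
      move: hi => /andP[]; rewrite leq_eqVlt => /orP[/eqP<-//|hi] _.
      by apply: hsrt; rewrite hi hi2.
    have hin : i - size qs < size new by move: hi; rewrite size_cat; lia.
    by rewrite [leqRHS]hnew ?leqnSn //; exact: mem_nth.
  exists h.+1, (qs ++ new); split.
  + by rewrite size_cat; split=> //; lia.
  + have et : take h.+1 (qs ++ new) = rcons (take h qs) v.
      by rewrite takel_cat // (take_nth [::]).
    case: hI4 => k1 k2 k3 k4 k5 k6 k7 k8 k9; split=> //.
    * move=> u b hu; rewrite k5 // et mem_rcons inE.
      by case: b {hu}; rewrite ?andbT ?andbF ?orbF /= [(u == v) || _]orbC.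
    * move=> w b hw; rewrite et mem_rcons inE => hor; apply: k7 => //.
      by move: hor; case: b; rewrite ?andbT ?andbF ?orbF /= [(w == v) || _]orbC.
    * move=> w b hw hw0; rewrite et mem_rcons inE => hor; apply: k8 => //.
      by move: hor; case: b; rewrite ?andbT ?andbF ?orbF /= [(w == v) || _]orbC.
  + move=> j k hjk; case: (ltnP k (size qs)) => hk.
      by rewrite !nth_cat hk; case: ltnP => [_|]; [apply: hsrt; lia|lia].
    rewrite [X in _ <= size X]nth_cat ltnNge hk /=.
    have hin : k - size qs < size new by move: hjk; rewrite size_cat; lia.
    rewrite [leqRHS]hnew; last exact: mem_nth.
    have hj : j < size (qs ++ new) by lia.
    have := mem_nth [::] hj.
    by rewrite mem_cat => /orP[/hqv|/hnew->].
  + move=> i w hi hw; have hi' : h <= i < size (qs ++ new) by lia.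
    apply: leq_trans (_ : (size v).+1 <= _); last by rewrite ltnS; exact: hge.
    by move: hw; rewrite mem_cat => /orP[/hqv|/hnew->].
  + lia.
- move=> T1 s1 _ [h [qs [[hh hhq] hI hsrt hwin hT1]]].
  rewrite /= hh (bi_tail hI) => hge; have eh : h = size qs by lia.
  split; first lia.
  have hall u : u \in L -> (u == [::]) || (u \in take h qs).
    elim/last_ind: u => [//|u b IH] huL; have {}IH := IH (pt_closed hL huL).
    have := bi_mem hI huL; rewrite IH eh take_size => ->; exact: orbT.
  by move=> w b hw; apply: (bi_goto hI) => //; exact: hall.
Qed.

End Bfs.

(** * Scanning the text *)

Definition from_end a := Sub (Inc ve 1) (Get a vl).

Definition accept :=
  If (Get aF vs) (Set_ vres (Inc vres 1)) (
    Set_ vl (Get aI vs) ;;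
    If vl (
      Set_ vx (Num 1) ;; Set_ vgo (Num 1) ;;
      If (Get aLo vl) (Cmp vx SrcT (from_end aLo) SrcT (from_end aV)) Skip ;;
      If (Get aHi vl) (Cmp vgo SrcT (from_end aV) SrcT (from_end aHi)) Skip ;;
      If vx (If vgo (Set_ vres (Inc vres 1)) Skip) Skip) Skip).

(* The stack of the current window is kept in the ring buffer [aT] of size [m]. *)
Definition scan :=
  Len vN SrcT ;; Set_ vs (Num 0) ;; Set_ vsp (Num 0) ;; Set_ ve (Num 0) ;;
  Set_ vres (Num 0) ;;
  While (Lt ve vN) (
    Set_ ve (Inc ve 1) ;; Set_ vgo (Get aDep vs) ;;
    While vgo (
      Cmp vx SrcT ve SrcT (Get aT vsp) ;;
      If vx (
        Set_ vs (Get aC0 vs) ;;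
        If vsp (Set_ vsp (Sub vsp (Num 1))) (Set_ vsp (Sub vM (Num 1))) ;;
        Set_ vgo (Get aDep vs)) (Set_ vgo (Num 0))) ;;
    Set_ vsp (Inc vsp 1) ;; If (Lt vsp vM) Skip (Set_ vsp (Num 0)) ;;
    Put aT vsp ve ;;
    Set_ vs (Get aC1 vs) ;;
    accept).

Lemma modn_pred m a : 0 < m -> 0 < a ->
  (a - 1) %% m = if a %% m == 0 then m - 1 else a %% m - 1.
Proof.
move=> hm ha; rewrite {1}(divn_eq a m); case: eqP => [e|/eqP].
  have hd : m %| a by rewrite /dvdn e.
  rewrite e addn0; have hq : 0 < a %/ m by rewrite divn_gt0 //; exact: dvdn_leq.
  have -> : a %/ m * m - 1 = (a %/ m).-1 * m + (m - 1).
    have -> : a %/ m * m = (a %/ m).-1 * m + m by rewrite -mulSnr prednK.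
    by rewrite addnBA.
  by rewrite modnMDl modn_small //; lia.
rewrite -lt0n => h; rewrite -addnBA // modnMDl modn_small //.
by have := ltn_pmod a hm; lia.
Qed.

Lemma modn_succ m a : 0 < m ->
  a.+1 %% m = if (a %% m).+1 < m then (a %% m).+1 else 0.
Proof.
move=> hm; rewrite -(addn1 a) -modnDml addn1; have := ltn_pmod a hm.
case: (ltnP (a %% m).+1 m) => h1 h2; first by rewrite modn_small.
by have -> : (a %% m).+1 = m by [lia]; rewrite modnn.
Qed.

Lemma modn_sub_neq m a i : 0 < i < m -> i <= a -> (a - i) %% m != a %% m.
Proof.
move=> hi hia; apply/negP => /eqP e.
have : a == a - i %[mod m] by rewrite e.
rewrite eqn_mod_dvd ?leq_subr // subKn // gtnNdvd //; lia.
Qed.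

Lemma longest_count L w v : longest L w v -> count id v <= count id w.
Proof. by elim=> // {}w {}v _ _ h; rewrite (leq_trans h) // count_del leq_subr. Qed.

Section Scan.
Variables (p t : seq int) (sb m : nat) (x : nat -> nat) (L : seq (seq bool)).
Local Notation tri := (tri p t sb).
Hypothesis m_gt0 : 0 < m.
Hypothesis hL : prefix_tree L.
Hypothesis hcount : forall w, w \in L -> count id w <= m.
Hypothesis hsb : m <= sb.
Hypothesis hx : forall a b, 0 < a <= size t -> 0 < b <= size t ->
  (nth 0%R t a.-1 < nth 0%R t b.-1)%R = (x a < x b).

(** With the window ending at [e], a stored distance [d] denotes the text position [e.+1 - d]; a
    bound equal to 0 omits its comparison. *)
Definition accepts (F I V lo hi : nat -> nat) e i :=
  (F i != 0) ||
  let l := I i in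
  [&& l != 0, (lo l == 0) || (x (e.+1 - lo l) < x (e.+1 - V l)) &
              (hi l == 0) || (x (e.+1 - V l) < x (e.+1 - hi l))].

Definition accepts_at s := accepts (arr s aF) (arr s aI) (arr s aV) (arr s aLo) (arr s aHi).

Lemma accept_ok s T e i : var s ve = e -> var s vs = i -> e <= size t ->
  (arr s aI i != 0 -> let l := arr s aI i in
     [/\ m <= e, 0 < arr s aV l <= m, arr s aLo l <= m & arr s aHi l <= m]) ->
  tri s accept T (fun T' s' => T' = T /\ var s' vres = var s vres + accepts_at s e i).
Proof.
move=> he hi het hr; rewrite /accepts_at /accepts.
apply: tri_if => /=; rewrite hi => hF.
  by apply: tri_set; rewrite /= hF.
rewrite hF /=; apply: tri_seq; apply: tri_set; apply: tri_if => /=; rewrite hi => hI; last first.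
  by apply: tri_skip; rewrite hI /= addn0.
have {hr} [h1 h2 h3 h4] := hr hI; move: h1 h2 h3 h4; set l := arr s 5 i => h1 h2 h3 h4.
rewrite hI /=.
apply: tri_seq; apply: tri_set; apply: tri_seq; apply: tri_set.
apply: tri_seq; apply: (tri_use (P := fun T2 s2 => T2 = T /\
   var s2 vx = (arr s aLo l == 0) || (x (e.+1 - arr s aLo l) < x (e.+1 - arr s aV l)))).
  apply: tri_if => /= hc; last by apply: tri_skip; rewrite hc.
  apply: tri_cmp; rewrite /= he ?addn1; try lia.
  by split=> //; rewrite (negPf hc) /= hx //; lia.
move=> T2 s2 [sv2 sa2] [-> hx2].
have he2 : var s2 ve = e by rewrite sv2.
have hl2 : var s2 vl = l by rewrite sv2.
have hr2 : var s2 vres = var s vres by rewrite sv2.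
have hgo2 : var s2 vgo = 1 by rewrite sv2.
apply: tri_seq; apply: (tri_use (P := fun T2 s3 => T2 = T /\
   var s3 vgo = (arr s aHi l == 0) || (x (e.+1 - arr s aV l) < x (e.+1 - arr s aHi l)))).
  apply: tri_if => /=; rewrite hl2 sa2 //= => hc; last by apply: tri_skip; rewrite hc hgo2.
  apply: tri_cmp; rewrite /= he2 hl2 ?sa2 //= ?addn1; try lia.
  by split=> //; rewrite (negPf hc) /= hx //; lia.
move=> T3 s3 [sv3 sa3] [-> hx3].
have hr3 : var s3 vres = var s vres by rewrite sv3.
have hxx3 : var s3 vx = var s2 vx by rewrite sv3.
apply: tri_if => /=; rewrite hxx3 hx2; case: (_ || _) => //= _; last first.
  by apply: tri_skip; rewrite addn0.
apply: tri_if => /=; rewrite hx3; case: (_ || _) => //= _.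
  by apply: tri_set; rewrite /= hr3.
by apply: tri_skip; rewrite addn0.
Qed.

(** A state of depth 0 has no open element left, so further pops concern forgotten elements only.
    The scan may thus stop popping here although the stack of the whole prefix would go on. *)
Lemma longest_drain w v k : longest L w v -> dep v = 0 -> k <= dep w ->
  longest L (w ++ nseq k false) v.
Proof.
move=> h h0; elim: k => [|k IH] hk; first by rewrite cats0.
have -> : w ++ nseq k.+1 false = step (w ++ nseq k false) false.
  by rewrite /step dep_pop subn_gt0 hk /= -cats1 -catA -(nseqD k 1) addn1.
apply: (longest_step hL) (IH (ltnW hk)) _.
by rewrite /step h0 /=; apply: LongestHere; exact: longest_in h.
Qed.

Lemma pops_stop e j : j <= pops x e -> j < size (stack x e) ->
  (x e.+1 < x (nth 0 (stack x e) j)) = (j < pops x e).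
Proof.
move=> hj hs; apply/idP/idP => h.
  rewrite ltn_neqAle hj andbT; apply/eqP => ej.
  have := @nth_find _ 0 (fun a => x a <= x e.+1) (stack x e).
  rewrite has_find -/(pops x e) -ej hs => /(_ isT); lia.
have := @before_find _ 0 (fun a => x a <= x e.+1) (stack x e) j h; lia.
Qed.

(** [SP] is the pointer before reduction modulo [m]. Only the top [d] entries of the stack of the
    text prefix are tracked; following failures forgets entries at the bottom and moves no data. *)
Definition ring s SP (st : seq nat) d := forall i, i < d -> arr s aT ((SP - i) %% m) = nth 0 st i.

(** Amortisation with potential [dep v]: each text element pays for its own iteration, for the
    comparison that ends its popping, and for its own later pop, hence the factor 3. *)
Lemma scan_ok s T Tb (good : nat -> bool) : var s vM = m ->
  (forall w b, w \in L -> goto_ok L s w b) ->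
  (forall w, w \in L -> arr s aDep (index w L) = dep w) ->
  (forall w, w \in L -> arr s aI (index w L) != 0 -> let l := arr s aI (index w L) in
     [/\ count id w = m, 0 < arr s aV l <= m, arr s aLo l <= m & arr s aHi l <= m]) ->
  (forall e v, 0 < e <= size t -> longest L (enc x e) v ->
     accepts_at s e (index v L) = good e) ->
  3 * size t + Tb <= T ->
  tri s scan T (fun T' s' => var s' vres = count good (iota 1 (size t))).
Proof.
move=> hM hgoto hdep hlab hgood hT; set n := size t in hT *.
do 5![apply: tri_seq; first [apply: tri_len|apply: tri_set]].
apply: (tri_while (I := fun T s1 => exists e v SP,
  [/\ var s1 ve = e /\ e <= n, longest L (enc x e) v /\ var s1 vs = index v L,
      dep v <= SP /\ var s1 vsp = SP %% m, ring s1 SP (stack x e) (dep v) &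
      var s1 vres = count good (iota 1 e) /\ Tb + 3 * (n - e) + dep v <= T])).
- exists 0, [::], 0; split=> //=.
  + split; first by apply: LongestHere; exact: pt_nil.
    by apply/esym/eqP; rewrite (pt_index0 hL) // pt_nil.
  + by rewrite mod0n.
  + by split=> //; rewrite subn0 addn0 addnC.
- move=> T1 s1 [sv sa] [e [v [SP [[he hen] [hv hs] [hSP hsp] hring [hres hT1]]]]].
  have hM1 : var s1 vM = m by rewrite sv.
  have hN1 : var s1 vN = n by rewrite sv.
  have harr a i : a != aT -> arr s1 a i = arr s a i by move=> ha; rewrite sa //= inE.
  clear sv sa.
  rewrite /= he hN1 => hlt; have {}hlt : e < n by lia.
  split; first lia.
  have hvL := longest_in hv.
  have hpop := pops_size x e.
  apply: tri_seq; apply: tri_set; apply: tri_seq; apply: tri_set; apply: tri_seq.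
  rewrite /= he addn1 hs harr // hdep //.
  apply: (tri_while (I := fun T s2 => exists j v SP,
    [/\ j <= pops x e,
        longest L (enc x e ++ nseq j false) v /\ var s2 vs = index v L,
        dep v <= SP /\ var s2 vsp = SP %% m, ring s2 SP (drop j (stack x e)) (dep v) &
        (if var s2 vgo == 0 then dep v = 0 \/ j = pops x e else var s2 vgo = dep v) /\
        Tb + 3 * (n - e.+1) + 1 + dep v + (var s2 vgo != 0) <= T])).
  + exists 0, v, SP; rewrite cats0 drop0; split=> //=.
    split; first by case: eqP => // h; left.
    by case: eqP => h /=; lia.
  + move=> T2 s2 [sv2 sa2] [j [v2 [SP2 [hj [hv2 hs2] [hSP2 hsp2] hring2 [hgo2 hT2]]]]].
    have hM2 : var s2 vM = m by rewrite sv2.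
    have he2 : var s2 ve = e.+1 by rewrite sv2.
    have harr2 a i : a != aT -> arr s2 a i = arr s a i by move=> ha; rewrite sa2 //= harr.
    have hT12 i : arr s2 aT i = arr s1 aT i by rewrite sa2.
    clear sv2 sa2.
    rewrite /= => hgo; rewrite (negPf hgo) in hgo2; rewrite hgo addn1 in hT2.
    have hd : 0 < dep v2 by rewrite -hgo2 lt0n.
    split; first lia.
    have hv2L := longest_in hv2.
    have hdw := longest_dep hv2; rewrite dep_pop dep_enc in hdw.
    have hjs : j < size (stack x e) by lia.
    have htop : arr s2 aT (var s2 vsp) = nth 0 (stack x e) j.
      by rewrite hsp2 -[X in X %% m]subn0 hring2 // nth_drop addn0.
    have hmem : 0 < nth 0 (stack x e) j <= e by apply: stack_le; exact: mem_nth.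
    have hcmp : (nth 0%R t e < nth 0%R t (nth 0 (stack x e) j).-1)%R =
        (x e.+1 < x (nth 0 (stack x e) j)).
      by rewrite -hx // -/n; lia.
    apply: tri_seq; apply: tri_cmp; rewrite /= ?he2 ?htop.
    * by rewrite -/n; lia.
    * by rewrite -/n; lia.
    rewrite hcmp pops_stop //.
    apply: tri_if => /=; case: ltnP => hjp //= _; last first.
      apply: tri_set; exists j, v2, SP2; split=> //=.
      by split; [right; lia|lia].
    have [v3 [hv3 hk3]] := hgoto v2 false hv2L.
    have hkid : arr s2 aC0 (index v2 L) = index v3 L by rewrite harr2.
    have hd3 : dep v3 < dep v2.
      apply: leq_ltn_trans (longest_dep hv3) _.
      by rewrite /step hd /= dep_rcons prednK.
    apply: tri_seq; apply: tri_set; rewrite /= hs2 hkid.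
    apply: tri_seq; apply: (tri_use (P := fun T4 s4 => T4 = T2.-1 /\ var s4 vsp = (SP2 - 1) %% m)).
      apply: tri_if => /=; rewrite hsp2 => hc; apply: tri_set; rewrite /= ?hsp2 ?hM2.
        by rewrite modn_pred ?(negPf hc) //; lia.
      by rewrite modn_pred ?hc ?eqxx //; lia.
    move=> T4 s4 [sv4 sa4] [-> hsp4].
    have hs4 : var s4 vs = index v3 L by rewrite sv4.
    have harr4 a i : arr s4 a i = arr s2 a i by rewrite sa4.
    clear sv4 sa4.
    have hv3L := longest_in hv3.
    apply: tri_set; rewrite /= hs4 harr4 harr2 // hdep //.
    exists j.+1, v3, (SP2 - 1); split=> //=.
    * split=> //; have -> : false :: nseq j false = nseq j false ++ [:: false].
        by rewrite -(nseqD j 1) addn1.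
      rewrite catA cats1.
      have -> : rcons (enc x e ++ nseq j false) false = step (enc x e ++ nseq j false) false.
        by rewrite /step dep_pop dep_enc subn_gt0 hjs orbT.
      exact: (longest_step hL) hv2 hv3.
    * by split; [lia|].
    * move=> i hi; rewrite /= harr4 -subnDA add1n hring2; last lia.
      by rewrite !nth_drop addnS addSn.
    * split; first by case: eqP => // h; left.
      by case: eqP => h /=; lia.
  + move=> T2 s2 [sv2 sa2] [j [v2 [SP2 [hj [hv2 hs2] [hSP2 hsp2] hring2 [hgo2 hT2]]]]].
    have hM2 : var s2 vM = m by rewrite sv2.
    have he2 : var s2 ve = e.+1 by rewrite sv2.
    have hres2 : var s2 vres = count good (iota 1 e) by rewrite sv2.
    have harr2 a i : a != aT -> arr s2 a i = arr s a i by move=> ha; rewrite sa2 //= harr.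
    clear sv2 sa2.
    rewrite /= => hgo; rewrite hgo /= addn0 in hgo2 hT2.
    have hv2L := longest_in hv2.
    have hw : longest L (enc x e ++ nseq (pops x e) false) v2.
      case: hgo2 => [h0|<- //].
      have -> : enc x e ++ nseq (pops x e) false =
                (enc x e ++ nseq j false) ++ nseq (pops x e - j) false.
        by rewrite -catA -nseqD subnKC.
      apply: longest_drain => //.
      by rewrite dep_pop dep_enc; lia.
    have [v3 [hv3 hk3]] := hgoto v2 true hv2L.
    have hkid : arr s2 aC1 (index v2 L) = index v3 L by rewrite harr2.
    have hd3 : dep v3 <= (dep v2).+1.
      by apply: leq_trans (longest_dep hv3) _; rewrite /step /= dep_rcons.
    have hv3L := longest_in hv3.
    (* At most [m] entries stay live, so the cell overwritten by the push holds none of the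
       others. *)
    have hd3m : dep v3 <= m by apply: leq_trans (dep_count v3) (hcount hv3L).
    have hv3' : longest L (enc x e.+1) v3 by exact: (longest_step hL hw hv3).
    apply: tri_seq; apply: tri_set.
    apply: tri_seq; apply: (tri_use (P := fun T4 s4 => T4 = T2 /\ var s4 vsp = SP2.+1 %% m)).
      apply: tri_if => /=; rewrite hsp2 hM2 addn1 => hc;
        [apply: tri_skip|apply: tri_set]; rewrite /= ?hsp2 ?addn1 modn_succ //;
        move: hc; by case: ltnP.
    move=> T4 s4 [sv4 sa4] [-> hsp4].
    have hs4 : var s4 vs = index v2 L by rewrite sv4.
    have he4 : var s4 ve = e.+1 by rewrite sv4.
    have hres4 : var s4 vres = count good (iota 1 e) by rewrite sv4.
    have harr4 a i : arr s4 a i = arr s2 a i by rewrite sa4.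
    clear sv4 sa4.
    apply: tri_seq; apply: tri_put; rewrite /= ?hsp4.
      by apply: leq_trans hsb; rewrite ltn_mod.
    apply: tri_seq; apply: tri_set; rewrite /= hs4 he4 harr4 hkid.
    apply: tri_use.
      apply: (@accept_ok _ _ e.+1 (index v3 L)) => //=.
      rewrite harr4 harr2 // => hne; have [k1 k2 k3 k4] := hlab v3 hv3L hne.
      have hc := longest_count hv3'; rewrite count_enc k1 in hc.
      by rewrite !harr4 !harr2.
    move=> T5 s5 [sv5 sa5] [-> hres5].
    have hve5 : var s5 ve = e.+1 by rewrite sv5.
    have hvs5 : var s5 vs = index v3 L by rewrite sv5.
    have hsp5 : var s5 vsp = SP2.+1 %% m by rewrite sv5.
    have hT5 i : arr s5 aT i = if i == SP2.+1 %% m then e.+1 else arr s2 aT i.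
      by rewrite sa5 //= harr4.
    clear sv5 sa5.
    exists e.+1, v3, SP2.+1; split=> //.
    * by split=> //; lia.
    * clear hres5; move=> i hi; rewrite hT5 stackS.
      case: i hi => [|i] hi; first by rewrite subn0 eqxx.
      have hi2 : 0 < i.+1 < m by lia.
      have hi3 : i.+1 <= SP2.+1 by lia.
      rewrite (negPf (modn_sub_neq hi2 hi3)) subSS [nth _ _ _]/=.
      case: hgo2 => [h0|ej]; first lia.
      by rewrite -ej hring2 //; lia.
    * split; last lia.
      have := iotaD 1 e 1; rewrite addn1 => ->.
      rewrite count_cat add1n hres5 [var _ vres]/= hres4 /= addn0.
      congr (_ + nat_of_bool _); rewrite -(hgood e.+1 v3 hlt hv3').
      by rewrite /accepts_at /accepts /= !harr4 !harr2.
- move=> T1 s1 [sv sa] [e [v [SP [[he hen] _ _ _ [hres _]]]]].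
  have hN1 : var s1 vN = n by rewrite sv.
  by rewrite /= he hN1 => hge; have en : e = n by [lia]; rewrite hres en.
Qed.
End Scan.

(** * Correctness of the test at a window *)

Lemma dinj_swap x m l : dinj x m -> 0 < l < m -> dinj (swap x l) m.
Proof.
move=> hx hl a b ha hb; rewrite /swap.
case: (eqVneq a l) => [->|na]; case: (eqVneq b l) => [->|nb] //.
- case: (eqVneq b l.+1) => [->|nb1] e; first by have : l.+1 = l by [apply: hx; lia]; lia.
  by have : l.+1 = b by [apply: hx; lia]; lia.
- case: (eqVneq a l.+1) => [->|na1] e; first by have : l.+1 = l by [apply: hx; lia]; lia.
  by have : a = l.+1 by [apply: hx; lia]; lia.
- case: (eqVneq a l.+1) => [->|na1]; case: (eqVneq b l.+1) => [->|nb1] // e.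
  + by have : l = b by [apply: hx; lia]; lia.
  + by have : a = l by [apply: hx; lia]; lia.
  + exact: hx.
Qed.

Lemma size_tau s i : 0 < i < size s -> size (tau s i) = size s.
Proof.
move=> hi; rewrite /tau !size_cat /= size_drop size_take_min.
have -> : minn i.-1 (size s) = i.-1 by lia.
lia.
Qed.

Lemma nth_tau s i k : 0 < i < size s -> k < size s ->
  nth 0%R (tau s i) k = nth 0%R s (if k.+1 == i then i else if k == i then i.-1 else k).
Proof.
move=> hi hk; have hs : i.-1 <= size s by lia.
rewrite /tau nth_cat (size_takel hs).
case: ltnP => h1.
  have -> : k.+1 == i = false by apply/eqP; lia.
  have -> : k == i = false by apply/eqP; lia.
  by rewrite nth_take.
case: (eqVneq k.+1 i) => [e|n1].
  by have -> : k - i.-1 = 0 by lia.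
case: (eqVneq k i) => [e|n2].
  by have -> : k - i.-1 = 1 by lia.
have -> : k - i.-1 = (k - i.+1).+2 by lia.
by rewrite /= nth_drop; congr nth; lia.
Qed.

Lemma repr_tau s x i : repr s x -> 0 < i < size s -> repr (tau s i) (swap x i).
Proof.
move=> H hi; have E k : k < size s ->
    swap x i k.+1 = x (if k.+1 == i then i else if k == i then i.-1 else k).+1.
  move=> hk; rewrite /swap eqSS; case: (k.+1 == i) => //; case: eqP => // _.
  by rewrite prednK //; lia.
have F k : k < size s -> (if k.+1 == i then i else if k == i then i.-1 else k) < size s.
  by move=> hk; case: eqP => _; [lia|case: eqP => _; lia].
move=> a b; rewrite size_tau // => ha hb; rewrite !nth_tau // !E // H //; exact: F.
Qed.

Lemma tau_ct_equivP u w x y m : size u = m -> size w = m -> repr u x -> repr w y ->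
  dinj x m -> dinj y m ->
  reflect (cteq x y m \/ exists2 l, 0 < l < m & cteq (swap x l) y m \/ cteq x (swap y l) m)
          (tau_ct_equiv u w).
Proof.
move=> hu hw rx ry dx dy; rewrite /tau_ct_equiv hu hw eqxx /=.
have E0 : ct_equiv u w <-> cteq x y m.
  by have := ct_equivP rx ry; rewrite hu hw; apply.
have E1 l : 0 < l < m -> ct_equiv (tau u l) w <-> cteq (swap x l) y m.
  move=> hl; have hlu : 0 < l < size u by rewrite hu.
  have := ct_equivP (repr_tau rx hlu) ry; rewrite size_tau // hu hw; apply=> //.
  exact: dinj_swap.
have E2 l : 0 < l < m -> ct_equiv (tau w l) u <-> cteq (swap y l) x m.
  move=> hl; have hlw : 0 < l < size w by rewrite hw.
  have := ct_equivP (repr_tau ry hlw) rx; rewrite size_tau // hu hw; apply=> //.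
  exact: dinj_swap.
apply: (iffP orP) => [[/E0|/hasP[l]]|[/E0|[l hl [/E1|/cteq_sym/E2]]]]; try by left.
- rewrite mem_iota => hl; have {}hl : 0 < l < m by lia.
  by move=> /orP[/(E1 l hl)|/(E2 l hl)/cteq_sym] h; right; exists l => //; [left|right].
- move=> /(_ hl) h; right; apply/hasP; exists l; rewrite ?mem_iota ?h //; lia.
- move=> /(_ hl) h; right; apply/hasP; exists l; rewrite ?mem_iota ?h ?orbT //; lia.
Qed.

Lemma is_pat_orient dir m q i y : 0 < i < m -> orient dir m q i < orient dir m q i.+1 ->
  is_pat q m (lab dir m i) y ->
  orient dir m q i < orient dir m y i /\
  forall k, 0 < k <= m -> orient dir m y k = ins (orient dir m q) i (orient dir m y i) k.
Proof.
move=> hi; case: dir; rewrite /orient /lab /mirror /ins /= => ha [_ h2 h3].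
  case: h3 => [[h3 h4 h5]|[h3 _ _]]; last lia.
  split=> // k hk; case: (eqVneq k i) => [->//|n1].
  by case: (eqVneq k i.+1) => [->//|n2]; exact: h2.
have e1 : m.+1 - i = (m - i).+1 by lia.
have e2 : m.+1 - i.+1 = m - i by lia.
rewrite e1 e2 in ha *.
case: h3 => [[h3 _ _]|[h3 h4 h5]]; first lia.
split=> // k hk; case: (eqVneq k i) => [->|n1]; first by rewrite e1.
case: (eqVneq k i.+1) => [->|n2]; first by rewrite e2.
by apply: h2; lia.
Qed.

Section Window.
Variables (m : nat) (q w : nat -> nat).
Hypothesis hq : dinj q m.
Hypothesis hw : dinj w m.

Lemma cteq_orient_swap dir i : 0 < i < m ->
  cteq (swap w (lab dir m i)) q m <-> cteq (swap (orient dir m w) i) (orient dir m q) m.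
Proof.
move=> hi; have hl := lab_in dir hi; have hd := dinj_swap hw hl.
have E k : 0 < k <= m -> orient dir m (swap w (lab dir m i)) k = swap (orient dir m w) i k.
  by move=> hk; rewrite orient_swap // labK.
split=> H.
  by apply: cteq_trans (cteq_orient dir hd hq H); apply: cteq_sym; exact: eq_cteq.
have hX := eq_cteq (fun k hk => E k hk).
have := cteq_orient dir (dinj_orient (dir := dir) hd) (dinj_orient (dir := dir) hq)
  (cteq_trans hX H).
have KE z : cteq z (orient dir m (orient dir m z)) m by apply: eq_cteq => k hk; rewrite orientK.
by move=> H'; apply: cteq_trans (KE _) (cteq_trans H' (cteq_sym (KE q))).
Qed.

Lemma chkP dir i g h y : 0 < i < m -> orient dir m q i < orient dir m q i.+1 ->
  bracket (orient dir m q) m i g h -> is_pat q m (lab dir m i) y -> dinj y m -> cteq w y m ->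
  cteq (swap w (lab dir m i)) q m <-> chk (orient dir m w) m i g h.
Proof.
move=> hi ha hb hp hy hc; rewrite cteq_orient_swap //.
have dq := dinj_orient (dir := dir) hq; have dw := dinj_orient (dir := dir) hw.
have [h1 h2] := is_pat_orient hi ha hp.
split=> H; first exact: (swap_chk dw hi ha H hb).
apply: (pattern_swap dw dq _ hi ha h1 _ hb H).
  by apply: (eq_dinj h2); exact: dinj_orient.
by apply: cteq_trans (cteq_orient dir hw hy hc) _; exact: eq_cteq.
Qed.

End Window.

Lemma asc_dir m q l : dinj q m -> 0 < l < m -> exists dir i,
  [/\ 0 < i < m, l = lab dir m i & orient dir m q i < orient dir m q i.+1].
Proof.
move=> hq hl; case: (ltngtP (q l) (q l.+1)) => h.
- by exists true, l.
- exists false, (m - l); rewrite /orient /mirror /=.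
  have -> : m.+1 - (m - l) = l.+1 by lia.
  have -> : m.+1 - (m - l).+1 = l by lia.
  by split=> //; lia.
- by have : l = l.+1 by [apply: hq; lia]; lia.
Qed.

Lemma tau_ct_count_end p t (m := size p) : 0 < m ->
  tau_ct_count p t =
  count (fun e => (m <= e) && tau_ct_equiv (factor t (e - m).+1 m) p) (iota 1 (size t)).
Proof.
rewrite /tau_ct_count -/m => m_gt0; case: leqP => h; last first.
  rewrite /=; symmetry; apply/eqP; rewrite -leqn0 leqNgt -has_count; apply/hasPn => e.
  rewrite mem_iota => he; apply/negP => /andP[]; lia.
have -> : size t = m.-1 + (size t - m).+1 by lia.
rewrite iotaD count_cat.
have -> : count (fun e => (m <= e) && tau_ct_equiv (factor t (e - m).+1 m) p) (iota 1 m.-1) = 0.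
  apply/eqP; rewrite -leqn0 leqNgt -has_count; apply/hasPn => e.
  rewrite mem_iota => he; apply/negP => /andP[]; lia.
have -> : 1 + m.-1 = m.-1 + 1 by lia.
rewrite iotaDl count_map add0n.
have -> : m.-1 + (size t - m).+1 - m = size t - m.
  lia.
apply: eq_in_count => j; rewrite mem_iota /= => hj.
have e1 : (m.-1 + j - m).+1 = j by lia.
have e2 : m <= m.-1 + j by lia.
by rewrite e1 e2.
Qed.

Section Correct.
Variables (p t : seq int) (s : state) (L : seq (seq bool)) (PL : database).
Local Notation m := (size p).
Local Notation q := (rk p).
Local Notation x := (rk t).
Hypothesis hp : uniq p.
Hypothesis ht : uniq t.
Hypothesis m_gt0 : 0 < m.
Hypothesis hL : prefix_tree L.
Hypothesis hcount : forall w, w \in L -> count id w <= m.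
Hypothesis hin : forall w l f, (w, l, f) \in PL ->
  [/\ w \in L, exists f', (w, arr s aI (index w L), f') \in PL &
      f -> arr s aF (index w L) != 0].
Hypothesis hF : forall w, w \in L -> arr s aF (index w L) != 0 -> exists l, (w, l, true) \in PL.
Hypothesis hI : forall w, w \in L -> arr s aI (index w L) != 0 ->
  exists f, (w, arr s aI (index w L), f) \in PL.
Hypothesis hgood : good m q PL.
Hypothesis hpin : (enc q m, 0, true) \in PL.
Hypothesis hcF : forall dir, covF m q dir m PL.
Hypothesis hcI : forall dir, covI m q dir m s PL.

Let hq : dinj q m := rk_inj hp.

Lemma label_slot w l f : (w, l, f) \in PL -> l != 0 ->
  exists y dir i, [/\ is_pat q m l y, dinj y m, w = enc y m,
    [/\ 0 < i < m, l = lab dir m i & orient dir m q i < orient dir m q i.+1] & slot m q dir s i].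
Proof.
move=> /hgood[[-> _]|[y [h1 h2 h3 h4]]] hl //.
have [dir [i [k1 k2 k3]]] : exists dir i,
  [/\ 0 < i < m, l = lab dir m i & orient dir m q i < orient dir m q i.+1].
  by apply: asc_dir => //; case: h1.
exists y, dir, i; split=> //.
have [hi1 hi2] : 0 < i <= m /\ i < m by lia.
by have [_ _] := hcI hi1 hi2 k3.
Qed.

Lemma label_bounds w : w \in L -> arr s aI (index w L) != 0 ->
  let l := arr s aI (index w L) in
  [/\ count id w = m, 0 < arr s aV l <= m, arr s aLo l <= m & arr s aHi l <= m].
Proof.
move=> hw h0 l; have [f hf] := hI hw h0.
have [y [dir [i [h1 h2 h3 [h4 h5 h6] [g [h [[b1 b2 b3 b4] e1 e2 e3]]]]]]] := label_slot hf h0.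
rewrite /l h5 e1 e2 e3; split.
- by rewrite h3 count_enc.
- by have := @ix_in dir m i; lia.
- case: ifP => // hg; have := @ix_in dir m g; lia.
- case: ifP => // hg; have := @ix_in dir m h; have := b4 hg; lia.
Qed.

(** Words of [L] have at most [m] opening letters, so the first [e - m] deletions are forced and the
    state depends on the window alone. *)
Lemma window_longest e v : m <= e -> longest L (enc x e) v ->
  longest L (enc (shift (e - m) x) m) v.
Proof.
move=> hme; have {1}-> : e = (e - m) + m by lia.
move=> h; rewrite -del_iter_enc; apply: longest_iter_del => // j hj.
have -> : e - m + m = j + (e - j) by lia.
rewrite del_iter_enc; apply/negP => /hcount; rewrite count_enc; lia.
Qed.

Lemma longest_full w v : count id v = m -> longest L (enc w m) v -> v = enc w m.
Proof.
move=> hc h; inversion h; subst=> //.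
have em : m = m.-1.+1 by lia.
by have := longest_count H0; rewrite hc em del_enc count_enc ltnn.
Qed.

Lemma longest_self w v : enc w m \in L -> longest L (enc w m) v -> v = enc w m.
Proof. by move=> hw h; apply: longest_det h _; apply: LongestHere. Qed.

Lemma PL_count w l f : (w, l, f) \in PL -> count id w = m.
Proof. by move=> /hgood[[_ ->]|[y [_ _ -> _]]]; rewrite count_enc. Qed.

Section Window.
Variables (e : nat) (v : seq bool).
Hypothesis hme : m <= e.
Hypothesis het : e <= size t.
Local Notation w := (shift (e - m) x).
Hypothesis hv : longest L (enc w m) v.

Lemma window_inj : dinj w m.
Proof. by apply: dinj_shift (rk_inj ht) _; rewrite subnK. Qed.

Lemma flagged : (arr s aF (index v L) != 0) <->
  (cteq w q m \/ exists2 l, 0 < l < m & cteq w (swap q l) m).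
Proof.
have hw := window_inj; have hvL := longest_in hv.
have sw l : 0 < l < m -> dinj (swap q l) m by exact: dinj_swap.
split=> [h|].
  have [l hl] := hF hvL h.
  have ev := longest_full (PL_count hl) hv.
  case: (hgood hl) => [[_ e1]|[y [[hl0 _ _] _ _ /(_ isT) e1]]].
    by left; apply/(enc_cteq hw hq); rewrite -ev.
  by right; exists l => //; apply/(enc_cteq hw (sw l hl0)); rewrite -ev.
have main y l : (enc y m, l, true) \in PL -> enc w m = enc y m -> arr s aF (index v L) != 0.
  move=> hin0 ee; have [k1 _ k3] := hin hin0.
  rewrite -ee in k1; rewrite (longest_self k1 hv) ee; exact: k3.
case=> [h|[l hl h]].
  by apply: main hpin _; apply/(enc_cteq hw hq).
have [dir [i [k1 k2 k3]]] := asc_dir hq hl.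
have [hi1 hi2] : 0 < i <= m /\ i < m by lia.
have [_ k4 _] := hcI hi1 hi2 k3.
rewrite -k2 in k4.
by apply: main k4 _; apply/(enc_cteq hw (sw l hl)).
Qed.

(** Of the values allowed by [zok], the case [f = i] was inserted by [patI] and the spine positions
    [f < i] by [patF]. *)
Lemma pattern_mem l : 0 < l < m -> cteq (swap w l) q m ->
  exists y f, [/\ is_pat q m l y, dinj y m, cteq w y m & (enc y m, l, f) \in PL].
Proof.
move=> hl hc; have hw := window_inj.
have [dir [i [k1 k2 k3]]] := asc_dir hq hl.
have dq := dinj_orient (dir := dir) hq; have dw := dinj_orient (dir := dir) hw.
rewrite k2 in hc; have hc' := proj1 (cteq_orient_swap hq hw dir k1) hc.
have [z [[f [ez hf]] hz]] := swap_pattern dq k1 k3 hc'.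
have hin0 : (enc (pat dir m q i z) m, lab dir m i, false) \in PL.
  case: hf => [ef|[h1 h2 h3]]; last by rewrite ez; apply: hcF => //; lia.
  have [hi1 hi2] : 0 < i <= m /\ i < m by lia.
  by rewrite ez ef; have [] := hcI hi1 hi2 k3.
have hzi : orient dir m q i < z by rewrite ez; case: hf => [->|[_ h2 _]]; lia.
have di : dinj (ins (orient dir m q) i z) m.
  apply: dinj_ins => // k _ _; rewrite ez; apply: odd_fresh => //.
    exact: rk_out.
  exact: rk_even.
exists (pat dir m q i z), false; rewrite k2; split=> //.
- exact: pat_is_pat.
- exact: dinj_orient.
- have KE : cteq w (orient dir m (orient dir m w)) m by apply: eq_cteq => k hk; rewrite orientK.
  exact: cteq_trans KE (cteq_orient dir dw di hz).
Qed.

Lemma accepts_window : accepts_at x s e (index v L) <->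
  (cteq w q m \/ exists2 l, 0 < l < m & cteq (swap w l) q m \/ cteq w (swap q l) m).
Proof.
have hw := window_inj; have hvL := longest_in hv.
have eX dir g : 0 < g <= m -> x (e.+1 - (m.+1 - dpos dir m g)) = orient dir m w g.
  move=> hg; rewrite -orient_pos /shift; have := ix_in dir hg => hi.
  by congr rk; lia.
(* The stored label is the only position at which a pattern can have this tree, and the two
   comparisons made there are [chk]. *)
have check : arr s aI (index v L) != 0 -> let l := arr s aI (index v L) in
  [/\ 0 < l < m, forall l' y, is_pat q m l' y -> cteq w y m -> l' = l &
  [&& l != 0, (arr s aLo l == 0) || (x (e.+1 - arr s aLo l) < x (e.+1 - arr s aV l)) &
    (arr s aHi l == 0) || (x (e.+1 - arr s aV l) < x (e.+1 - arr s aHi l))] <->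
  cteq (swap w l) q m].
  move=> h0 l; have [f hf] := hI hvL h0.
  have [y [dir [i [h1 h2 h3 [h4 h5 h6] [g [h [hb e1 e2 e3]]]]]]] := label_slot hf h0.
  have ev := longest_full (PL_count hf) hv.
  have hcy : cteq w y m by apply/(enc_cteq hw h2); rewrite -ev.
  rewrite -/l in h1 h5; split.
  - by case: h1.
  - by move=> l' y' hy' hc'; apply: (is_pat_inj hy' h1); exact: cteq_trans (cteq_sym hc') hcy.
  have -> : l != 0 by [].
  rewrite h5 in h1 *; rewrite (chkP hq hw h4 h6 hb h1 h2 hcy) e1 e2 e3 /=.
  case: hb => b1 b2 b3 b4.
  have E1 : ((if g <= m then m.+1 - dpos dir m g else 0) == 0) = (m < g).
    case: leqP => hg //; have := @ix_in dir m g; lia.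
  have E2 : ((if i.+2 < g then m.+1 - dpos dir m h else 0) == 0) = (g <= i.+2).
    case: ltnP => hg //; have := @ix_in dir m h; have := b4 hg; lia.
  rewrite E1 E2; split=> [/andP[c1 c2]|[c1 c2]].
    split=> hg.
      by move: c1; rewrite hg ltnNge hg /= !eX //; lia.
    by have [b5 _] := b4 hg; move: c2; rewrite hg leqNgt hg /= !eX //; lia.
  apply/andP; split.
    case: (ltnP m g) => //= hg; rewrite !eX; [exact: c1|lia..].
  case: (leqP g i.+2) => //= hg; have [b5 _] := b4 hg; rewrite !eX; [exact: c2|lia..].
split.
  move=> /orP[/flagged[h|[l hl h]]|]; [by left|by right; exists l => //; right|].
  move=> h; have h0 : arr s aI (index v L) != 0 by case/and3P: h.
  have [k1 _ k2] := check h0; right; exists (arr s aI (index v L)) => //.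
  by left; apply/k2.
move=> H; apply/orP; case: (boolP (arr s aF (index v L) != 0)) => hf; [by left|right].
have nf := elimN idP hf.
case: H => [h|[l hl [h|h]]]; first by case: nf; apply/flagged; left.
  have [y [f [h1 h2 h3 h4]]] := pattern_mem hl h.
  have ew : enc w m = enc y m by apply/(enc_cteq hw h2).
  have [k1 [f' k2] _] := hin h4.
  rewrite -ew in k1 k2; have ev := longest_self k1 hv; rewrite -ev in k2.
  (* Label 0 belongs to [p] itself, and a window with the tree of [p] is flagged, contrary to
     [nf]. *)
  have h0 : arr s aI (index v L) != 0.
    apply/negP => /eqP e0; rewrite e0 in k2.
    case: (hgood k2) => [[_ e1]|[y' [[]]]]; last by lia.
    by case: nf; apply/flagged; left; apply/(enc_cteq hw hq); rewrite -ev.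
  have [_ c2 c3] := check h0; apply/c3; rewrite -(c2 l y) //.
by case: nf; apply/flagged; right; exists l.
Qed.

End Window.

Lemma accepts_good e v : 0 < e <= size t -> longest L (enc x e) v ->
  accepts_at x s e (index v L) = (m <= e) && tau_ct_equiv (factor t (e - m).+1 m) p.
Proof.
move=> he hv; case: leqP => hme /=; last first.
  have hc := longest_count hv; rewrite count_enc in hc; have hvL := longest_in hv.
  apply/negP => /orP[h|/andP[h _]].
    by have [l hl] := hF hvL h; have := PL_count hl; lia.
  by have [f hf] := hI hvL h; have := PL_count hf; lia.
have het : e <= size t by lia.
have hs : size (factor t (e - m).+1 m) = m.
  by rewrite /factor size_takel //= size_drop; lia.
have rw : repr (factor t (e - m).+1 m) (shift (e - m) x).
  by apply: repr_take; apply: repr_drop; exact: repr_rk.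
have H := accepts_window hme het (window_longest hme hv).
have T := tau_ct_equivP hs erefl rw (@repr_rk p) (window_inj hme het) hq.
by apply/idP/T => /H.
Qed.

End Correct.

(** * The algorithm *)

Definition matcher :=
  rank ;; Set_ vflag (Num 1) ;; insert ;;
  patF true ;; patF false ;; patI true ;; patI false ;; bfs ;; scan.

Definition zero_state := State (fun=> 0) (fun _ _ => 0).

Lemma db_zero m : 0 < m -> db m zero_state [::] [:: [::]].
Proof.
move=> hm; split=> //.
- by split=> //; exact: trie_mem_init.
- by move=> w; rewrite inE => /eqP->.
Qed.

Lemma enc1_in L x n : prefix_tree L -> 0 < n -> enc x n \in L -> [:: true] \in L.
Proof.
move=> hL; case: n => // n _; elim: n => [//|n IH] /(pt_closed hL) h.
apply: IH; move: (pops x n.+1) h => j; elim: j => [|j IHj]; first by rewrite cats0.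
rewrite -[j.+1]addn1 nseqD catA cats1 => /(pt_closed hL); exact: IHj.
Qed.

Section Matcher.
Variables (p t : seq int).
Local Notation m := (size p).
Local Notation q := (rk p).
Hypothesis hp : uniq p.
Hypothesis ht : uniq t.
Hypothesis m_gt0 : 0 < m.

(** In units of [m ^ 2]: 2 for [rank], 2 for inserting [p], 4 for each [patF], 7 for each [patI],
    and at most 20 for [bfs], bounded by the size of the trie; [scan] adds [3 * size t]. *)
Lemma matcher_ok : tri p t (20 * m ^ 2) zero_state matcher (50 * m ^ 2 + 3 * size t)
  (fun _ s => var s vres = tau_ct_count p t).
Proof.
set sb := 20 * m ^ 2; set T := 50 * m ^ 2 + _.
have hmm : m <= m ^ 2 by rewrite -{1}(expn1 m) leq_pexp2l.
have e4 : 4 * m * m = 4 * m ^ 2 by rewrite -mulnA.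
have e7 : 7 * m * m = 7 * m ^ 2 by rewrite -mulnA.
have e2 : 2 * m * m = 2 * m ^ 2 by rewrite -mulnA.
(* There are at most [1 + m + m + 2 * m + 2 * m] insertions of words with at most [2 * m] letters;
   the additional 1 in [6 * m + 2] comes from the successor in the premises. *)
have hsb k : k <= 6 * m + 2 -> 1 + 2 * m * k <= sb.
  move=> hk; have : 2 * m * k <= 2 * m * (6 * m + 2) by rewrite leq_mul2l hk orbT.
  have -> : 2 * m * (6 * m + 2) = 12 * m ^ 2 + 4 * m by rewrite expnS expn1; lia.
  rewrite /sb; lia.
have hq0 := @rk_out p; have hqe := @rk_even p; have hqi := rk_inj hp.
have hmsb : m.+1 < sb by rewrite /sb; lia.
apply: tri_seq; apply: tri_use.
  by apply: (rank_ok _ (Tb := 48 * m ^ 2 + 3 * size t)) => //; rewrite /T; lia.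
move=> T1 s1 hs1 [hT1 hE1].
have hdb1 : db m s1 [::] [:: [::]] by apply: (db_same hs1) => //; exact: db_zero.
have hl1 : var s1 vlab = 0 by rewrite (proj1 hs1).
have hf1 i : arr s1 aFail i = 0 by rewrite (proj2 hs1).
apply: tri_seq; apply: tri_set; apply: tri_seq; apply: tri_use.
  apply: (insert_db _ _ (y := q) (m := m) (Tb := 46 * m ^ 2 + 3 * size t) (PL := [::])
    (L := [:: [::]])) => //=.
  - exact: proj1 hE1.
  - by move=> k _; exact: (proj2 hE1).
  - by apply: db_setv.
  - by apply: hsb; lia.
  - lia.
  - lia.
move=> T2 s2 [sv2 sa2]; rewrite /= hl1 => -[hT2 [L2 hdb2]].
set PL2 := [:: _] in hdb2.
have hE2 : env m q s2.
  by split=> [|k]; [rewrite sv2 //; exact: (proj1 hE1)|rewrite sa2 //; exact: (proj2 hE1)].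
have hf2 i : arr s2 aFail i = 0 by rewrite sa2 //; exact: hf1.
have hg2 : good m q PL2 by move=> w l f; rewrite inE => /eqP[-> -> _]; left.
apply: tri_seq; apply: tri_use.
  apply: (patF_ok _ _ m_gt0 hq0 hqe hqi true (Tb := 42 * m ^ 2 + 3 * size t) hE2 hdb2 hg2) => //.
    by apply: hsb; rewrite /=; lia.
  by rewrite e4; lia.
move=> T3 s3 [sv3 sa3] [hT3 [PL3 [L3 [[hE3 hdb3] hg3 hz3 hc3 hs3]]]].
have hf3 i : arr s3 aFail i = 0 by rewrite sa3.
apply: tri_seq; apply: tri_use.
  apply: (patF_ok _ _ m_gt0 hq0 hqe hqi false (Tb := 38 * m ^ 2 + 3 * size t) hE3 hdb3 hg3) => //.
    by apply: hsb; move: hz3; rewrite /=; lia.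
  by rewrite e4; lia.
move=> T4 s4 [sv4 sa4] [hT4 [PL4 [L4 [[hE4 hdb4] hg4 hz4 hc4 hs4]]]].
have hf4 i : arr s4 aFail i = 0 by rewrite sa4.
apply: tri_seq; apply: tri_use.
  apply: (patI_ok _ _ m_gt0 hq0 hqe hqi true (Tb := 31 * m ^ 2 + 3 * size t) hE4 hdb4 hg4) => //.
    by apply: hsb; move: hz3 hz4; rewrite /=; lia.
  by rewrite e7; lia.
move=> T5 s5 [sv5 sa5] [hT5 [PL5 [L5 [hE5 [hdb5 hc5] [hg5 hs5] hz5 _]]]].
have hf5 i : arr s5 aFail i = 0 by rewrite sa5.
apply: tri_seq; apply: tri_use.
  apply: (patI_ok _ _ m_gt0 hq0 hqe hqi false (Tb := 24 * m ^ 2 + 3 * size t) hE5 hdb5 hg5) => //.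
    by apply: hsb; move: hz3 hz4 hz5; rewrite /=; lia.
  by rewrite e7; lia.
move=> T6 s6 [sv6 sa6] [hT6 [PL6 [L6 [hE6 [hdb6 hc6] [hg6 hs6] hz6 hslot]]]].
have hf6 i : arr s6 aFail i = 0 by rewrite sa6.
have hc6' dir : covI m q dir m s6 PL6.
  case: dir => // i h1 h2 h3; have [k1 k2 k3] := hc5 i h1 h2 h3.
  by split; [exact: hs6|exact: hs6|apply: hslot => //; lia].
have hcF dir : covF m q dir m PL6.
  case: dir => f i h1 h2 h3 h4 h5; apply/hs6/hs5; first by apply: hs4; exact: hc3.
  exact: hc4.
have hpin : (enc q m, 0, true) \in PL6.
  by apply/hs6/hs5/hs4/hs3; rewrite inE eqxx.
have hL6 : size L6 <= sb.
  apply: leq_trans (db_size hdb6) _; apply: hsb; move: hz3 hz4 hz5 hz6; rewrite /=; lia.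
clear sv2 sa2 sv3 sa3 sv4 sa4 sv5 sa5 sv6 sa6 hs1 hdb1 hdb2 hdb3 hdb4 hdb5.
have [[hm6 _] _ _ hcnt hin hF hI _] := hdb6.
have hpt : prefix_tree L6 := hm6.
apply: tri_seq; apply: tri_use.
  apply: (bfs_ok _ _ hpt hL6 (Tb := 3 * size t) hm6 _ hf6).
    by have [h _ _] := hin _ _ _ hpin; exact: enc1_in hpt m_gt0 h.
  by rewrite /sb in hL6; lia.
move=> T7 s7 [sv7 sa7] [hT7 hgoto].
have hA a i : a \in [:: aDep; aI; aF; aV; aLo; aHi] -> arr s7 a i = arr s6 a i.
  by rewrite !inE => ha; apply: sa7; move: ha; do 5![case/orP => [/eqP->//|]]; move/eqP->.
have hM7 : var s7 vM = m by rewrite sv7 //; exact: proj1 hE6.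
clear sv7 sa7.
have hin7 w l f : (w, l, f) \in PL6 -> [/\ w \in L6,
    exists f', (w, arr s7 aI (index w L6), f') \in PL6 & f -> arr s7 aF (index w L6) != 0].
  by move=> h; rewrite !hA //; exact: hin h.
have hF7 w : w \in L6 -> arr s7 aF (index w L6) != 0 -> exists l, (w, l, true) \in PL6.
  by rewrite hA //; exact: hF.
have hI7 w : w \in L6 -> arr s7 aI (index w L6) != 0 ->
    exists f, (w, arr s7 aI (index w L6), f) \in PL6.
  by rewrite hA //; exact: hI.
have hcI7 dir : covI m q dir m s7 PL6.
  move=> i h1 h2 h3; have [k1 k2 k3] := hc6' dir i h1 h2 h3; split=> //.
  apply: (slot_frame k3) => a ha; apply: hA; move: ha; rewrite !inE.
  by case/or3P => ->; rewrite ?orbT.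
apply: tri_use.
  apply: (scan_ok p (x := rk t) (L := L6) (m := m) (Tb := 0) m_gt0 hpt hcnt _ _
    (good := fun e => (m <= e) && tau_ct_equiv (factor t (e - m).+1 m) p)) => //.
  - by apply: leq_trans (ltnW (ltnW hmsb)).
  - move=> a b ha hb; have := @repr_rk t a.-1 b.-1; rewrite !prednK; [apply|..]; lia.
  - by move=> w hw; rewrite hA //; exact: (tm_dep hm6).
  - by move=> w hw h0; exact: (label_bounds hp ht m_gt0 hI7 hg6 hpin hcI7 hw h0).
  - move=> e v he hv.
    exact: (accepts_good hp ht m_gt0 hcnt hin7 hF7 hI7 hg6 hpin hcF hcI7 he hv).
  - lia.
by move=> T8 s8 _ ->; rewrite tau_ct_count_end.
Qed.

End Matcher.

(** The constant factor is absorbed into the exponent, since [c < N ^ c] for [N > 1]. *)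
Lemma word_bound K N : 1 < N -> (112 + 848 * K) * N ^ 2 < N ^ (2 + (112 + 848 * K)).
Proof. by move=> hN; rewrite expnD mulnC ltn_pmul2l ?expn_gt0 ?(ltnW hN) // ltn_expl. Qed.

Theorem theorem2 :
  exists (prog : seq instr) (c C : nat),
    forall p t : seq int,
      uniq p -> uniq t -> 0 < size p ->
      let m := size p in
      let n := size t in
      exists k sp : nat,
        runs_to prog p t ((m + n + 2) ^ c) (tau_ct_count p t) k sp /\
        k <= C * ((m ^ 2 + n) * (trunc_log 2 m).+1) /\
        sp <= C * m ^ 2.
Proof.
have hwf : wfc matcher by [].
(* Hides the numeral behind a variable, so that arithmetic never unfolds the program; likewise for
   its length. *)
have [K eK] : exists K, grc matcher = K by eexists.
have [len el] : exists len, size (ccmd 0 matcher) = len by eexists.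
exists (ccmd 0 matcher ++ [:: IHalt vres]), (2 + (112 + 848 * K)), (54 * len + 400).
move=> p t hp ht hm m n.
set T := 50 * m ^ 2 + 3 * n.
have hmm : m <= m ^ 2 by rewrite -{1}(expn1 m) leq_pexp2l.
(* With [N = m + n + 2] one has [T.+1 <= 53 * N ^ 2]; then [848 = 16 * 53] and [112 = 16 + 96]. *)
have hW : 16 * (m + n + T.+1 * K) + 96 < (m + n + 2) ^ (2 + (112 + 848 * K)).
  apply: leq_ltn_trans (word_bound K (N := m + n + 2) _); last lia.
  set N := m + n + 2.
  have hN : N <= N ^ 2 by rewrite -{1}(expn1 N) leq_pexp2l // /N; lia.
  have hN2 : m ^ 2 <= N ^ 2 by rewrite leq_exp2r // /N; lia.
  have hT : T.+1 * K <= 53 * N ^ 2 * K by rewrite leq_mul2r; apply/orP; right; rewrite /T; lia.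
  have e : (112 + 848 * K) * N ^ 2 = 112 * N ^ 2 + 16 * (53 * N ^ 2 * K) by lia.
  rewrite e; have hmN : m + n + 2 <= N ^ 2 by []; lia.
rewrite -{1}eK in hW.
have [k [sp [h1 h2 h3]]] := tri_runs_to hwf (isT : vres < 48) (matcher_ok hp ht hm) hW.
exists k, sp; split=> //; split; last first.
  (* The space bound is [64 + 16 * 20 * m ^ 2], at most [384 * m ^ 2] because [m] is positive. *)
  apply: leq_trans h3 _; apply: (@leq_trans (400 * m ^ 2)); first lia.
  by rewrite leq_mul2r leq_addl orbT.
rewrite el -/T in h2.
(* The two-letter alphabet gives constant-time transitions, so the time is linear in [m ^ 2 + n] and
   fits in the summand 1 that [mulnS] splits off from the logarithmic factor. *)
apply: leq_trans h2 _; rewrite [X in _ <= _ * X]mulnS mulnDr.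
apply: leq_trans (leq_addr _ _).
have hT : T.+1 <= 54 * (m ^ 2 + n) by rewrite /T; lia.
have hTl : T.+1 * len <= 54 * (m ^ 2 + n) * len by rewrite leq_mul2r hT orbT.
have e : (54 * len + 400) * (m ^ 2 + n) = 54 * (m ^ 2 + n) * len + 400 * (m ^ 2 + n) by lia.
rewrite e; lia.
Qed.
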